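(* Let $G$ be a circular-arc graph given together with a $k$-fold proper circular-arc representation $\mathcal A$ of $G$. Then the FO model checking problem for $G$ (deciding $G\models\phi$ for an FO sentence $\phi$) is fixed-parameter tractable with respect to the parameters $k$ and $|\phi|$; i.e., it can be solved in time $f(k,|\phi|)\cdot n^{O(1)}$ for a computable function $f$, where $n$ is the input size.
   Context: A circular-arc graph is the intersection graph of a finite family of arcs on a circle (vertices are the arcs, two adjacent iff they intersect); such a family is a circular-arc representation. A set of arcs (or intervals) is proper if no member is contained in another; it is $k$-fold proper if it can be partitioned into $k$ proper sets, equivalently if it contains no chain of $k+1$ arcs nested by inclusion. Graphs may carry vertex labels (unary predicates), and FO logic of graphs uses quantification over vertices, equality, the adjacency predicate and label predicates. *)

(* Defs.v *)
From mathcomp Require Import all_boot all_order all_algebra.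
From mathcomp Require Import reals.

Set Implicit Arguments.
Unset Strict Implicit.
Unset Printing Implicit Defensive.

Import Order.TTheory GRing.Theory Num.Theory.

(* Random access machines with directly addressed registers and an unbounded
   memory of natural numbers, under uniform cost.  The only arithmetic is
   addition and truncated subtraction, so each step increases the longest word
   by at most one bit (constants of the program aside), and running times are
   polynomially related to those of Turing machines. *)
Inductive instr : Type :=
  | Const of nat & nat          (* Const d v:   reg[d] := v               *)
  | Add of nat & nat & nat      (* Add d a b:   reg[d] := reg[a] + reg[b] *)
  | Sub of nat & nat & nat      (* Sub d a b:   reg[d] := reg[a] - reg[b] *)
  | Get of nat & nat            (* Get d a:     reg[d] := mem[reg[a]]     *)
  | Put of nat & nat            (* Put a b:     mem[reg[a]] := reg[b]     *)
  | JmpZ of nat & nat.          (* JmpZ a l:    if reg[a] = 0 goto l      *)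

Definition program : Type := seq instr.

Record config : Type := Config { pc : nat; reg : nat -> nat; mem : nat -> nat }.

Definition upd (h : nat -> nat) (a v : nat) : nat -> nat :=
  fun x => if x == a then v else h x.

Definition exec (i : instr) (c : config) : config :=
  let: Config p r m := c in
  match i with
  | Const d v => Config p.+1 (upd r d v) m
  | Add d a b => Config p.+1 (upd r d (r a + r b)) m
  | Sub d a b => Config p.+1 (upd r d (r a - r b)) m
  | Get d a => Config p.+1 (upd r d (m (r a))) m
  | Put a b => Config p.+1 r (upd m (r a) (r b))
  | JmpZ a l => Config (if r a == 0 then l else p.+1) r m
  end.

(* The machine halts when the program counter leaves the program. *)
Definition step (P : program) (c : config) : option config :=
  omap (exec^~ c) (onth P (pc c)).

(* [run P t c = Some v] iff from [c] the machine halts after at most [t] steps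
   with [v] in register 0. *)
Fixpoint run (P : program) (t : nat) (c : config) : option nat :=
  if step P c is Some c' then
    if t is t'.+1 then run P t' c' else None
  else Some (reg c 0).

Definition init (w : seq nat) : config :=
  Config 0 (upd (fun=> 0) 0 (size w)) (nth 0 w).

Definition computable2 (f : nat -> nat -> nat) : Prop :=
  exists P : program, forall a b : nat, exists t : nat,
    run P t (init [:: a; b]) = Some (f a b).

Definition bitsize (w : seq nat) : nat := \sum_(x <- w) (trunc_log 2 x).+1.

(* [fo L m]: first-order formulas over adjacency, equality and [L] labels, with
   free variables among [m] de Bruijn indices (0 is the innermost quantifier).
   Sentences are the elements of [fo L 0]. *)
Inductive fo (L : nat) : nat -> Type :=
  | FEq m of 'I_m & 'I_m : fo L m
  | FAdj m of 'I_m & 'I_m : fo L m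
  | FLab m of 'I_L & 'I_m : fo L m
  | FNot m of fo L m : fo L m
  | FAnd m of fo L m & fo L m : fo L m
  | FOr m of fo L m & fo L m : fo L m
  | FEx m of fo L m.+1 : fo L m
  | FAll m of fo L m.+1 : fo L m.

Fixpoint fo_code (L m : nat) (phi : fo L m) : seq nat :=
  match phi with
  | FEq _ x y => [:: 0; val x; val y]
  | FAdj _ x y => [:: 1; val x; val y]
  | FLab _ l x => [:: 2; val l; val x]
  | FNot _ a => 3 :: fo_code a
  | FAnd _ a b => 4 :: fo_code a ++ fo_code b
  | FOr _ a b => 5 :: fo_code a ++ fo_code b
  | FEx _ a => 6 :: fo_code a
  | FAll _ a => 7 :: fo_code a
  end.

Definition fo_size (L m : nat) (phi : fo L m) : nat := size (fo_code phi).

Record lgraph (L n : nat) : Type := LGraph {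
  adj : rel 'I_n;
  adj_sym : symmetric adj;
  adj_irr : irreflexive adj;
  lab : 'I_L -> pred 'I_n
}.

Definition scons (T : Type) (m : nat) (v : T) (e : 'I_m -> T) : 'I_m.+1 -> T :=
  fun i => if unlift ord0 i is Some j then e j else v.

Fixpoint sat (L n m : nat) (G : lgraph L n) (phi : fo L m) :
    ('I_m -> 'I_n) -> bool :=
  match phi in fo _ m return ('I_m -> 'I_n) -> bool with
  | FEq _ x y => fun e => e x == e y
  | FAdj _ x y => fun e => adj G (e x) (e y)
  | FLab _ l x => fun e => lab G l (e x)
  | FNot _ a => fun e => ~~ sat G a e
  | FAnd _ a b => fun e => sat G a e && sat G b e
  | FOr _ a b => fun e => sat G a e || sat G b e
  | FEx _ a => fun e => [exists v : 'I_n, sat G a (scons v e)]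
  | FAll _ a => fun e => [forall v : 'I_n, sat G a (scons v e)]
  end.

Definition no_vars (T : Type) (i : 'I_0) : T :=
  let: Ordinal _ h := i in False_rect T (notF h).

Definition models (L n : nat) (G : lgraph L n) (phi : fo L 0) : bool :=
  sat G phi (@no_vars 'I_n).

Local Open Scope ring_scope.

(* The circle of circumference 1, cut open at the point 0. *)
Definition circle (R : realType) : Type := {x : R | 0 <= x < 1}.

(* [(s, t)] is the closed arc traversed in the positive direction from [s] to
   [t]; it passes through the point 0 when [t < s]. *)
Definition circ_arc (R : realType) : Type := (circle R * circle R)%type.

Definition in_arc (R : realType) (a : circ_arc R) (p : circle R) : bool :=
  let s := val a.1 in let t := val a.2 in
  if s <= t then s <= val p <= t else (s <= val p) || (val p <= t).

Definition arc_meets (R : realType) (a b : circ_arc R) : Prop :=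
  exists p : circle R, in_arc a p /\ in_arc b p.

Definition arc_sub (R : realType) (a b : circ_arc R) : Prop :=
  forall p : circle R, in_arc a p -> in_arc b p.

Definition represents (R : realType) (L n : nat)
    (A : 'I_n -> circ_arc R) (G : lgraph L n) : Prop :=
  forall i j : 'I_n, i != j -> (adj G i j <-> arc_meets (A i) (A j)).

Definition proper_on (R : realType) (n : nat)
    (A : 'I_n -> circ_arc R) (S : {set 'I_n}) : Prop :=
  forall i j : 'I_n, i \in S -> j \in S -> i != j -> ~ arc_sub (A i) (A j).

Definition kfold_proper (R : realType) (n k : nat) (A : 'I_n -> circ_arc R) : Prop :=
  exists col : 'I_n -> 'I_k,
    forall c : 'I_k, proper_on A [set i | col i == c].

(* Real endpoints are handed to the machine through their order type: an
   endpoint is described by the number of endpoints strictly below it. *)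
Definition endpoint (R : realType) (n : nat) (A : 'I_n -> circ_arc R)
    (q : 'I_n * bool) : R :=
  if q.2 then val (A q.1).2 else val (A q.1).1.

Definition endpoint_rank (R : realType) (n : nat) (A : 'I_n -> circ_arc R)
    (q : 'I_n * bool) : nat :=
  #|[set q' : 'I_n * bool | endpoint A q' < endpoint A q]|.

Definition encode (R : realType) (L n : nat) (G : lgraph L n)
    (A : 'I_n -> circ_arc R) (phi : fo L 0) : seq nat :=
  [:: n; L]
  ++ [seq nat_of_bool (adj G i j) | i <- enum 'I_n, j <- enum 'I_n]
  ++ [seq nat_of_bool (lab G l i) | l <- enum 'I_L, i <- enum 'I_n]
  ++ [seq endpoint_rank A (i, b) | i <- enum 'I_n, b <- [:: false; true]]
  ++ fo_code phi.

(* Main.v *)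
Require Import Defs.
From mathcomp Require Import all_boot all_order all_algebra.
From mathcomp Require Import reals.
From mathcomp Require Import zify.

Set Implicit Arguments.
Unset Strict Implicit.
Unset Printing Implicit Defensive.

(** Only the order of the end points matters, so a representation is a linear order of [2 n] points
    with the involution [s] that swaps the two ends of an arc.  Split the arcs according to whether
    they pass through 0 and to the height in the nesting order; in a k-fold proper representation
    this gives at most [2 k] classes, and [s] is monotone on each of them.  Consider the moves
    [x |-> s x] and [x |-> the first (last) point of the class P after (before) x].  The two
    families of order moves are adjoint to each other, hence any comparison of an image of [x]
    under few moves with a landmark can be unwound to a comparison of [x] itself with a landmark a
    few moves further.  Therefore, in an Ehrenfeucht-Fraisse game a chosen point may be replaced
    by any point lying between the same landmarks with the same local type, for instance by the
    first one after a landmark, once the classes have been refined by these local types.  It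
    follows that a quantifier may be restricted to a set of bounded size, obtained from the end
    of the line by boundedly many moves; over these sets the formula is evaluated by brute force.

    The random access machine is programmed through a calculus of computable functions on
    lists, represented by cons cells in its memory; if all lists that occur have length at most
    [K], the running time is at most a fixed power of [K]. *)

(** * Random access machine programs *)

(** The partition into [k] proper sets is not part of the input; only its existence is known.
    Heights in the nesting order replace it: the members of a nested chain have different colours,
    so at most [k] heights occur, while equal height excludes nesting, and this is what makes the
    swap of ends monotone. A comparison of [s x] with a landmark is unwound by rounding the landmark
    to the class of [s x] and then applying [s] to both sides; this costs two moves, an order move
    costs one. Hence words of length [r] need landmarks of radius [3 r], the new point takes one
    move more, and composition with a word of length [r] gives the recursion [4 r + 1] for the
    radius. The number of refined classes stays bounded because a local type is a list of bits whose
    length depends only on the radius and on the previous number of classes. The number of labels is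
    not a parameter either, so the classes distinguish only labels that can occur in the formula.
    Coinciding end points are separated by a perturbation that puts left ends first, so that closed
    arcs that touch still meet. *)

Definition steps (P : program) (t : nat) (c : config) : option config :=
  iter t (obind (step P)) (Some c).
Arguments steps : simpl never.

Lemma steps_add P s t c c1 c2 :
  steps P s c = Some c1 -> steps P t c1 = Some c2 -> steps P (s + t) c = Some c2.
Proof. by rewrite /steps addnC iterD => ->. Qed.

Lemma run_steps P t s c c' : steps P t c = Some c' -> run P (t + s) c = run P s c'.
Proof.
elim: t c => [|t IH] c; first by rewrite /steps => -[->].
rewrite /steps iterSr /=; case E: (step P c) => [c1|] /=; first exact: IH.
by have -> : iter t (obind (step P)) None = None by elim: t {IH} => //= t ->.
Qed.

Definition placed (P : program) (b : nat) (s : seq instr) : Prop :=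
  forall i x, onth s i = Some x -> onth P (b + i) = Some x.

Lemma placed_cat P b s1 s2 :
  placed P b (s1 ++ s2) -> placed P b s1 /\ placed P (b + size s1) s2.
Proof.
move=> h; split=> i x hx.
- apply: h; rewrite onth_cat; case: ifP => // hi.
  by move: hx; rewrite onth_default // leqNgt hi.
- by rewrite -addnA; apply: h; rewrite onth_cat ltnNge leq_addr /= addKn.
Qed.

Lemma placed_step P b i s r m : placed P b (i :: s) ->
  steps P 1 (Config b r m) = Some (exec i (Config b r m)).
Proof. by move=> h; rewrite /steps /= /step /=; have := h 0 i erefl; rewrite addn0 => ->. Qed.

Definition straight (i : instr) : bool := if i is JmpZ _ _ then false else true.

Fixpoint blk (s : seq instr) (r m : nat -> nat) : (nat -> nat) * (nat -> nat) :=
  if s is i :: s' then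
    match i with
    | Const d v => blk s' (upd r d v) m
    | Add d a b => blk s' (upd r d (r a + r b)) m
    | Defs.Sub d a b => blk s' (upd r d (r a - r b)) m
    | Get d a => blk s' (upd r d (m (r a))) m
    | Put a b => blk s' r (upd m (r a) (r b))
    | JmpZ _ _ => blk s' r m
    end
  else (r, m).

Lemma steps_blk P b s r m : all straight s -> placed P b s ->
  steps P (size s) (Config b r m)
  = Some (Config (b + size s) (blk s r m).1 (blk s r m).2).
Proof.
elim: s b r m => [|i s IH] b r m /=; first by rewrite addn0.
case/andP=> hi hs hp.
have hp' : placed P b.+1 s.
  by move=> j x hj; rewrite addSnnS; apply: hp.
rewrite -addSnnS; apply: (@steps_add _ 1 _ _ _ _ (placed_step r m hp)).
by case: i hi {hp} => [d v|d a a'|d a a'|d a|a a'|] //= _; apply: IH.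
Qed.

(* [drep m h w x]: the word [w] stands for [x] in the heap [m] below the address [h].
   [dfits K x]: all the lists that make up [x] have length at most [K]; the size of numbers is
   irrelevant under uniform cost. *)
Structure dtype := DType {
  dsort :> Type;
  drep : (nat -> nat) -> nat -> nat -> dsort -> Prop;
  dfits : nat -> dsort -> Prop;
  drep_le : forall m m' h h' w x, h <= h' -> (forall a, a < h -> m' a = m a) ->
    drep m h w x -> drep m' h' w x;
  dfits_le : forall K K' x, K <= K' -> dfits K x -> dfits K' x
}.

Definition nat_rep (m : nat -> nat) (h w x : nat) := w = x.
Program Canonical nat_dt := @DType nat nat_rep (fun _ _ => True) _ _.

Definition bool_rep (m : nat -> nat) (h w : nat) (x : bool) := w = nat_of_bool x.
Program Canonical bool_dt := @DType bool bool_rep (fun _ _ => True) _ _.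

Section Compound.
Variables A B : dtype.

(** Address 0 has to be kept free for [[::]] only, but [0 < w] is asked of pairs too: a pair and a
    cons cell then have the same layout, and [spec_cons] needs no instruction. *)
Definition prod_rep (m : nat -> nat) (h w : nat) (x : A * B) :=
  [/\ 0 < w, w.+1 < h, drep m h (m w) x.1 & drep m h (m w.+1) x.2].
Definition prod_fits K (x : A * B) := dfits K x.1 /\ dfits K x.2.

Lemma prod_rep_le m m' h h' w x : h <= h' -> (forall a, a < h -> m' a = m a) ->
    prod_rep m h w x -> prod_rep m' h' w x.
Proof.
move=> hh hm [w0 wh h1 h2]; split=> //; first exact: leq_trans hh.
- by rewrite hm; [exact: drep_le hh hm h1 | lia].
- by rewrite hm; [exact: drep_le hh hm h2 | lia].
Qed.

Lemma prod_fits_le K K' x : K <= K' -> prod_fits K x -> prod_fits K' x.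
Proof. by move=> h [h1 h2]; split; apply: dfits_le h _. Qed.

Canonical prod_dt := DType prod_rep_le prod_fits_le.

Fixpoint seq_rep (m : nat -> nat) (h w : nat) (x : seq A) :=
  if x is y :: x' then [/\ 0 < w, w.+1 < h, drep m h (m w) y & seq_rep m h (m w.+1) x']
  else w = 0.
Definition seq_fits K (x : seq A) := size x <= K /\ foldr (fun y p => dfits K y /\ p) True x.

Lemma seq_rep_le m m' h h' w x : h <= h' -> (forall a, a < h -> m' a = m a) ->
    seq_rep m h w x -> seq_rep m' h' w x.
Proof.
move=> hh hm; elim: x w => [|y x IH] w //= [w0 wh h1 h2].
split=> //; first exact: leq_trans hh.
- by rewrite hm; [exact: drep_le hh hm h1 | lia].
- by rewrite hm; [exact: IH h2 | lia].
Qed.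

Lemma seq_fits_le K K' x : K <= K' -> seq_fits K x -> seq_fits K' x.
Proof.
move=> h [h1 h2]; split; first exact: leq_trans h.
by elim: x {h1} h2 => //= y x IH [/(dfits_le h) ? /IH].
Qed.

Canonical seq_dt := DType seq_rep_le seq_fits_le.
End Compound.

Definition good (A : dtype) (r m : nat -> nat) (x : A) := 0 < r 2 /\ drep m (r 2) (r 0) x.

(* Register 0 holds the argument and the result, register 1 a stack kept as a linked list
   in the heap, register 2 the first free heap address; the heap below it never changes. *)
Definition frame (r m r' m' : nat -> nat) :=
  [/\ r' 1 = r 1, r 2 <= r' 2 & forall a, a < r 2 -> m' a = m a].

(** The code depends on its base address [b] because jumps are absolute; its length does not, so
    that the addresses of concatenated blocks are known in advance. Registers from 3 on are
    scratch. *)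
Definition spec (A B : dtype) (f : A -> B) (T : A -> nat) : Prop :=
  exists (c : nat -> seq instr) (len : nat), (forall b, size (c b) = len) /\
  forall x P b r m, placed P b (c b) -> good r m x ->
  exists t r' m', [/\ t <= T x, steps P t (Config b r m) = Some (Config (b + len) r' m'),
    frame r m r' m' & good r' m' (f x)].

Lemma frame_trans r m r1 m1 r2 m2 :
  frame r m r1 m1 -> frame r1 m1 r2 m2 -> frame r m r2 m2.
Proof.
move=> [a1 b1 c1] [a2 b2 c2]; split; [by rewrite a2|exact: leq_trans b2|].
by move=> a ha; rewrite c2 ?c1 //; apply: leq_trans b1.
Qed.

Lemma spec_le (A B : dtype) (f : A -> B) T T' :
  (forall x, T x <= T' x) -> spec f T -> spec f T'.
Proof.
move=> hT [c [len [hl h]]]; exists c, len; split=> // x P b r m hp hg.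
have [t [r' [m' [ht hs hf hg']]]] := h x P b r m hp hg.
by exists t, r', m'; split=> //; apply: leq_trans (hT x).
Qed.

Lemma eq_spec (A B : dtype) (f g : A -> B) T : f =1 g -> spec f T -> spec g T.
Proof.
move=> hT [c [len [hl h]]]; exists c, len; split=> // x P b r m hp hg.
have [t [r' [m' [ht hs hf hg']]]] := h x P b r m hp hg.
by exists t, r', m'; split=> //; rewrite -hT.
Qed.

Lemma spec_blk (A B : dtype) (f : A -> B) s : all straight s ->
  (forall r m x, good r m x -> frame r m (blk s r m).1 (blk s r m).2 /\
     good (blk s r m).1 (blk s r m).2 (f x)) ->
  spec f (fun=> size s).
Proof.
move=> hs h; exists (fun=> s), (size s); split=> // x P b r m hp hg.
have [h1 h2] := h r m x hg.
by exists (size s), (blk s r m).1, (blk s r m).2; split=> //; apply: steps_blk.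
Qed.

Lemma spec_comp (A B C : dtype) (f : A -> B) (g : B -> C) Tf Tg :
  spec f Tf -> spec g Tg -> spec (fun x => g (f x)) (fun x => Tf x + Tg (f x)).
Proof.
move=> [c [l [hl h]]] [c' [l' [hl' h']]].
exists (fun b => c b ++ c' (b + l)), (l + l'); split=> [b|]; first by rewrite size_cat hl hl'.
move=> x P b r m /placed_cat[p1 p2] hg.
have [t [r1 [m1 [ht hs hf hg1]]]] := h x P b r m p1 hg.
rewrite hl in p2.
have [t' [r2 [m2 [ht' hs' hf' hg2]]]] := h' _ P _ r1 m1 p2 hg1.
exists (t + t'), r2, m2; split=> //; first exact: leq_add.
- by rewrite addnA; apply: steps_add hs hs'.
- exact: frame_trans hf'.
Qed.

Lemma spec_id (A : dtype) : spec (fun x : A => x) (fun=> 0).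
Proof. by apply: (@spec_blk _ _ _ [::]). Qed.

Lemma spec_nat (A : dtype) (v : nat) : spec (fun _ : A => v) (fun=> 1).
Proof. by apply: (@spec_blk _ _ _ [:: Const 0 v]) => // r m x []. Qed.

Lemma spec_bool (A : dtype) (v : bool) : spec (fun _ : A => v) (fun=> 1).
Proof. by apply: (@spec_blk _ _ _ [:: Const 0 v]) => // r m x []. Qed.

Lemma spec_nil (A B : dtype) : spec (fun _ : A => [::] : seq B) (fun=> 1).
Proof. by apply: (@spec_blk _ _ _ [:: Const 0 0]) => // r m x []. Qed.

Lemma spec_fst (A B : dtype) : spec (fun x : A * B => x.1) (fun=> 1).
Proof. by apply: (@spec_blk _ _ _ [:: Get 0 0]) => // r m x [? []]. Qed.

Lemma spec_snd (A B : dtype) : spec (fun x : A * B => x.2) (fun=> 3).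
Proof.
apply: (@spec_blk _ _ _ [:: Const 3 1; Add 0 0 3; Get 0 0]) => // r m x [? []] /=.
by rewrite /upd /= /good /= addn1.
Qed.

Lemma spec_cons (A : dtype) : spec (fun x : A * seq A => x.1 :: x.2) (fun=> 0).
Proof. by apply: (@spec_blk _ _ _ [::]). Qed.

Lemma spec_add : spec (fun x : nat * nat => x.1 + x.2) (fun=> 5).
Proof.
apply: (@spec_blk _ _ _ [:: Get 4 0; Const 3 1; Add 0 0 3; Get 0 0; Add 0 4 0]) => // r m x [? []] /=.
by rewrite /upd /= /good /frame /= addn1 /nat_rep => ? ? -> ->.
Qed.

Lemma spec_sub : spec (fun x : nat * nat => x.1 - x.2) (fun=> 5).
Proof.
apply: (@spec_blk _ _ _ [:: Get 4 0; Const 3 1; Add 0 0 3; Get 0 0; Defs.Sub 0 4 0]) => // r m x [? []] /=.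
by rewrite /upd /= /good /frame /= addn1 /nat_rep => ? ? -> ->.
Qed.

(** [pushc] saves register 0 on the stack, [swapc] exchanges it with the top, [mkpairc] pops the top
    and pairs it with register 0. [swapc] allocates a new cell instead of overwriting the top, since
    data below register 2 must never change. *)
Definition pushc : seq instr :=
  [:: Put 2 0; Const 3 1; Add 4 2 3; Put 4 1; Const 5 0; Add 1 2 5; Add 2 4 3].
Definition swapc : seq instr :=
  [:: Get 3 1; Const 5 1; Add 4 1 5; Get 4 4; Put 2 0; Add 6 2 5; Put 6 4; Const 7 0;
      Add 1 2 7; Add 2 6 5; Add 0 3 7].
Definition mkpairc : seq instr :=
  [:: Get 3 1; Const 5 1; Add 4 1 5; Get 4 4; Put 2 3; Add 6 2 5; Put 6 0; Const 7 0;
      Add 0 2 7; Add 2 6 5; Add 1 4 7].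

Definition pushed (r m : nat -> nat) (x s : nat) :=
  [/\ (r 1).+1 < r 2, 0 < r 1, m (r 1) = x & m (r 1).+1 = s].

Lemma pushedP r m : let r1 := (blk pushc r m).1 in let m1 := (blk pushc r m).2 in
  0 < r 2 -> [/\ r1 0 = r 0, r 2 <= r1 2, pushed r1 m1 (r 0) (r 1),
    r1 2 = (r 2).+2 & forall a, a < r 2 -> m1 a = m a].
Proof.
rewrite /pushed /= /upd /= !addn1 !addn0 !eqxx => h.
split=> //; first by lia.
  by split=> //; case: eqP => //; lia.
by move=> a ha; do 2 (case: eqP => [|_]; first by lia).
Qed.

Lemma swapP r m x s : let r1 := (blk swapc r m).1 in let m1 := (blk swapc r m).2 in
  0 < r 2 -> pushed r m x s -> [/\ r1 0 = x, r 2 <= r1 2, pushed r1 m1 (r 0) s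
    & forall a, a < r 2 -> m1 a = m a].
Proof.
rewrite /pushed /= /upd /= !addn1 !addn0 !eqxx => h [h1 h2 h3 h4].
split=> //; first by lia.
  by split=> //; case: eqP => //; lia.
by move=> a ha; do 2 (case: eqP => [|_]; first by lia).
Qed.

Lemma mkpairP r m x s : let r1 := (blk mkpairc r m).1 in let m1 := (blk mkpairc r m).2 in
  0 < r 2 -> pushed r m x s -> [/\ 0 < r1 0, (r1 0).+1 < r1 2, m1 (r1 0) = x, m1 (r1 0).+1 = r 0 &
   [/\ r 2 <= r1 2, r1 1 = s & forall a, a < r 2 -> m1 a = m a]].
Proof.
rewrite /pushed /= /upd /= !addn1 !addn0 !eqxx => h [h1 h2 h3 h4].
split=> //; first by case: eqP => //; lia.
split=> //; first by lia.
by move=> a ha; do 2 (case: eqP => [|_]; first by lia).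
Qed.

Lemma pushed_le r m r' m' x s :
  r' 1 = r 1 -> r 2 <= r' 2 -> (forall a, a < r 2 -> m' a = m a) ->
  pushed r m x s -> pushed r' m' x s.
Proof.
rewrite /pushed => -> h1 h2 [h3 h4 h5 h6]; split=> //; first exact: leq_trans h1.
- by rewrite h2 //; lia.
- by rewrite h2.
Qed.

Lemma good_le (A : dtype) r m r' m' (x : A) w : 0 < r 2 -> r' 0 = w -> r 2 <= r' 2 ->
  (forall a, a < r 2 -> m' a = m a) -> drep m (r 2) w x -> good r' m' x.
Proof.
move=> h0 hw h1 h2 h3; split; first exact: leq_trans h1.
by rewrite hw; apply: drep_le h3.
Qed.

(** The argument waits on the stack while [f] runs, is exchanged for [f x], and is then consumed by
    [g]. The constant is [7 + 11 + 11], the lengths of the three stack blocks. *)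
Lemma spec_pair (A B C : dtype) (f : A -> B) (g : A -> C) Tf Tg :
  spec f Tf -> spec g Tg -> spec (fun x => (f x, g x)) (fun x => Tf x + Tg x + 29).
Proof.
move=> [c [l [hl h]]] [c' [l' [hl' h']]].
exists (fun b => pushc ++ c (b + 7) ++ swapc ++ c' (b + 7 + l + 11) ++ mkpairc).
exists (7 + l + 11 + l' + 11); split=> [b|].
  by rewrite !size_cat hl hl' /=; lia.
move=> x P b r m /placed_cat[p1 /placed_cat[p2 /placed_cat[p3 /placed_cat[p4 p5]]]] [g0 gx].
rewrite hl in p3 p4 p5; rewrite hl' in p5.
have s1 := @steps_blk _ _ pushc r m isT p1.
have [e0 e2 e1 _ em] := @pushedP r m g0.
set r1 := (blk pushc r m).1 in s1 e0 e1 e2 em; set m1 := (blk pushc r m).2 in s1 e1 em.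
have [t2 [r2 [m2 [ht2 s2 [f1 f2 f3] [gy0 gy]]]]] :=
  h x P _ r1 m1 p2 (good_le g0 e0 e2 em gx).
have q2 := pushed_le f1 f2 f3 e1.
have s3 := @steps_blk _ _ swapc r2 m2 isT p3.
have [i0 i2 i1 im] := swapP gy0 q2.
set r3 := (blk swapc r2 m2).1 in s3 i0 i1 i2; set m3 := (blk swapc r2 m2).2 in s3 i1 im.
have gx2 : drep m2 (r2 2) (r 0) x.
  apply: drep_le gx; first exact: leq_trans f2.
  by move=> a ha; rewrite f3 ?em //; apply: leq_trans e2.
have [t4 [r4 [m4 [ht4 s4 [k1 k2 k3] [gz0 gz]]]]] :=
  h' x P _ r3 m3 p4 (good_le gy0 i0 i2 im gx2).
have q4 := pushed_le k1 k2 k3 i1.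
have s5 := @steps_blk _ _ mkpairc r4 m4 isT p5.
have [j0 j1 j2 j3 [j4 j5 j6]] := mkpairP gz0 q4.
set r5 := (blk mkpairc r4 m4).1 in s5 j0 j1 j2 j3 j4 j5.
set m5 := (blk mkpairc r4 m4).2 in s5 j2 j3 j6.
exists (7 + (t2 + (11 + (t4 + 11)))), r5, m5; split.
- by lia.
- apply: (steps_add s1); apply: (steps_add s2); apply: (steps_add s3).
  by apply: (steps_add s4); rewrite s5; congr (Some (Config _ _ _)); rewrite /=; lia.
- split=> //; first by lia.
  by move=> a ha; rewrite j6 ?k3 ?im ?f3 ?em //; lia.
- split; first by lia.
  split=> //; rewrite ?j2 ?j3.
  + apply: drep_le gy; first by lia.
    by move=> a ha; rewrite j6 ?k3 ?im //; lia.
  + by apply: drep_le gz.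
Qed.

Definition jmp (l : nat) : seq instr := [:: Const 7 0; JmpZ 7 l].

Lemma steps_jmp P b l r m : placed P b (jmp l) ->
  steps P 2 (Config b r m) = Some (Config l (upd r 7 0) m).
Proof.
move=> h; have h1 := placed_step r m h.
have h2 : placed P b.+1 [:: JmpZ 7 l].
  by move=> i x hx; rewrite addSnnS; apply: h.
by apply: (@steps_add _ 1 _ _ _ _ h1); rewrite (placed_step _ _ h2) /= /upd.
Qed.

Lemma steps_jmpz P b a l r m : placed P b [:: JmpZ a l] ->
  steps P 1 (Config b r m) = Some (Config (if r a == 0 then l else b.+1) r m).
Proof. exact: placed_step. Qed.

Definition loadc : seq instr := [:: Get 3 0; Const 4 1; Add 0 0 4; Get 0 0].

(** The test [s] leaves its result in register 3 and the argument of the selected branch in register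
    0. The extra cost is one conditional jump and the two instructions that skip the second
    branch. *)
Lemma branch_spec (A B C D : dtype) (p : A -> bool) (g1 : A -> C) (g2 : A -> D)
    (f1 : C -> B) (f2 : D -> B) s T1 T2 : all straight s ->
  (forall r m x, good r m x -> let r' := (blk s r m).1 in let m' := (blk s r m).2 in
     [/\ (r' 3 == 0) = ~~ p x, frame r m r' m',
         p x -> good r' m' (g1 x) & ~~ p x -> good r' m' (g2 x)]) ->
  spec f1 T1 -> spec f2 T2 ->
  spec (fun x => if p x then f1 (g1 x) else f2 (g2 x))
    (fun x => (if p x then T1 (g1 x) else T2 (g2 x)) + size s + 3).
Proof.
move=> hs hb [c [l [hl h]]] [c' [l' [hl' h']]].
pose n := size s.
exists (fun b => s ++ [:: JmpZ 3 (b + n + 1 + l + 2)] ++ c (b + n + 1)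
   ++ jmp (b + n + 1 + l + 2 + l') ++ c' (b + n + 1 + l + 2)).
exists (n + 1 + l + 2 + l'); split=> [b|]; first by rewrite !size_cat hl hl' /=; lia.
move=> x P b r m /placed_cat[p1 /placed_cat[p2 /placed_cat[p3 /placed_cat[p4 p5]]]] hg.
rewrite hl -/n /= in p2 p3 p4 p5.
have s1 := steps_blk r m hs p1.
have [e1 e2 e3 e4] := hb r m x hg.
set r1 := (blk s r m).1 in s1 e1 e2 e3 e4; set m1 := (blk s r m).2 in s1 e2 e3 e4.
have s2 := steps_jmpz r1 m1 p2.
rewrite e1 in s2; case: (p x) s2 e3 e4 => /= s2 e3 e4.
- have [t3 [r3 [m3 [ht3 s3 f3 g3]]]] := h _ P _ r1 m1 p3 (e3 isT).
  have s4 := steps_jmp r3 m3 p4.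
  exists (n + (1 + (t3 + 2))), (upd r3 7 0), m3; split.
  + by rewrite -/n; lia.
  + apply: (steps_add s1); apply: (steps_add s2); rewrite -(addn1 (b + n)).
    by apply: (steps_add s3); rewrite s4; congr (Some (Config _ _ _)); lia.
  + exact: frame_trans f3.
  + by [].
- have [t3 [r3 [m3 [ht3 s3 f3 g3]]]] := h' _ P _ r1 m1 p5 (e4 isT).
  exists (n + (1 + t3)), r3, m3; split=> //.
  + by rewrite -/n; lia.
  + apply: (steps_add s1); apply: (steps_add s2); rewrite s3.
    by congr (Some (Config _ _ _)); lia.
  + exact: frame_trans f3.
Qed.

Lemma spec_if (A B : dtype) (f g : A -> B) T1 T2 : spec f T1 -> spec g T2 ->
  spec (fun x : bool * A => if x.1 then f x.2 else g x.2)
    (fun x => (if x.1 then T1 x.2 else T2 x.2) + 4 + 3).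
Proof.
move=> h1 h2; apply: (@branch_spec (prod_dt bool_dt A) B A A (fun x => x.1) snd snd f g loadc) => //.
move=> r m [b x] [g0 [g1 g2 g3 g4]] /=; rewrite /upd /= !addn1.
rewrite /= /bool_rep in g3; rewrite g3; split=> //; by case: (b).
Qed.

Lemma spec_ifz (A B : dtype) (f g : A -> B) T1 T2 : spec f T1 -> spec g T2 ->
  spec (fun x : nat * A => if x.1 != 0 then f x.2 else g x.2)
    (fun x => (if x.1 != 0 then T1 x.2 else T2 x.2) + 4 + 3).
Proof.
move=> h1 h2; apply: (@branch_spec (prod_dt nat_dt A) B A A (fun x => x.1 != 0) snd snd f g loadc) => //.
move=> r m [b x] [g0 [g1 g2 g3 g4]] /=; rewrite /upd /= !addn1.
by rewrite /= /nat_rep in g3; rewrite g3; split=> //; rewrite negbK.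
Qed.


(** Between rounds register 0 holds the state and the top of the stack the unread part of the list.
    [enterc] establishes this, [bodyc] pairs the state with the next entry and replaces the top by
    the tail, [exitc] drops the empty list. *)
Definition enterc : seq instr :=
  [:: Const 3 1; Add 3 0 3; Get 3 3; Get 0 0; Put 2 3; Const 5 1; Add 4 2 5; Put 4 1;
      Const 6 0; Add 1 2 6; Add 2 4 5].
Definition body1 : seq instr := [:: Const 7 1; Add 4 1 7; Get 4 4; Get 5 3; Add 6 3 7; Get 6 6].
Definition body2 : seq instr :=
  [:: Put 2 0; Add 3 2 7; Put 3 5; Const 5 0; Add 0 2 5; Add 2 3 7].
Definition body3 : seq instr := [:: Put 2 6; Add 3 2 7; Put 3 4; Add 1 2 5; Add 2 3 7].
Definition bodyc : seq instr := body1 ++ body2 ++ body3.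
Definition exitc : seq instr := [:: Const 7 1; Add 1 1 7; Get 1 1].

Lemma blk_cat s1 s2 r m : blk (s1 ++ s2) r m = blk s2 (blk s1 r m).1 (blk s1 r m).2.
Proof. by elim: s1 r m => [|i s1 IH] r m //=; case: i => *; rewrite IH. Qed.

Lemma steps_chain P s t c p p' r m c' :
  steps P s c = Some (Config p r m) -> p = p' -> steps P t (Config p' r m) = Some c' ->
  steps P (s + t) c = Some c'.
Proof. by move=> h <-; apply: steps_add. Qed.

Section FoldLoop.
Variables (S T : dtype) (g : S * T -> S) (Tg : S * T -> nat).

(** [21] counts the fetch and the test of the list, the 17 instructions of [bodyc] and the two of
    the jump back. *)
Fixpoint fold_cost (s : S) (l : seq T) : nat :=
  if l is h :: l' then Tg (s, h) + 21 + fold_cost (g (s, h)) l' else 0.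

Lemma bodyP r m (s : S) (h : T) (l : seq T) st : good r m s -> pushed r m (r 3) st ->
  drep (d := seq_dt T) m (r 2) (r 3) (h :: l) ->
  let r1 := (blk bodyc r m).1 in let m1 := (blk bodyc r m).2 in
  exists w, [/\ good r1 m1 (s, h), pushed r1 m1 w st,
    drep (d := seq_dt T) m1 (r1 2) w l, r 2 <= r1 2 & forall a, a < r 2 -> m1 a = m a].
Proof.
move=> [g0 gs] [p1 p2 p3 p4] [h1 h2 h3 h4]; cbv zeta; exists (m (r 3).+1).
rewrite /bodyc !blk_cat.
set r1 := (blk body1 r m).1; set m1 := (blk body1 r m).2.
have -> : m1 = m by [].
have [e0 e2 e4 [e5 e6 e7]] : [/\ r1 0 = r 0, r1 2 = r 2, r1 4 = st &
    [/\ r1 5 = m (r 3), r1 6 = m (r 3).+1 & r1 7 = 1]].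
  by rewrite /r1 /= /upd /= !addn1 p4.
set r2 := (blk body2 r1 m).1; set m2 := (blk body2 r1 m).2.
have [f0 f2 f4 [f5 f6 f7]] : [/\ r2 0 = r 2, r2 2 = (r 2).+2, r2 4 = st &
    [/\ r2 5 = 0, r2 6 = m (r 3).+1 & r2 7 = 1]].
  by rewrite /r2 /= /upd /= e2 e4 e6 e7 addn0 !addn1.
have hm2 : forall a, m2 a = if a == (r 2).+1 then m (r 3) else if a == r 2 then r 0 else m a.
  by move=> a; rewrite /m2 /= /upd /= e2 e7 e5 e0 !addn1.
have hm3 : forall a, (blk body3 r2 m2).2 a =
    if a == (r 2).+3 then st else if a == (r 2).+2 then m (r 3).+1 else m2 a.
  by move=> a; rewrite /= /upd /= f2 f7 f6 f4 !addn1.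
have [k0 k1 k2] : [/\ (blk body3 r2 m2).1 0 = r 2, (blk body3 r2 m2).1 1 = (r 2).+2 &
    (blk body3 r2 m2).1 2 = (r 2).+4].
  by rewrite /= /upd /= f0 f2 f5 f7 addn0 !addn1.
move: (blk body3 r2 m2).2 (blk body3 r2 m2).1 hm3 k0 k1 k2 => mm rr hm3 k0 k1 k2.
have hm : forall a, a < r 2 -> mm a = m a.
  by move=> a ha; rewrite hm3 hm2; do 4 (case: eqP => [|_]; first by lia).
have em1 : mm (r 2) = r 0.
  by rewrite hm3 hm2; do 3 (case: eqP => [|_]; first by lia); rewrite eqxx.
have em2 : mm (r 2).+1 = m (r 3).
  by rewrite hm3 hm2; do 2 (case: eqP => [|_]; first by lia); rewrite eqxx.
have em3 : mm (r 2).+2 = m (r 3).+1.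
  by rewrite hm3; case: eqP => [|_]; [lia | rewrite eqxx].
have em4 : mm (r 2).+3 = st by rewrite hm3 eqxx.
rewrite /good /pushed k0 k1 k2; split=> //; try by lia.
- split; first by lia.
  split=> //=; rewrite ?em1 ?em2; first by lia.
  + by apply: drep_le gs => //; lia.
  + by apply: (drep_le _ _ h3) => //; lia.
- by apply: (@drep_le (seq_dt T)) h4 => //; lia.
Qed.

Lemma enterP r m (s : S) (l : seq T) : good r m (s, l) ->
  let r1 := (blk enterc r m).1 in let m1 := (blk enterc r m).2 in
  exists w, [/\ good r1 m1 s, pushed r1 m1 w (r 1),
    drep (d := seq_dt T) m1 (r1 2) w l, r 2 <= r1 2 & forall a, a < r 2 -> m1 a = m a].
Proof.
move=> [g0 [h1 h2 h3 h4]] /=; rewrite /= in h3 h4; exists (m (r 0).+1).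
rewrite /good /pushed /= /upd /= !addn1 !addn0 !eqxx.
set mm := (fun x => if x == (r 2).+1 then _ else _).
have hm : forall a, a < r 2 -> mm a = m a.
  by move=> a ha; rewrite /mm; do 2 (case: eqP => [|_]; first by lia).
split=> //.
- by split; [lia|apply: drep_le h3 => //; lia].
- by split=> //; rewrite ?/mm ?eqxx; repeat (case: eqP => [|_]; first by lia); lia.
- by apply: (@drep_le (seq_dt T)) h4 => //; lia.
- by lia.
Qed.

Lemma spec_foldl : spec g Tg ->
  spec (fun x : S * seq T => foldl (fun s h => g (s, h)) x.1 x.2)
    (fun x => fold_cost x.1 x.2 + 16).
Proof.
move=> [c [l [hl h]]].
exists (fun b => enterc ++ [:: Get 3 1] ++ [:: JmpZ 3 (b + 13 + 17 + l + 2)] ++ bodyc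
   ++ c (b + 13 + 17) ++ jmp (b + 11) ++ exitc), (13 + 17 + l + 2 + 3).
split=> [b|]; first by rewrite !size_cat hl /=; lia.
move=> [s0 xs0] P b r m /placed_cat[p1 /placed_cat[p2 /placed_cat[p3 /placed_cat[p4
  /placed_cat[p5 /placed_cat[p6 p7]]]]]] hg.
rewrite hl in p6 p7.
rewrite -?addnA /= in p1 p2 p3 p4 p5 p6 p7.
have s1 := @steps_blk _ _ enterc r m isT p1.
have [w [e1 e2 e3 e4 e5]] := enterP hg.
set r1 := (blk enterc r m).1 in s1 e1 e2 e3 e4; set m1 := (blk enterc r m).2 in s1 e1 e2 e3 e5.
suff loop : forall (xs : seq T) (s : S) r1 m1 w, good r1 m1 s -> pushed r1 m1 w (r 1) ->
    drep (d := seq_dt T) m1 (r1 2) w xs ->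
    exists t r' m', [/\ t <= fold_cost s xs + 5,
      steps P t (Config (b + 11) r1 m1) = Some (Config (b + (13 + (17 + (l + (2 + 3))))) r' m'),
      [/\ r' 1 = r 1, r1 2 <= r' 2 & forall a, a < r1 2 -> m' a = m1 a]
      & good r' m' (foldl (fun s h => g (s, h)) s xs)].
  have [t [r2 [m2 [ht s2 [f1 f2 f3] g2]]]] := loop xs0 s0 r1 m1 w e1 e2 e3.
  exists (11 + t), r2, m2; split=> //.
  - by rewrite /=; lia.
  - by apply: (steps_add s1); rewrite s2; congr (Some (Config _ _ _)); lia.
  - by split=> //; [lia|move=> a ha; rewrite f3 ?e5 //; lia].
move=> {s1 e1 e2 e3 e4 e5 r1 m1 w hg p1} xs.
elim: xs => [|x xs IH] s r1 m1 w gs pw hw.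
  have s2 := @steps_blk _ _ [:: Get 3 1] r1 m1 isT p2.
  case: (pw) => q1 q2 q3 q4; rewrite /= q3 in s2.
  have s3 := steps_jmpz (upd r1 3 w) m1 p3.
  rewrite {2}/upd /= hw eqxx in s3.
  rewrite -?addnA /= in s3.
  have s4 := @steps_blk _ _ exitc (upd r1 3 0) m1 isT p7.
  exists (1 + (1 + 3)), (blk exitc (upd r1 3 0) m1).1, m1; split; last 1 first.
  - case: gs => gs0 gs1; split; last exact: gs1.
    by [].
  - by rewrite /=; lia.
  - rewrite hw in s2.
    have E := fun e1 e2 => steps_chain s2 e1 (steps_chain s3 e2 s4).
    rewrite E; first by congr (Some (Config _ _ _)); rewrite /=; lia.
      by lia.
    by lia.
  - split=> //.
    by rewrite /= /upd /= addn1 q4.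
case: (pw) => q1 q2 q3 q4.
have s2 := @steps_blk _ _ [:: Get 3 1] r1 m1 isT p2.
rewrite /= q3 in s2.
have s3 := steps_jmpz (upd r1 3 w) m1 p3.
have w0 : (w == 0) = false by case: hw => ? *; apply/eqP; lia.
rewrite {2}/upd /= w0 in s3.
have s4 := @steps_blk _ _ bodyc (upd r1 3 w) m1 isT p4.
have [w' [b1 b2 b3 b4 b5]] := @bodyP (upd r1 3 w) m1 s x xs (r 1) gs pw hw.
set r2 := (blk bodyc _ _).1 in s4 b1 b2 b3 b4; set m2 := (blk bodyc _ _).2 in s4 b1 b2 b3 b5.
rewrite -?addnA /= in p5.
have [t5 [r5 [m5 [ht5 s5 [f1 f2 f3] g5]]]] := h _ P _ r2 m2 p5 b1.
have s6 := steps_jmp r5 m5 p6.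
rewrite /upd /= in b4 b5.
have b2' := pushed_le f1 f2 f3 b2.
have b3' : drep (d := seq_dt T) m5 (r5 2) w' xs by apply: (@drep_le (seq_dt T)) b3.
have [t7 [r7 [m7 [ht7 s7 [k1 k2 k3] g7]]]] := IH _ (upd r5 7 0) m5 w' g5 b2' b3'.
have {}k3 : forall a, a < r5 2 -> m7 a = m5 a := k3.
have {}k2 : r5 2 <= r7 2 := k2.
exists (1 + (1 + (17 + (t5 + (2 + t7))))), r7, m7; split=> //.
- by rewrite /=; lia.
- have E := fun e1 e2 e3 e4 e5 => steps_chain s2 e1 (steps_chain s3 e2 (steps_chain s4 e3
    (steps_chain s5 e4 (steps_chain s6 e5 s7)))).
  by rewrite E //; rewrite ?[size bodyc]/=; lia.
- split=> //; first by lia.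
  by move=> a ha; rewrite k3 ?f3 ?b5 //; lia.
Qed.
End FoldLoop.

(** Turns a number into a list that can drive a loop. The cost is linear in the number and not in
    the length of a list, so this serves only where mere computability is at stake. *)
Lemma spec_nseq : spec (fun n : nat => nseq n 0) (fun n => 10 * n + 10).
Proof.
(* Register 3 counts down; registers 4 and 6 hold the constants 1 and 0, and adding register 6
   copies a register. *)
pose body : seq instr := [:: Defs.Sub 3 3 4; Put 2 6; Add 5 2 4; Put 5 0; Add 0 2 6; Add 5 5 4; Add 2 5 6].
exists (fun b => [:: Add 3 0 6; Const 6 0; Add 3 0 6; Const 4 1; Const 0 0] ++
   [:: JmpZ 3 (b + 15)] ++ body ++ jmp (b + 5)), 15; split=> // n P b r m.
move=> /placed_cat[p1 /placed_cat[p2 /placed_cat[p3 p4]]] [g0 g1].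
have s1 := @steps_blk _ _ [:: Add 3 0 6; Const 6 0; Add 3 0 6; Const 4 1; Const 0 0] r m isT p1.
have [e0 e1 e2 [e3 e4 e6]] : let r1 := (blk [:: Add 3 0 6; Const 6 0; Add 3 0 6; Const 4 1; Const 0 0] r m).1 in
  [/\ r1 0 = 0, r1 1 = r 1, r1 2 = r 2 & [/\ r1 3 = n, r1 4 = 1 & r1 6 = 0]].
  by rewrite /= /upd /= addn0 g1.
move: {s1}(blk _ _ _).1 s1 e0 e1 e2 e3 e4 e6 => r1 s1 e0 e1 e2 e3 e4 e6.
rewrite /= in p2 p3 p4.
suff loop : forall n r1 m1 x, good r1 m1 (x : seq nat) -> r1 3 = n -> r1 4 = 1 -> r1 6 = 0 ->
    exists t r' m', [/\ t <= 10 * n + 1,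
      steps P t (Config (b + 5) r1 m1) = Some (Config (b + 15) r' m'),
      frame r1 m1 r' m' & good r' m' (nseq n 0 ++ x)].
  have gg : good r1 m ([::] : seq nat) by split; rewrite ?e2.
  have [t [r2 [m2 [ht s2 [f1 f2 f3] g2]]]] := loop n r1 m [::] gg e3 e4 e6.
  exists (5 + t), r2, m2; split=> //.
  - by lia.
  - by apply: (steps_add s1).
  - by split; rewrite ?f1 -?e2.
  - by rewrite cats0 in g2.
move=> {n r1 m s1 e0 e1 e2 e3 e4 e6 p1 g0 g1} n; elim: n => [|n IH] r1 m1 x gx e3 e4 e6.
  have s2 := steps_jmpz r1 m1 p2.
  by exists 1, r1, m1; split=> //; rewrite s2 e3.
have s2 := steps_jmpz r1 m1 p2; rewrite e3 /= in s2.
have s3 := @steps_blk _ _ body r1 m1 isT p3.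
case: (gx) => gx0 gx1.
have [f0 f1 f2 [f3 f4 f6]] : let r2 := (blk body r1 m1).1 in
   [/\ r2 0 = r1 2, r2 1 = r1 1, r2 2 = (r1 2).+2 & [/\ r2 3 = n, r2 4 = 1 & r2 6 = 0]].
  by rewrite /= /upd /= e3 e4 e6 !addn0 !addn1 subn1.
have hm : forall a, (blk body r1 m1).2 a = if a == (r1 2).+1 then r1 0 else if a == r1 2 then 0 else m1 a.
  by move=> a; rewrite /= /upd /= e4 e6 addn1.
move: (blk body r1 m1).1 (blk body r1 m1).2 s3 f0 f1 f2 f3 f4 f6 hm => r2 m2 s3 f0 f1 f2 f3 f4 f6 hm.
have s4 := steps_jmp r2 m2 p4.
have lo : forall a, a < r1 2 -> m2 a = m1 a.
  by move=> a ha; rewrite hm; do 2 (case: eqP => [|_]; first by lia).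
have g2 : good (upd r2 7 0) m2 (0 :: x).
  split; first by rewrite /upd /= f2.
  rewrite /upd /= f0 f2; split=> //.
  - by rewrite hm; case: eqP => [|_]; [lia | rewrite eqxx].
  - by rewrite hm eqxx; apply: (@drep_le (seq_dt nat_dt)) gx1 => //; lia.
have [t [r5 [m5 [ht s5 [k1 k2 k3] g5]]]] := IH _ _ _ g2 f3 f4 f6.
have {}k2 : r2 2 <= r5 2 := k2.
have {}k3 : forall a, a < r2 2 -> m5 a = m2 a := k3.
exists (1 + (7 + (2 + t))), r5, m5; split.
- by lia.
- have E := fun e1 e2 e3 => steps_chain s2 e1 (steps_chain s3 e2 (steps_chain s4 e3 s5)).
  by rewrite E //=; lia.
- split; [by rewrite k1 | by lia | by move=> a ha; rewrite k3 ?lo //; lia].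
- suff -> : nseq n.+1 0 ++ x = nseq n 0 ++ 0 :: x by [].
  by elim: (n) => //= j ->.
Qed.

(** Converts the input array into a linked list, from its last entry to the first so that consing
    yields the right order. The heap starts above the array, and register 1 is still 0, the empty
    stack. *)
Definition loader : program :=
  [:: Const 3 1; Add 2 0 3; Add 4 0 6; Const 0 0; JmpZ 4 15; Defs.Sub 4 4 3; Get 5 4; Put 2 5;
      Add 5 2 3; Put 5 0; Add 0 2 6; Add 5 5 3; Add 2 5 6; Const 7 0; JmpZ 7 4].

Lemma loader_steps P w : placed P 0 loader ->
  exists t r m, [/\ t <= 11 * size w + 5,
    steps P t (init w) = Some (Config 15 r m) & good r m w].
Proof.
move=> h; pose pre := [:: Const 3 1; Add 2 0 3; Add 4 0 6; Const 0 0].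
pose body := [:: Defs.Sub 4 4 3; Get 5 4; Put 2 5; Add 5 2 3; Put 5 0; Add 0 2 6; Add 5 5 3; Add 2 5 6].
have : placed P 0 (pre ++ [:: JmpZ 4 15] ++ body ++ jmp 4) by [].
move=> /placed_cat[p1 /placed_cat[p2 /placed_cat[p3 p4]]]; rewrite /= in p2 p3 p4.
have s1 := @steps_blk _ _ pre (upd (fun=> 0) 0 (size w)) (nth 0 w) isT p1.
suff loop : forall i r m, i <= size w -> good r m (drop i w) -> r 4 = i -> r 3 = 1 -> r 6 = 0 ->
    (forall a, a < size w -> m a = nth 0 w a) -> size w < r 2 ->
    exists t r' m', [/\ t <= 11 * i + 1,
      steps P t (Config 4 r m) = Some (Config 15 r' m') & good r' m' w].
  have [t [r [m [ht s2 g2]]]] : exists t r m, [/\ t <= 11 * size w + 1,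
      steps P t (Config 4 (blk pre (upd (fun=> 0) 0 (size w)) (nth 0 w)).1
        (blk pre (upd (fun=> 0) 0 (size w)) (nth 0 w)).2) = Some (Config 15 r m) & good r m w].
    apply: loop => //=; rewrite /upd /= ?addn1 ?addn0 //.
    by rewrite drop_size; split.
  exists (4 + t), r, m; split=> //; first by lia.
  by apply: (steps_add s1).
elim=> [|i IH] r m hi g e4 e3 e6 hm hw; have s2 := steps_jmpz r m p2; rewrite e4 /= in s2.
  by exists 1, r, m; split=> //; rewrite drop0 in g.
have s3 := @steps_blk _ _ body r m isT p3.
case: g => gx0 gx1.
have [f0 f2 f3 f4 f6] : let r2 := (blk body r m).1 in
   [/\ r2 0 = r 2, r2 2 = (r 2).+2, r2 3 = 1, r2 4 = i & r2 6 = 0].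
  by rewrite /= /upd /= e3 e4 e6 !addn0 !addn1 subn1.
have hm2 : forall a, (blk body r m).2 a =
    if a == (r 2).+1 then r 0 else if a == r 2 then nth 0 w i else m a.
  by move=> a; rewrite /= /upd /= e3 e4 addn1 subn1 /= hm.
move: (blk body r m).1 (blk body r m).2 s3 f0 f2 f3 f4 f6 hm2 => r2 m2 s3 f0 f2 f3 f4 f6 hm2.
have lo : forall a, a < r 2 -> m2 a = m a.
  by move=> a ha; rewrite hm2; do 2 (case: eqP => [|_]; first by lia).
have s4 := steps_jmp r2 m2 p4.
have [||||t [r5 [m5 [ht s5 g5]]]] := IH (upd r2 7 0) m2 _ _ f4 f3 f6.
- by lia.
- split; rewrite /upd /= f2 //; rewrite f0 (drop_nth 0) //; split=> //.
  + by rewrite hm2; case: eqP => [|_]; [lia | rewrite eqxx].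
  + by rewrite hm2 eqxx; apply: (@drep_le (seq_dt nat_dt)) gx1 => //; lia.
- by move=> a ha; rewrite lo ?hm //; lia.
- by rewrite /upd /= f2; lia.
exists (1 + (8 + (2 + t))), r5, m5; split=> //; first by lia.
have E := fun e1 e2 e3 => steps_chain s2 e1 (steps_chain s3 e2 (steps_chain s4 e3 s5)).
by rewrite E.
Qed.

Lemma spec_run (B : dtype) (out : B -> nat) (f : seq nat -> B) (T : seq nat -> nat) :
  (forall m h w x, drep m h w x -> w = out x) -> spec f T ->
  exists P : program, forall w t, 11 * size w + 5 + T w <= t ->
    run P t (init w) = Some (out (f w)).
Proof.
move=> hB [c [l [hl h]]]; exists (loader ++ c 15) => w t ht.
have hp : placed (loader ++ c 15) 0 (loader ++ c 15) by [].
have [p1 p2] := placed_cat hp.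
have [t1 [r1 [m1 [ht1 s1 g1]]]] := loader_steps w p1.
have [t2 [r2 [m2 [ht2 s2 _ [_ g2]]]]] := h w _ _ r1 m1 p2 g1.
have -> : t = t1 + t2 + (t - (t1 + t2)) by lia.
rewrite (run_steps _ (steps_add s1 s2)).
have hs : step (loader ++ c 15) (Config (15 + l) r2 m2) = None.
  by rewrite /step /= onth_default //= hl.
by case: (t - _) => [|u] /=; rewrite hs (hB _ _ _ _ g2).
Qed.

Lemma spec_computable2 (f : nat * nat -> nat) T :
  spec f T -> computable2 (fun a b => f (a, b)).
Proof.
(* The fold remembers the last two entries, which on an input of length two are the arguments in
   order. *)
pose hd2 (w : seq nat) := foldl (fun (s : nat * nat) h => (s.2, h)) (0, 0) w.
move=> h.
have h1 := spec_pair (spec_comp (@spec_fst (prod_dt nat_dt nat_dt) nat_dt) (@spec_snd nat_dt nat_dt))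
  (@spec_snd (prod_dt nat_dt nat_dt) nat_dt).
have h2 := spec_foldl h1.
have h3 := spec_pair (spec_pair (@spec_nat (seq_dt nat_dt) 0) (@spec_nat (seq_dt nat_dt) 0))
  (@spec_id (seq_dt nat_dt)).
have h4 := spec_comp (spec_comp h3 h2) h.
have [P hP] := spec_run (out := id) (fun m h w x (e : w = x) => e) h4.
by exists P => a b; eexists; rewrite hP.
Qed.

(** * Polynomial time in the length of the lists *)

(* The bound [K] is kept apart from the input: it will depend on the parameters as well, and [p]
   says for which [K] the computation on [x] stays within lists of length [K]. *)
Definition cpoly (A B : dtype) (p : A -> nat -> Prop) (f : A -> B) : Prop :=
  exists T e, spec f T /\
    forall x K, 1 < K -> p x K -> T x <= K ^ e /\ dfits (K ^ e) (f x).

Definition fitp (A : dtype) (x : A) (K : nat) : Prop := dfits K x.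

Notation ptime f := (cpoly (@fitp _) f).

(** Each of the two powers is at most [K ^ (a + b)], and [1 + 1 + 62 = 2 ^ 6 <= K ^ 6]. *)
Lemma exp_sum K a b c : 1 < K -> c <= 62 -> K ^ a + K ^ b + c <= K ^ (a + b + 6).
Proof.
move=> hK hc; have h1 : 64 <= K ^ 6 by rewrite -[64]/(2 ^ 6) leq_exp2r.
have ha : K ^ a <= K ^ (a + b) by rewrite leq_pexp2l ?leq_addr; lia.
have hb : K ^ b <= K ^ (a + b) by rewrite leq_pexp2l ?leq_addl; lia.
have h0 : 0 < K ^ (a + b) by rewrite expn_gt0; lia.
by rewrite expnD; nia.
Qed.

Lemma exp_le K a b : 1 < K -> a <= b -> K ^ a <= K ^ b.
Proof. by move=> hK hab; rewrite leq_pexp2l //; lia. Qed.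

Lemma exp_gt1 K a : 1 < K -> 0 < a -> 1 < K ^ a.
Proof. by move=> hK ha; rewrite -{1}(exp1n a) ltn_exp2r. Qed.

Lemma cpolyI (A B : dtype) (p : A -> nat -> Prop) (f : A -> B) c e : c <= 64 -> spec f (fun=> c) ->
  (forall x K, 1 < K -> p x K -> dfits (K ^ e) (f x)) -> cpoly p f.
Proof.
move=> hc hf h; exists (fun=> c), (e + 6); split=> // x K hK hp; split.
- apply: leq_trans (exp_le hK (leq_addl e 6)); apply: leq_trans hc _.
  by rewrite -[64]/(2 ^ 6) leq_exp2r.
- by apply: dfits_le (h _ _ hK hp); apply: exp_le hK (leq_addr _ _).
Qed.

Lemma eq_cpoly (A B : dtype) p (f g : A -> B) : f =1 g -> cpoly p f -> cpoly p g.
Proof.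
move=> e [T [c [h1 h2]]]; exists T, c; split; first exact: eq_spec h1.
by move=> x K hK hp; rewrite -e; apply: h2.
Qed.

Lemma cpoly_comp (A B C : dtype) p q (f : A -> B) (g : B -> C) :
  cpoly p f -> cpoly q g ->
  (exists c, forall x K, 1 < K -> p x K -> q (f x) (K ^ c.+1)) -> cpoly p (fun x => g (f x)).
Proof.
move=> [T [e [h1 h2]]] [T' [e' [h1' h2']]] [c hc].
exists (fun x => T x + T' (f x)), (e + c.+1 * e' + 6); split; first exact: spec_comp.
move=> x K hK hp; have [a1 a2] := h2 x K hK hp.
have [] := h2' (f x) (K ^ c.+1) (@exp_gt1 K c.+1 hK isT) (hc x K hK hp).
rewrite -expnM => b1 b2; split.
- by apply: leq_trans (exp_sum (c := 0) e _ hK isT); lia.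
- by apply: dfits_le b2; apply: exp_le => //; lia.
Qed.

Lemma cpoly_app (A B C : dtype) p (f : A -> B) (g : B -> C) :
  ptime g -> cpoly p f -> cpoly p (fun x => g (f x)).
Proof.
move=> hg hf; apply: (cpoly_comp hf hg).
case: hf => T [e [_ h]]; exists e => x K hK /(h x K hK) [_].
by apply: dfits_le; apply: exp_le.
Qed.

Lemma cpoly_pair (A B C : dtype) p (f : A -> B) (g : A -> C) :
  cpoly p f -> cpoly p g -> cpoly p (fun x => (f x, g x)).
Proof.
move=> [T [e [h1 h2]]] [T' [e' [h1' h2']]].
exists (fun x => T x + T' x + 29), (e + e' + 6); split; first exact: spec_pair.
move=> x K hK hp; have [a1 a2] := h2 x K hK hp; have [b1 b2] := h2' x K hK hp; split.
- by apply: leq_trans (exp_sum (c := 29) e e' hK isT); lia.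
- by split; [apply: dfits_le a2|apply: dfits_le b2]; apply: exp_le => //; lia.
Qed.

Lemma cpoly_app2 (A B C D : dtype) p (F : B -> C -> D) (f : A -> B) (g : A -> C) :
  ptime (fun z => F z.1 z.2) -> cpoly p f -> cpoly p g -> cpoly p (fun x => F (f x) (g x)).
Proof. by move=> h hf hg; apply: (cpoly_app h (cpoly_pair hf hg)). Qed.

Lemma cpoly_app3 (A B C D E : dtype) p (F : B -> C -> D -> E) (f : A -> B) (g : A -> C) (h : A -> D) :
  ptime (fun z => F z.1 z.2.1 z.2.2) -> cpoly p f -> cpoly p g -> cpoly p h ->
  cpoly p (fun x => F (f x) (g x) (h x)).
Proof. by move=> k hf hg hh; apply: (cpoly_app k (cpoly_pair hf (cpoly_pair hg hh))). Qed.

Lemma cpoly_app4 (A B C D E G : dtype) p (F : B -> C -> D -> E -> G) (f : A -> B) (g : A -> C)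
    (h : A -> D) (i : A -> E) :
  ptime (fun z => F z.1 z.2.1 z.2.2.1 z.2.2.2) -> cpoly p f -> cpoly p g -> cpoly p h ->
  cpoly p i -> cpoly p (fun x => F (f x) (g x) (h x) (i x)).
Proof.
by move=> k hf hg hh hi; apply: (cpoly_app k (cpoly_pair hf (cpoly_pair hg (cpoly_pair hh hi)))).
Qed.

Lemma ptime_id (A : dtype) : ptime (fun x : A => x).
Proof. by apply: (@cpolyI _ _ _ _ 0 1 isT (@spec_id A)) => x K; rewrite expn1. Qed.

Lemma cpoly_nat (A : dtype) p (n : nat) : cpoly p (fun _ : A => n).
Proof. exact: (@cpolyI _ _ _ _ 1 0 isT (@spec_nat A n)). Qed.

Lemma cpoly_bool (A : dtype) p (n : bool) : cpoly p (fun _ : A => n).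
Proof. exact: (@cpolyI _ _ _ _ 1 0 isT (@spec_bool A n)). Qed.

Lemma cpoly_nil (A B : dtype) p : cpoly p (fun _ : A => [::] : seq B).
Proof. exact: (@cpolyI _ _ _ _ 1 0 isT (@spec_nil A B)). Qed.

Lemma ptime_fst (A B : dtype) : ptime (fun x : A * B => x.1).
Proof. by apply: (@cpolyI _ _ _ _ _ 1 _ (@spec_fst A B)) => // x K _ []; rewrite expn1. Qed.

Lemma ptime_snd (A B : dtype) : ptime (fun x : A * B => x.2).
Proof. by apply: (@cpolyI _ _ _ _ _ 1 _ (@spec_snd A B)) => // x K _ []; rewrite expn1. Qed.

Lemma cpoly_fst (A B C : dtype) p (f : A -> B * C) : cpoly p f -> cpoly p (fun x => (f x).1).
Proof. exact: cpoly_app (@ptime_fst _ _). Qed.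

Lemma cpoly_snd (A B C : dtype) p (f : A -> B * C) : cpoly p f -> cpoly p (fun x => (f x).2).
Proof. exact: cpoly_app (@ptime_snd _ _). Qed.

Lemma cpoly_cons (A B : dtype) p (f : A -> B) (g : A -> seq B) :
  cpoly p f -> cpoly p g -> cpoly p (fun x => f x :: g x).
Proof.
apply: (@cpoly_app2 A B (seq_dt B) (seq_dt B) p cons).
apply: (@cpolyI _ _ _ _ _ 2 _ (@spec_cons B)) => // -[h t] K hK /= [h1 [h2 h3]].
have e : K < K ^ 2 by rewrite -{1}[K]expn1 ltn_exp2l.
split=> /=; first exact: leq_ltn_trans e.
split; first by apply: dfits_le h1; apply: ltnW.
by apply: (seq_fits_le (ltnW e) (conj h2 h3)).2.
Qed.

Lemma cpoly_addn (A : dtype) p (f g : A -> nat) :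
  cpoly p f -> cpoly p g -> cpoly p (fun x => f x + g x).
Proof. apply: cpoly_app2; exact: (@cpolyI _ _ _ _ _ 0 _ spec_add). Qed.

Lemma cpoly_succ (A : dtype) p (f : A -> nat) :
  cpoly p f -> cpoly p (fun x => (f x).+1).
Proof.
move=> h; apply: (@eq_cpoly A nat_dt _ (fun x => f x + 1)) => [x|]; first by rewrite addn1.
exact: cpoly_addn h (cpoly_nat _ _).
Qed.

Lemma cpoly_subn (A : dtype) p (f g : A -> nat) :
  cpoly p f -> cpoly p g -> cpoly p (fun x => f x - g x).
Proof. apply: cpoly_app2; exact: (@cpolyI _ _ _ _ _ 0 _ spec_sub). Qed.

Lemma cpoly_if (A B : dtype) p (b : A -> bool) (f g : A -> B) :
  cpoly p b -> cpoly p f -> cpoly p g -> cpoly p (fun x => if b x then f x else g x).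
Proof.
apply: (@cpoly_app3 A bool_dt B B B p (fun b x y => if b then x else y)).
have h := spec_if (@spec_fst B B) (@spec_snd B B).
have h' : spec (fun x : bool * (B * B) => if x.1 then x.2.1 else x.2.2) (fun=> 10).
  by apply: spec_le h => x; case: x.1.
by apply: (@cpolyI _ _ _ _ _ 1 _ h') => // -[[] [y z]] K _ [_ []] /=; rewrite expn1.
Qed.

Lemma cpoly_eq0 (A : dtype) p (f : A -> nat) : cpoly p f -> cpoly p (fun x => f x == 0).
Proof.
have h := spec_ifz (@spec_bool nat_dt false) (@spec_bool nat_dt true).
have h' : spec (fun x : nat => x == 0) (fun=> 37).
  apply: (@eq_spec nat_dt bool_dt (fun x : nat => if (x, x).1 != 0 then false else true)).
    by move=> x /=; case: (x == 0).
  apply: spec_le (spec_comp (spec_pair (@spec_id nat_dt) (@spec_id nat_dt)) h) => x.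
  by case: ifP.
by apply: (@cpoly_app A nat_dt bool_dt p f (fun x : nat => x == 0)); apply: (@cpolyI _ _ _ _ _ 0 _ h').
Qed.

Lemma cpoly_leq (A : dtype) p (f g : A -> nat) :
  cpoly p f -> cpoly p g -> cpoly p (fun x => f x <= g x).
Proof. by move=> hf hg; apply: cpoly_eq0; apply: cpoly_subn. Qed.

Lemma cpoly_negb (A : dtype) p (f : A -> bool) : cpoly p f -> cpoly p (fun x => ~~ f x).
Proof.
move=> h; apply: (@eq_cpoly A bool_dt p (fun x => if f x then false else true)).
  by move=> x; case: (f x).
exact: cpoly_if h (cpoly_bool _ _) (cpoly_bool _ _).
Qed.

Lemma cpoly_andb (A : dtype) p (f g : A -> bool) :
  cpoly p f -> cpoly p g -> cpoly p (fun x => f x && g x).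
Proof. by move=> h k; apply: (@cpoly_if A bool_dt) h k (cpoly_bool _ _). Qed.

Lemma cpoly_orb (A : dtype) p (f g : A -> bool) :
  cpoly p f -> cpoly p g -> cpoly p (fun x => f x || g x).
Proof. by move=> h k; apply: (@cpoly_if A bool_dt) h (cpoly_bool _ _) k. Qed.

Lemma cpoly_eqn (A : dtype) p (f g : A -> nat) :
  cpoly p f -> cpoly p g -> cpoly p (fun x => f x == g x).
Proof.
move=> hf hg; apply: (@eq_cpoly A bool_dt _ (fun x => (f x <= g x) && (g x <= f x))).
  by move=> x; rewrite eqn_leq.
by apply: cpoly_andb; apply: cpoly_leq.
Qed.

Lemma cpoly_nat_of_bool (A : dtype) p (f : A -> bool) :
  cpoly p f -> cpoly p (fun x => nat_of_bool (f x)).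
Proof.
move=> h; apply: (@eq_cpoly A nat_dt _ (fun x => if f x then 1 else 0)).
  by move=> x; case: (f x).
by apply: (@cpoly_if A nat_dt) h (cpoly_nat _ _) (cpoly_nat _ _).
Qed.

Lemma dfits_nth (T : dtype) K (l : seq T) y i :
  dfits K (l : seq_dt T) -> i < size l -> dfits K (nth y l i).
Proof. by case=> _; elim: l i => //= z l IH [|i] [h1 h2] hi //=; apply: IH. Qed.

Lemma dfits_seq (T : dtype) K (l : seq T) : size l <= K ->
  (forall y i, i < size l -> dfits K (nth y l i)) -> dfits K (l : seq_dt T).
Proof.
move=> h1 h2; split=> //; elim: l {h1} h2 => //= z l IH h2; split; first exact: (h2 z 0).
by apply: IH => y i; apply: (h2 y i.+1).
Qed.

(** Polynomial bounds for one round do not compose over an unbounded number of rounds, as the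
    exponent would grow each time. Therefore every intermediate state must be bounded in advance by
    one fixed power of [K], and must satisfy the condition [pb] of the body. *)
Lemma cpoly_foldl_gen (A S T : dtype) p (pb : A * (S * T) -> nat -> Prop)
    (b : A -> S -> T -> S) (s0 : A -> S) (l : A -> seq T) :
  cpoly pb (fun z : A * (S * T) => b z.1 z.2.1 z.2.2) ->
  cpoly p (fun x => x) -> cpoly p s0 -> cpoly p l ->
  (exists c, forall x K, 1 < K -> p x K ->
     (forall q y r, l x = q ++ y :: r -> pb (x, (foldl (b x) (s0 x) q, y)) (K ^ c.+1)) /\
     dfits (K ^ c.+1) (foldl (b x) (s0 x) (l x))) ->
  cpoly p (fun x => foldl (b x) (s0 x) (l x)).
Proof.
move=> hb hx hs hl [c hc].
(* A compiled loop body sees only its state, so the parameter [x] travels along with it. *)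
pose g (z : (A * S) * T) : A * S := (z.1.1, b z.1.1 z.1.2 z.2).
have [Tg [eg [g1 g2]]] : exists T e, spec g T /\ forall z K, 1 < K ->
    pb (z.1.1, (z.1.2, z.2)) K -> T z <= K ^ e.
  case: hb => Tb [eb [hb1 hb2]].
  have h1 := @spec_fst (prod_dt A S) T.
  have h2 := spec_pair (spec_comp h1 (@spec_fst A S))
    (spec_pair (spec_comp h1 (@spec_snd A S)) (@spec_snd (prod_dt A S) T)).
  have h3 := spec_pair (spec_comp h1 (@spec_fst A S)) (spec_comp h2 hb1).
  eexists; exists (eb + 0 + 6 + 0 + 6); split; first exact: h3.
  move=> z K hK hp; have [hT _] := hb2 _ K hK hp.
  have e1 := exp_sum (c := 62) eb 0 hK isT; have e2 := exp_sum (c := 62) (eb + 0 + 6) 0 hK isT.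
  apply: leq_trans e2; rewrite expn0 in e1 *; move: e1 hT.
  move: (K ^ eb) (K ^ (eb + 0 + 6)) => k1 k2 h4 h5.
  by apply: (@leq_trans (98 + k1)); [apply: leq_trans (leq_add (leqnn 98) h5); move: (Tb _) => tb; clear; lia | clear - h4; lia].
have [Ti [ei [i1 i2]]] := cpoly_pair (cpoly_pair hx hs) hl.
have gE x s r : foldl (fun s h => g (s, h)) (x, s) r = (x, foldl (b x) s r).
  by elim: r s => //= h r IH s; rewrite IH.
have sp := spec_comp i1 (spec_comp (spec_foldl g1) (@spec_snd A S)).
eexists; exists (c.+1 + ei + (c.+1 * eg + ei + 6) + 6); split.
  by apply: eq_spec sp => x /=; rewrite gE.
move=> x K hK hp.
have [j1 [_ j4]] := i2 x K hK hp; rewrite [_.2]/= in j4.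
have [hb1 hb2] := hc x K hK hp.
split; last by apply: dfits_le hb2; apply: exp_le => //; lia.
have cost : forall r q, l x = q ++ r ->
    fold_cost g Tg (x, foldl (b x) (s0 x) q) r <= size r * ((K ^ c.+1) ^ eg + 21).
  elim=> [|h r IH] q hq //=.
  have t1 := g2 ((x, foldl (b x) (s0 x) q), h) _ (@exp_gt1 K c.+1 hK isT) (hb1 _ _ _ hq).
  have := IH (rcons q h); rewrite cat_rcons => /(_ hq).
  by rewrite foldl_rcons mulSn /g /= => t2; lia.
have := cost (l x) [::] erefl; rewrite /= => {}cost.
have hsz : size (l x) <= K ^ ei by case: j4.
apply: leq_trans (exp_sum (c := 20) (c.+1 + ei) (c.+1 * eg + ei + 6) hK isT).
suff : size (l x) * ((K ^ c.+1) ^ eg + 21) <= K ^ (c.+1 * eg + ei + 6).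
  by have := @exp_le K ei (c.+1 + ei) hK (leq_addl _ _); lia.
have -> : c.+1 * eg + ei + 6 = ei + (c.+1 * eg + 6) by lia.
rewrite -expnM expnD; apply: leq_mul => //.
by have := exp_sum (c := 20) 0 (c.+1 * eg) hK isT; rewrite expn0 add0n; lia.
Qed.

Lemma cpoly_foldl (A S T : dtype) p (b : A -> S -> T -> S) (s0 : A -> S) (l : A -> seq T) :
  ptime (fun z : A * (S * T) => b z.1 z.2.1 z.2.2) ->
  cpoly p (fun x => x) -> cpoly p s0 -> cpoly p l ->
  (exists c, forall x K i, 1 < K -> p x K ->
     dfits (K ^ c) (foldl (b x) (s0 x) (take i (l x)))) ->
  cpoly p (fun x => foldl (b x) (s0 x) (l x)).
Proof.
move=> hb hx hs hl [c hc]; apply: (cpoly_foldl_gen hb) => //.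
have [Tx [ex [_ fx]]] := hx; have [Tl [el [_ fl]]] := hl.
exists (c + ex + el) => x K hK hp; split; last first.
  by have := hc x K (size (l x)) hK hp; rewrite take_size; apply: dfits_le; apply: exp_le => //; lia.
move=> q y r E; have [_ hx'] := fx x K hK hp; have [_ hl'] := fl x K hK hp.
split; first by apply: dfits_le hx'; apply: exp_le => //; lia.
split; first by have := hc x K (size q) hK hp; rewrite E take_size_cat //; apply: dfits_le; apply: exp_le => //; lia.
have := @dfits_nth _ _ (l x) y (size q) hl'.
rewrite E nth_cat ltnn subnn size_cat /= => H; apply: dfits_le (H _); last by lia.
by apply: exp_le => //; lia.
Qed.

Lemma ptime_foldl (A S T : dtype) (b : A -> S -> T -> S) (s0 : A -> S) (l : A -> seq T) :
  ptime (fun z : A * (S * T) => b z.1 z.2.1 z.2.2) -> ptime s0 -> ptime l ->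
  (exists c, forall x K i, 1 < K -> dfits K x ->
     dfits (K ^ c) (foldl (b x) (s0 x) (take i (l x)))) ->
  ptime (fun x => foldl (b x) (s0 x) (l x)).
Proof. by move=> hb; apply: cpoly_foldl => //; apply: ptime_id. Qed.

(* For the scalar states of a loop nothing has to be checked between its rounds. *)
Lemma ptime_foldl_flat (A S T : dtype) (b : A -> S -> T -> S) (s0 : A -> S) (l : A -> seq T) :
  (forall K (s : S), dfits K s) ->
  ptime (fun z : A * (S * T) => b z.1 z.2.1 z.2.2) -> ptime s0 -> ptime l ->
  ptime (fun x => foldl (b x) (s0 x) (l x)).
Proof. by move=> h hb hs hl; apply: ptime_foldl => //; exists 0. Qed.

Ltac pbase := idtac; lazymatch goal with
  | |- cpoly _ (fun x => x) => exact: ptime_id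
  | |- cpoly _ fst => first [exact: ptime_fst | refine (cpoly_fst (f := fun x => x) _)]
  | |- cpoly _ snd => first [exact: ptime_snd | refine (cpoly_snd (f := fun x => x) _)]
  | |- cpoly _ (fun x => (_).1) => apply: cpoly_fst
  | |- cpoly _ (fun x => (_).2) => apply: cpoly_snd
  | |- cpoly _ (fun x => (_, _)) => apply: cpoly_pair
  | |- cpoly _ (fun x => [::]) => exact: cpoly_nil
  | |- cpoly _ (fun x => _ :: _) => apply: cpoly_cons
  | |- cpoly _ (fun x => true) => exact: cpoly_bool
  | |- cpoly _ (fun x => false) => exact: cpoly_bool
  | |- cpoly _ (fun x => 0) => exact: cpoly_nat
  | |- cpoly _ (fun x => _.+1) => apply: cpoly_succ
  | |- cpoly _ (fun x => _ + _) => apply: cpoly_addn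
  | |- cpoly _ (fun x => _ - _) => apply: cpoly_subn
  | |- cpoly _ (fun x => _ <= _) => apply: cpoly_leq
  | |- cpoly _ (fun x => ~~ _) => apply: cpoly_negb
  | |- cpoly _ (fun x => _ && _) => apply: cpoly_andb
  | |- cpoly _ (fun x => _ || _) => apply: cpoly_orb
  | |- cpoly _ (fun x => if _ then _ else _) => apply: cpoly_if
  | |- cpoly _ (fun x => nat_of_bool _) => apply: cpoly_nat_of_bool
  | |- cpoly _ (fun x => @eq_op _ (_ : nat) _) => apply: cpoly_eqn
  | |- cpoly ?p (foldl ?b ?s) => change (cpoly p (fun x => foldl b s x))
  | |- cpoly _ (fun x => foldl _ _ _) => apply: ptime_foldl_flat; first by repeat split
  end.
Ltac puser := fail.
Ltac pauto := repeat first [assumption | pbase | puser].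

(** * List operations in polynomial time *)

Definition revl (T : Type) (l : seq T) := foldl (fun s y => y :: s) [::] l.

Lemma revlE T (l : seq T) : revl l = rev l.
Proof. by elim/last_ind: l => // l x; rewrite /revl foldl_rcons rev_rcons => <-. Qed.

Lemma dfits_take (T : dtype) K (l : seq T) i : dfits K (l : seq_dt T) -> dfits K (take i l : seq_dt T).
Proof.
move=> h; apply: dfits_seq => [|y j].
  by rewrite size_take_min; apply: leq_trans (geq_minr _ _) _; case: h.
by rewrite size_take_min leq_min => /andP[h1 h2]; rewrite nth_take //; apply: dfits_nth h h2.
Qed.

Lemma dfits_rev (T : dtype) K (l : seq T) : dfits K (l : seq_dt T) -> dfits K (rev l : seq_dt T).
Proof.
move=> h; apply: dfits_seq => [|y j]; first by rewrite size_rev; case: h.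
by rewrite size_rev => hj; rewrite nth_rev //; apply: dfits_nth h _; lia.
Qed.

Lemma dfits_cat (T : dtype) K K' (l r : seq T) : dfits K (l : seq_dt T) -> dfits K' (r : seq_dt T) ->
  dfits (K + K') (l ++ r : seq_dt T).
Proof.
move=> h h'; apply: dfits_seq => [|y j].
  by rewrite size_cat; apply: leq_add; [case: h|case: h'].
rewrite size_cat nth_cat => hj; case: ltnP => hjl.
  by apply: dfits_le (dfits_nth _ h hjl); lia.
by apply: dfits_le (dfits_nth _ h' _); lia.
Qed.

Lemma cpoly_rev (A T : dtype) p (l : A -> seq T) : cpoly p l -> cpoly p (fun x => rev (l x)).
Proof.
apply: (@cpoly_app _ _ _ _ l); apply: (@eq_cpoly _ _ _ (@revl T)); first exact: revlE.
apply: (@ptime_foldl (seq_dt T) (seq_dt T) T (fun _ s y => y :: s) (fun=> [::]) (fun x => x)); try by pauto.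
exists 1 => x K i hK hx; rewrite -/(revl _) revlE expn1; apply: dfits_rev; exact: dfits_take.
Qed.

Lemma cpoly_cat (A T : dtype) p (l r : A -> seq T) :
  cpoly p l -> cpoly p r -> cpoly p (fun x => l x ++ r x).
Proof.
apply: cpoly_app2; apply: (@eq_cpoly _ _ _ (fun z => foldl (fun s y => y :: s) z.2 (rev z.1))).
  move=> [a b] /=; elim/last_ind: a b => //= a x IH b.
  by rewrite rev_rcons /= IH -cats1 -catA.
apply: (@ptime_foldl (prod_dt (seq_dt T) (seq_dt T)) (seq_dt T) T (fun _ s y => y :: s) snd (fun x => rev x.1)).
- by pauto.
- by pauto.
- by apply: cpoly_rev; pauto.
exists 2 => -[a b] K i hK [/= ha hb].
have E q s : foldl (fun s (y : T) => y :: s) s q = rev q ++ s.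
  by elim: q s => //= y q IH s; rewrite IH rev_cons -cats1 -catA.
rewrite E; apply: (@dfits_le _ (K + K)); first by nia.
by apply: dfits_cat => //; apply: dfits_rev; apply: dfits_take; apply: dfits_rev.
Qed.

Lemma dfits_all (T : dtype) K (l : seq T) : size l <= K ->
  (forall q y r, l = q ++ y :: r -> dfits K y) -> dfits K (l : seq_dt T).
Proof.
move=> h1 h2; apply: dfits_seq => // y i hi; apply: (h2 (take i l) _ (drop i.+1 l)).
by rewrite -drop_nth // cat_take_drop.
Qed.

Lemma dfits_mid (T : dtype) K (q r : seq T) y : dfits K (q ++ y :: r : seq_dt T) -> dfits K y.
Proof.
move=> h; have := @dfits_nth _ _ _ y (size q) h.
by rewrite nth_cat ltnn subnn size_cat /=; apply; lia.
Qed.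

Lemma ptime_bound (A B : dtype) (f : A -> B) : ptime f ->
  exists c, forall x K, 1 < K -> dfits K x -> dfits (K ^ c.+1) (f x).
Proof.
case=> T [e [_ h]]; exists e => x K hK /(h x K hK)[_]; apply: dfits_le.
exact: exp_le.
Qed.

Lemma ptime_map (A B C : dtype) (F : A -> B -> C) (l : A -> seq B) :
  ptime (fun z : A * B => F z.1 z.2) -> ptime l -> ptime (fun x => [seq F x y | y <- l x]).
Proof.
move=> hF hl.
have E s x q : foldl (fun s y => F x y :: s) s q = rev [seq F x y | y <- q] ++ s.
  by elim: q s => //= y q IH s; rewrite IH rev_cons -cats1 -catA.
apply: (@eq_cpoly _ _ _ (fun x => rev (foldl (fun s y => F x y :: s) [::] (l x)))).
  by move=> x; rewrite E cats0 revK.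
apply: cpoly_rev.
apply: (@ptime_foldl A (seq_dt C) B (fun x s y => F x y :: s) (fun=> [::]) l) => //.
- have h : ptime (fun z : A * (seq C * B) => F z.1 z.2.2).
    by apply: (cpoly_app2 hF); pauto.
  by pauto.
- by pauto.
have [c hc] := ptime_bound hF; have [d hd] := ptime_bound hl.
exists (d.+1 * c.+1) => x K i hK hx; rewrite E cats0; apply: dfits_rev.
have hx' : dfits (K ^ d.+1) x by apply: dfits_le hx; apply: (@exp_le K 1 d.+1).
have := hd x K hK hx; case=> h1 h2.
have h3 : dfits (K ^ d.+1) (take i (l x) : seq_dt B) by apply: dfits_take.
case: (h3) => h4 h5; rewrite expnM; apply: dfits_all => [|q y r].
  by rewrite size_map; apply: leq_trans h4 _; rewrite -expnM; apply: exp_le => //; lia.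
move=> hq; have hs : size q < size (take i (l x)).
  by rewrite -(size_map (F x)) hq size_cat /=; lia.
move: hq; case E2 : (l x) => [|b0 l'].
  by rewrite E2 in hs.
rewrite -E2 => hq; have -> : y = F x (nth b0 (take i (l x)) (size q)).
  by rewrite -(nth_map b0 y) // hq nth_cat ltnn subnn.
apply: (hc (x, _)); first by apply: exp_gt1.
by split=> //; apply: dfits_nth.
Qed.

Lemma dfits_filter (T : dtype) K (P : pred T) (l : seq T) :
  dfits K (l : seq_dt T) -> dfits K (filter P l : seq_dt T).
Proof.
case=> h1 h2; split.
  by apply: leq_trans h1; rewrite size_filter count_size.
by elim: l {h1} h2 => //= y l IH [h /IH h']; case: ifP.
Qed.

Lemma ptime_filter (A B : dtype) (F : A -> B -> bool) (l : A -> seq B) :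
  ptime (fun z : A * B => F z.1 z.2) -> ptime l -> ptime (fun x => [seq y <- l x | F x y]).
Proof.
move=> hF hl.
have E s x q : foldl (fun s y => if F x y then y :: s else s) s q = rev [seq y <- q | F x y] ++ s.
  elim: q s => //= y q IH s; rewrite IH; case: ifP => // _.
  by rewrite rev_cons -cats1 -catA.
apply: (@eq_cpoly _ _ _ (fun x => rev (foldl (fun s y => if F x y then y :: s else s) [::] (l x)))).
  by move=> x; rewrite E cats0 revK.
apply: cpoly_rev.
apply: (@ptime_foldl A (seq_dt B) B (fun x s y => if F x y then y :: s else s) (fun=> [::]) l) => //.
- have h : ptime (fun z : A * (seq B * B) => F z.1 z.2.2).
    by apply: (cpoly_app2 hF); pauto.
  by pauto.
- by pauto.
have [d hd] := ptime_bound hl.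
exists d.+1 => x K i hK hx; rewrite E cats0; apply: dfits_rev; apply: dfits_filter.
by apply: dfits_take; apply: hd.
Qed.

Lemma cpoly_flatten (A B : dtype) p (l : A -> seq (seq B)) :
  cpoly p l -> cpoly p (fun x => flatten (l x)).
Proof.
have E s (q : seq (seq B)) : foldl (fun s y => s ++ y) s q = s ++ flatten q.
  by elim: q s => /= [|y q IH] s; rewrite ?cats0 // IH catA.
apply: (@cpoly_app _ _ _ _ l); apply: (@eq_cpoly _ _ _ (fun x => foldl (fun s y => s ++ y) [::] x)).
  by move=> x; rewrite E.
apply: (@ptime_foldl _ (seq_dt B) (seq_dt B) (fun _ s y => s ++ y) (fun=> [::]) (fun x => x)).
- by apply: cpoly_cat; pauto.
- by pauto.
- by pauto.
exists 2 => x K i hK hx; rewrite E /=.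
have : dfits K (take i x : seq_dt (seq_dt B)) by apply: dfits_take.
move: (take i x) => {hx}x [h1 h2].
apply: (@dfits_le _ (size x * K)); first by nia.
elim: x {h1} h2 => [|y x IH] //= [h1 h2]; rewrite mulSn.
by apply: dfits_cat => //; apply: IH.
Qed.

Lemma ptime_has (A B : dtype) (F : A -> B -> bool) (l : A -> seq B) :
  ptime (fun z : A * B => F z.1 z.2) -> ptime l -> ptime (fun x => has (F x) (l x)).
Proof.
move=> hF hl.
apply: (@eq_cpoly _ bool_dt _ (fun x => foldl (fun s y => s || F x y) false (l x))).
  move=> x; have E s q : foldl (fun s y => s || F x y) s q = s || has (F x) q.
    by elim: q s => /= [|y q IH] s; rewrite ?orbF // IH orbA.
  by rewrite E.
apply: (@ptime_foldl_flat A bool_dt B (fun x s y => s || F x y)) => //; last by pauto.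
have h : ptime (fun z : A * (bool * B) => F z.1 z.2.2).
  by apply: (cpoly_app2 hF); pauto.
by pauto.
Qed.

Lemma ptime_size (T : dtype) : ptime (fun x : seq T => size x).
Proof.
apply: (@eq_cpoly (seq_dt T) nat_dt _ (fun x => foldl (fun s _ => s.+1) 0 x)).
  move=> x; have E s q : foldl (fun s (_ : T) => s.+1) s q = s + size q.
    by elim: q s => /= [|y q IH] s; rewrite ?addn0 // IH addSnnS.
  by rewrite E.
by pauto.
Qed.
Definition cpoly_size (A T : dtype) p (f : A -> seq T) (h : cpoly p f) := cpoly_app (@ptime_size T) h.

Lemma dfits_drop (T : dtype) K (l : seq T) i : dfits K (l : seq_dt T) -> dfits K (drop i l : seq_dt T).
Proof.
move=> h; apply: dfits_seq => [|y j].
  by rewrite size_drop; apply: leq_trans (leq_subr _ _) _; case: h.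
by rewrite size_drop nth_drop => hj; apply: dfits_nth h _; lia.
Qed.

Lemma ptime_drop (T : dtype) : ptime (fun x : nat * seq T => drop x.1 x.2).
Proof.
pose b (s : nat * seq T) y := if s.1 == 0 then (0, y :: s.2) else (s.1 - 1, s.2).
have E s q : foldl b s q = (s.1 - size q, rev (drop s.1 q) ++ s.2).
  elim: q s => [|y q IH] [n r] /=; rewrite ?subn0 // {}IH /b /=.
  case: n => [|n] /=; last by rewrite ?subSS ?subn1 ?subn0.
  by rewrite drop0 sub0n rev_cons -cats1 -catA.
apply: (@eq_cpoly _ _ _ (fun x => rev (foldl b (x.1, [::]) x.2).2)).
  by move=> x; rewrite E cats0 revK.
apply: cpoly_rev; apply: cpoly_snd.
apply: (@ptime_foldl _ (prod_dt nat_dt (seq_dt T)) T (fun _ s y => b s y)).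
- by rewrite /b; pauto; apply: cpoly_eqn; pauto.
- by pauto.
- by pauto.
exists 1 => -[n l] K i hK [_ hl]; rewrite E /= cats0 expn1; split=> //=.
by apply: dfits_rev; apply: dfits_drop; apply: dfits_take.
Qed.
Definition cpoly_drop (A T : dtype) p (f : A -> nat) (g : A -> seq T) (hf : cpoly p f) (hg : cpoly p g) :=
  cpoly_app2 (@ptime_drop T) hf hg.

Lemma ptime_head : ptime (fun x : seq nat => head 0 x).
Proof.
pose b (s : bool * nat) y := if s.1 then s else (true, y).
apply: (@eq_cpoly (seq_dt nat_dt) nat_dt _ (fun x => (foldl b (false, 0) x).2)).
  by case=> //= y x; rewrite /b /=; elim: x.
by rewrite /b; pauto.
Qed.
Definition cpoly_head (A : dtype) p (f : A -> seq nat) (h : cpoly p f) := cpoly_app ptime_head h.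

Lemma ptime_nth : ptime (fun x : nat * seq nat => nth 0 x.2 x.1).
Proof.
apply: (@eq_cpoly (prod_dt nat_dt (seq_dt nat_dt)) nat_dt _ (fun x => head 0 (drop x.1 x.2))).
  by move=> x; rewrite -nth0 nth_drop addn0.
by apply: cpoly_head; apply: cpoly_drop; pauto.
Qed.
Lemma cpoly_nth (A : dtype) p (f : A -> nat) (g : A -> seq nat) : cpoly p f -> cpoly p g ->
  cpoly p (fun x => nth 0 (g x) (f x)).
Proof. exact: (@cpoly_app2 A nat_dt (seq_dt nat_dt) nat_dt p (fun i l => nth 0 l i) f g ptime_nth). Qed.

Lemma ptime_eqseq : ptime (fun x : seq nat * seq nat => x.1 == x.2).
Proof.
pose b (s : bool * seq nat) y := (s.1 && (head 0 s.2 == y), drop 1 s.2).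
apply: (@eq_cpoly (prod_dt (seq_dt nat_dt) (seq_dt nat_dt)) bool_dt _
  (fun x => (size x.1 == size x.2) && (foldl b (true, x.2) x.1).1)).
  move=> [x y] /=.
  have E s q r : size q = size r -> (foldl b (s, r) q).1 = s && (q == r).
    elim: q s r => [|z q IH] s [|t r] //=; first by rewrite andbT.
    by case=> h; rewrite {2}/b /= drop0 IH // eqseq_cons -andbA [z == t]eq_sym.
  case: eqP => [h|h] /=; first by rewrite E.
  by apply/esym/eqP => e; apply: h; rewrite e.
apply: cpoly_andb; first by apply: cpoly_eqn; apply: cpoly_size; pauto.
apply: cpoly_fst; apply: (@ptime_foldl _ (prod_dt bool_dt (seq_dt nat_dt)) nat_dt (fun _ s y => b s y)).
- rewrite /b; apply: cpoly_pair; last by apply: cpoly_drop; [exact: cpoly_nat | pauto].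
  by apply: cpoly_andb; first pauto; apply: cpoly_eqn; first apply: cpoly_head; pauto.
- by pauto.
- by pauto.
exists 1 => -[x y] K i hK [hx hy]; rewrite expn1 /=.
have E s r q : (foldl b (s, r) q).2 = drop (size q) r.
  elim: q s r => [|z q IH] s r; first by rewrite drop0.
  by rewrite /= IH /= drop_drop addn1.
split=> //; rewrite E.
exact: dfits_drop.
Qed.
Lemma cpoly_eqseq (A : dtype) p (f g : A -> seq nat) : cpoly p f -> cpoly p g ->
  cpoly p (fun x => f x == g x).
Proof. exact: cpoly_app2 ptime_eqseq. Qed.

Ltac plist := lazymatch goal with
  | |- cpoly _ (fun x => nth 0 _ _) => apply: cpoly_nth
  | |- cpoly _ (fun x => head 0 _) => apply: cpoly_head
  | |- cpoly _ (fun x => drop _ _) => apply: cpoly_drop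
  | |- cpoly _ (fun x => size _) => apply: cpoly_size
  | |- cpoly _ (fun x => flatten _) => apply: cpoly_flatten
  | |- cpoly _ (fun x => rev _) => apply: cpoly_rev
  | |- cpoly _ (fun x => _ ++ _) => apply: cpoly_cat
  | |- cpoly _ (fun x => has _ _) => apply: ptime_has
  | |- cpoly _ (fun x => map _ _) => apply: ptime_map
  | |- cpoly _ (fun x => filter _ _) => apply: ptime_filter
  | |- cpoly _ (fun x => @eq_op _ (_ : seq nat) _) => apply: cpoly_eqseq
  | |- cpoly _ (fun x => ?n) => exact: cpoly_nat
  end.
Ltac puser ::= plist.

Definition memn (x : nat) (l : seq nat) := has (fun y => y == x) l.
Lemma cpoly_memn (A : dtype) p (f : A -> nat) (g : A -> seq nat) : cpoly p f -> cpoly p g ->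
  cpoly p (fun x => memn (f x) (g x)).
Proof. by apply: cpoly_app2; rewrite /memn; pauto. Qed.
Lemma memnE x l : memn x l = (x \in l).
Proof. by rewrite -has_pred1. Qed.

Definition meml (x : seq nat) (l : seq (seq nat)) := has (fun y => y == x) l.
Lemma cpoly_meml (A : dtype) p (f : A -> seq nat) (g : A -> seq (seq nat)) : cpoly p f -> cpoly p g ->
  cpoly p (fun x => meml (f x) (g x)).
Proof. by apply: cpoly_app2; rewrite /meml; pauto. Qed.
Lemma memlE x l : meml x l = (x \in l).
Proof. by rewrite -has_pred1. Qed.

(** * Moves and the Ehrenfeucht-Fraisse game *)

(** Only [d] in [{0, 1}] matters: [up] admits [x] itself for [d = 0], [dn] admits it for [d = 1].
    The defaults [top] and [0] are sentinels at the two ends of the line. *)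
Definition up (top d : nat) (P : seq nat) (x : nat) : nat :=
  foldl (fun s y => if (x + d <= y) && (y < s) then y else s) top P.
Definition dn (d : nat) (P : seq nat) (x : nat) : nat :=
  foldl (fun s y => if (y < x + d) && (s < y) then y else s) 0 P.

Lemma up_lt top d P x t : t <= top -> (up top d P x < t) = has (fun y => x + d <= y < t) P.
Proof.
rewrite /up; have E s : (foldl (fun s y => if (x + d <= y) && (y < s) then y else s) s P < t)
    = (s < t) || has (fun y => x + d <= y < t) P.
  elim: P s => [|y P IH] s /=; first by rewrite orbF.
  by rewrite IH orbA; congr orb; case: ifP; lia.
by move=> ht; rewrite E ltnNge ht.
Qed.

Lemma dn_ge d P x t : 0 < t -> (t <= dn d P x) = has (fun y => t <= y < x + d) P.
Proof.
rewrite /dn; have E s : (t <= foldl (fun s y => if (y < x + d) && (s < y) then y else s) s P)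
    = (t <= s) || has (fun y => t <= y < x + d) P.
  elim: P s => [|y P IH] s /=; first by rewrite orbF.
  by rewrite IH orbA; congr orb; case: ifP; lia.
by move=> ht; rewrite E leqNgt ht.
Qed.

(** Both sides say that [P] has a point [y] with [a + d <= y < b + e]. The hypotheses keep the
    defaults [top] and [0] from deciding the comparison. *)
Lemma up_dn top d e P a b : 0 < a + d -> b + e <= top ->
  (up top d P a < b + e) = (a + d <= dn e P b).
Proof. by move=> ha hb; rewrite up_lt // dn_ge. Qed.

Lemma up_mem top d P x : (up top d P x == top) || (up top d P x \in P).
Proof.
rewrite /up; have E s : foldl (fun s y => if (x + d <= y) && (y < s) then y else s) s P \in s :: P.
  elim: P s => [|y P IH] s /=; first by rewrite inE.
  by have := IH (if (x + d <= y) && (y < s) then y else s); case: ifP; rewrite !inE => _ /orP[->|->];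
    rewrite ?orbT.
by have := E top; rewrite inE.
Qed.

Lemma dn_mem d P x : (dn d P x == 0) || (dn d P x \in P).
Proof.
rewrite /dn; have E s : foldl (fun s y => if (y < x + d) && (s < y) then y else s) s P \in s :: P.
  elim: P s => [|y P IH] s /=; first by rewrite inE.
  by have := IH (if (y < x + d) && (s < y) then y else s); case: ifP; rewrite !inE => _ /orP[->|->];
    rewrite ?orbT.
by have := E 0; rewrite inE.
Qed.

Definition partner (tab : seq (nat * nat)) (x : nat) : nat :=
  foldl (fun s p => if p.1 == x then p.2 else if p.2 == x then p.1 else s) x tab.

(* A move [(c, P)] is the partner map for [c = 0], [up] for [c = 1, 2] and [dn] for [c = 3, 4]. *)
Definition app (tab : seq (nat * nat)) (top : nat) (m : nat * seq nat) (x : nat) : nat :=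
  if m.1 == 0 then partner tab x
  else if m.1 <= 2 then up top (m.1 - 1) m.2 x else dn (m.1 - 3) m.2 x.

Definition moves (preds : seq (seq nat)) : seq (nat * seq nat) :=
  (0, [::]) :: flatten [seq [:: (1, P); (2, P); (3, P); (4, P)] | P <- preds].

Definition close tab top (ms : seq (nat * seq nat)) (l : seq nat) : seq nat :=
  l ++ flatten [seq [seq app tab top m x | x <- l] | m <- ms].

(** The number of rounds is the length of [u]: numbers that control loops are kept in unary, because
    the cost of a loop is measured by lists. *)
Definition closeN tab top (u : seq nat) ms (l : seq nat) : seq nat :=
  foldl (fun s _ => close tab top ms s) l u.

Definition pat (preds : seq (seq nat)) (l : seq nat) : seq nat :=
  flatten [seq [seq nat_of_bool (x < y) | y <- l] ++ [seq nat_of_bool (memn x P) | P <- preds] | x <- l].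

(** The local type of [x] of radius [size u], written as a list of bits so that types can be
    compared and counted. *)
Definition key tab top u preds x := pat preds (closeN tab top u (moves preds) [:: x]).

Section Game.
Variables (tab : seq (nat * nat)) (top : nat) (pts : seq nat).
Notation sg := (partner tab).
Notation app := (app tab top).
Notation close := (close tab top).
Notation closeN := (closeN tab top).

Hypothesis pts_bound : forall x, x \in pts -> 0 < x < top.
Hypothesis sg_pts : forall x, x \in pts -> sg x \in pts.
Hypothesis sgK : forall x, x \in pts -> sg (sg x) = x.
Hypothesis sg0 : sg 0 = 0.
Hypothesis sgtop : sg top = top.

Definition wd (w : seq (nat * seq nat)) (x : nat) : nat := foldr app x w.

Lemma wd_cons m w x : wd (m :: w) x = app m (wd w x). Proof. by []. Qed.
Arguments wd : simpl never.

Definition overm (preds : seq (seq nat)) (d : nat) (w : seq (nat * seq nat)) : Prop :=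
  {subset w <= moves preds} /\ size w <= d.

Lemma overm_nil preds d : overm preds d [::]. Proof. by split. Qed.

Lemma overm_cons preds d m w : overm preds d.+1 (m :: w) <-> m \in moves preds /\ overm preds d w.
Proof.
split=> [[h1 h2]|[h0 [h1 h2]]]; last first.
  by split=> // x; rewrite inE => /orP[/eqP->|/h1].
split; first by apply: h1; rewrite mem_head.
by split=> // x hx; apply: h1; rewrite inE hx orbT.
Qed.

Lemma overm_cat preds d e w w' : overm preds d w -> overm preds e w' -> overm preds (d + e) (w ++ w').
Proof.
move=> [h1 h2] [h3 h4]; split; last by rewrite size_cat leq_add.
by move=> x; rewrite mem_cat => /orP[/h1|/h3].
Qed.

Lemma overm_le preds d e w : d <= e -> overm preds d w -> overm preds e w.
Proof. by move=> h [h1 h2]; split=> //; apply: leq_trans h. Qed.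

Lemma mem_moves preds m : (m \in moves preds) = (m == (0, [::])) || (0 < m.1 <= 4) && (m.2 \in preds).
Proof.
rewrite inE; congr orb; apply/flattenP/andP => [[s /mapP[P hP ->]]|[h1 h2]].
  by rewrite !inE => /or4P[] /eqP ->.
exists [:: (1, m.2); (2, m.2); (3, m.2); (4, m.2)]; first by apply/mapP; exists m.2.
by case: m h1 {h2} => [[|[|[|[|[|c]]]]] P] //= _; rewrite !inE eqxx ?orbT.
Qed.

Lemma moves_sub preds preds' : {subset preds <= preds'} -> {subset moves preds <= moves preds'}.
Proof.
by move=> h m; rewrite !mem_moves => /orP[->//|/andP[-> /h ->]]; rewrite orbT.
Qed.

Lemma overm_sub preds preds' d w : {subset preds <= preds'} -> overm preds d w -> overm preds' d w.
Proof. by move=> h [h1 h2]; split=> // x /h1; apply: moves_sub. Qed.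

Definition valid (x : nat) : bool := [|| x == 0, x == top | x \in pts].

Lemma valid_le x : valid x -> x <= top.
Proof. by case/or3P => [/eqP->|/eqP->|/pts_bound/andP[_ /ltnW]]. Qed.

(** A position of the game: [zs] matches the points chosen on one side with those chosen on the
    other, both on the same line. Words of length at most [d] must not tell the two sides apart. *)
Definition Eqv (preds : seq (seq nat)) (d : nat) (zs : seq (nat * nat)) : Prop :=
  forall w w' z z', overm preds d w -> overm preds d w' -> z \in zs -> z' \in zs ->
  (wd w z.1 < wd w' z'.1) = (wd w z.2 < wd w' z'.2) /\
  forall P, P \in preds -> (wd w z.1 \in P) = (wd w z.2 \in P).

(** The singletons of [0] and [top] are classes, so that equivalent points reach the sentinels by
    the same words; there the adjunction breaks down and the comparison is settled directly. *)
Record goodp (preds : seq (seq nat)) : Prop := GoodP {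
  goodp0 : [:: 0] \in preds;
  goodpT : [:: top] \in preds;
  goodp_valid : forall P, P \in preds -> forall x, x \in P -> valid x;
  goodp_mono : forall x, x \in pts -> exists Q, [/\ Q \in preds, x \in Q, {subset Q <= pts} &
    {in Q &, forall a b, a < b -> sg a < sg b}]
}.

Lemma app0 P x : app (0, P) x = sg x. Proof. by []. Qed.
Lemma app_up e P x : e <= 1 -> app (1 + e, P) x = up top e P x. Proof. by case: e => [|[|]]. Qed.
Lemma app_dn e P x : app (3 + e, P) x = dn e P x. Proof. by rewrite /app /= ?subn0 ?addKn. Qed.

Lemma mem_up preds e P : e <= 1 -> P \in preds -> (1 + e, P) \in moves preds.
Proof. by move=> he hP; rewrite mem_moves hP; case: e he => [|[|]]. Qed.
Lemma mem_dn preds e P : e <= 1 -> P \in preds -> (3 + e, P) \in moves preds.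
Proof. by move=> he hP; rewrite mem_moves hP; case: e he => [|[|]]. Qed.

Lemma move_shape preds m : m \in moves preds -> m = (0, [::]) \/
  exists e P, [/\ e <= 1, P \in preds & m = (1 + e, P) \/ m = (3 + e, P)].
Proof.
rewrite mem_moves => /orP[/eqP->|]; first by left.
case: m => [[|[|[|[|[|c]]]]] P] //= h; right.
- by exists 0, P; split=> //; left.
- by exists 1, P; split=> //; left.
- by exists 0, P; split=> //; right.
- by exists 1, P; split=> //; right.
Qed.

Lemma valid_app preds m x : goodp preds -> m \in moves preds -> valid x -> valid (app m x).
Proof.
move=> g; rewrite mem_moves => /orP[/eqP-> /=|/andP[h1 h2] _].
  rewrite app0 => /or3P[/eqP->|/eqP->|/sg_pts hx]; apply/or3P.
  - by rewrite sg0; constructor 1.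
  - by rewrite sgtop; constructor 2.
  - by constructor 3.
rewrite /app; case: eqP h1 => [->//|_] h1; case: leqP => h3.
- have /orP[/eqP->|] := up_mem top (m.1 - 1) m.2 x; first by apply/or3P; constructor 2.
  exact: (goodp_valid g h2).
- have /orP[/eqP->|] := dn_mem (m.1 - 3) m.2 x; first by rewrite /valid eqxx.
  exact: (goodp_valid g h2).
Qed.

Lemma valid_wd preds d w x : goodp preds -> overm preds d w -> valid x -> valid (wd w x).
Proof.
move=> g; elim: w d => [|m w IH] d // [h1 h2] hx; rewrite wd_cons.
apply: (@valid_app preds) => //; first by apply: h1; rewrite mem_head.
by apply: (IH (size w)) => //; split=> // y hy; apply: h1; rewrite inE hy orbT.
Qed.

(* By the adjunction [up_dn] and the monotonicity of the partner map on a class, a comparison of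
   [wd w x] with a landmark unwinds to a comparison of [x] with a landmark reached by at most
   two further moves per letter of [w]. *)
Lemma eqv_landmarks preds r x z E : goodp preds -> valid x -> valid z -> {in E, forall v, valid v} ->
  Eqv preds r [:: (x, z)] ->
  (forall u v e, overm preds (3 * r) u -> v \in E -> e <= 1 ->
     (x < wd u v + e) = (z < wd u v + e)) ->
  Eqv preds r ((x, z) :: [seq (v, v) | v <- E]).
Proof.
move=> g vx vz vE h1 h2.
have mem1 w P : overm preds r w -> P \in preds -> (wd w x \in P) = (wd w z \in P).
  by move=> hw; have [_ /(_ P)] := h1 w w (x, z) (x, z) hw hw (mem_head _ _) (mem_head _ _).
(* Each letter removed from [w] adds at most two to [u]. For [size w <= r] the allowance is at least
   [r], and it ends at [3 * r] when [w] is empty. *)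
have key1 : forall w, overm preds r w -> forall u v e, overm preds (3 * r - 2 * size w) u ->
    v \in E -> e <= 1 -> (wd w x < wd u v + e) = (wd w z < wd u v + e).
  elim=> [|m w IH] hw u v e hu hv he; first by apply: h2 => //; rewrite muln0 subn0 in hu.
  have hmw := hw; case: (hw) => _ /=; case: r h1 h2 mem1 IH hw hu hmw => // r h1 h2 mem1 IH hw hu hmw hr.
  have [hm hw1] := (overm_cons _ _ _ _).1 hw.
  have hw2 : overm preds r.+1 w by apply: overm_le hw1.
  have {}IH := IH hw2.
  have vl := valid_wd g hu (vE v hv).
  have va := valid_wd g hw2 vx; have va' := valid_wd g hw2 vz.
  have [lt|lnt] := eqVneq (wd u v) top.
    rewrite lt; have := mem1 _ [:: top] hmw (goodpT g); rewrite !inE !wd_cons.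
    have := valid_le (valid_app g hm va); have := valid_le (valid_app g hm va').
    move: (app m _) (app m _) => A B; case: e he => [|[|//]] _; lia.
  have lle : wd u v < top by rewrite ltn_neqAle lnt valid_le.
  have [a0|an0] := eqVneq (wd w x) 0.
    have := mem1 _ [:: 0] hw2 (goodp0 g); rewrite !inE a0 eqxx => /esym/eqP a0'.
    by rewrite !wd_cons a0 a0'.
  have a'n0 : wd w z != 0.
    by have := mem1 _ [:: 0] hw2 (goodp0 g); rewrite !inE (negbTE an0) => <-.
  have [at_|ant] := eqVneq (wd w x) top.
    have := mem1 _ [:: top] hw2 (goodpT g); rewrite !inE at_ eqxx => /esym/eqP at'.
    by rewrite !wd_cons at_ at'.
  have a'nt : wd w z != top.
    by have := mem1 _ [:: top] hw2 (goodpT g); rewrite !inE (negbTE ant) => <-.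
  have lea : wd w x < top by rewrite ltn_neqAle ant valid_le.
  have lea' : wd w z < top by rewrite ltn_neqAle a'nt valid_le.
  rewrite -lt0n in an0; rewrite -lt0n in a'n0.
  have bud : 3 * r.+1 - 2 * size w = (3 * r.+1 - 2 * (size w).+1).+2 by lia.
  have ext1 m' : m' \in moves preds -> overm preds (3 * r.+1 - 2 * size w) (m' :: u).
    move=> hm'; rewrite bud; apply: (@overm_le _ _.+1); first exact: leqnSn.
    by apply/overm_cons.
  case: (move_shape hm) hmw => [->|[d [P [hd hP em]]]] hmw.
    have pa : wd w x \in pts by move: va; rewrite /valid eqn0Ngt an0 (ltn_eqF lea).
    have pa' : wd w z \in pts by move: va'; rewrite /valid eqn0Ngt a'n0 (ltn_eqF lea').
    have [Q [q1 q2 q3 q4]] := goodp_mono g (sg_pts pa).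
    have q2' : sg (wd w z) \in Q by have := mem1 _ Q hmw q1; rewrite !wd_cons !app0 q2 => <-.
    have qlt : forall s t, s \in Q -> t \in Q -> (s <= t) = (sg s <= sg t).
      move=> s t hs ht; case: (ltngtP s t) => [l|l|->]; last by rewrite leqnn.
      - by rewrite ltnW // q4.
      - by rewrite leqNgt (q4 _ _ ht hs l).
    (* A point of [Q] compares with the landmark as with the last point of [Q] before it; inside [Q]
       the partner map preserves the order. If there is no such point, the default [0] is its own
       partner. *)
    have step s : s \in Q -> (s < wd u v + e) = (sg s < sg (dn e Q (wd u v)) + 1).
      move=> hs; have s0 : 0 < s by have /andP[] := pts_bound (q3 _ hs).
      have -> : (s < wd u v + e) = (s <= dn e Q (wd u v)).
        rewrite dn_ge //; apply/idP/hasP => [l|[y _ /andP[]]]; last exact: leq_ltn_trans.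
        by exists s => //; rewrite leqnn.
      rewrite addn1 ltnS; have /orP[/eqP->|hd] := dn_mem e Q (wd u v); last exact: qlt.
      have /andP[s1 _] := pts_bound (sg_pts (q3 _ hs)).
      by rewrite sg0 !leqn0 !eqn0Ngt s0 s1.
    rewrite !wd_cons !app0 !step // !sgK //.
    have mQ := mem_dn he q1.
    have m0 : (0, [::]) \in moves preds by rewrite mem_moves eqxx.
    have := IH ((0, [::]) :: (3 + e, Q) :: u) v 1 _ hv isT.
    rewrite !wd_cons app0 app_dn; apply.
    by rewrite bud; apply/overm_cons; split=> //; apply/overm_cons.
  have hbe : wd u v + e <= top by clear - he lle; lia.
  case: em => em; rewrite em !wd_cons.
    rewrite !app_up // !up_dn ?addn_gt0 ?an0 ?a'n0 //.
    have mQ := mem_dn he hP.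
    (* For [d <= 1], [a + d <= c] is the same as [a < c + (1 - d)], which has again the form of the
       induction hypothesis. *)
    have := IH ((3 + e, P) :: u) v (1 - d) (ext1 _ mQ) hv (leq_subr _ _).
    by rewrite wd_cons app_dn; clear - hd; case: d hd => [|[|//]] _ /=; rewrite ?subn0 ?addn0 ?addn1 ?ltnS.
  have [b0|bn0] := posnP (wd u v + e); first by rewrite b0.
  (* The adjunction with the roles of point and landmark exchanged, negated; it requires
     [wd u v + e] to be positive, hence the preceding case. *)
  have E1 a : a < top -> (dn d P a < wd u v + e) = ~~ (up top e P (wd u v) < a + d).
    by move=> l2; rewrite up_dn // -?ltnNge //; clear - hd l2; lia.
  rewrite !app_dn !E1 //.
  have mQ := mem_up he hP.
  have := IH ((1 + e, P) :: u) v (1 - d) (ext1 _ mQ) hv (leq_subr _ _).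
  rewrite wd_cons app_up //; move: (up _ _ _ _) (wd w x) (wd w z); clear - hd => A B C.
  by lia.
have key2 w u v : overm preds r w -> overm preds r u -> v \in E ->
    (wd w x < wd u v) = (wd w z < wd u v) /\ (wd u v < wd w x) = (wd u v < wd w z).
  move=> hw hu hv; have hu' : overm preds (3 * r - 2 * size w) u.
    by apply: overm_le hu; case: hw => _; lia.
  have := key1 w hw u v 0 hu' hv isT; have := key1 w hw u v 1 hu' hv isT.
  by rewrite addn0 addn1 !ltnS; lia.
move=> w w' [a a'] [b b'] hw hw'; rewrite !inE.
have sm c c' : (c, c') \in [seq (v, v) | v <- E] -> c = c' /\ c \in E.
  by case/mapP => v hv [-> ->].
case/orP => [/eqP[-> ->]|/sm[<- hE]]; case/orP => [/eqP[-> ->]|/sm[<- hE']] /=.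
- by apply: (h1 w w' (x, z) (x, z)) => //; apply: mem_head.
- by split; [case: (key2 w w' b) | move=> P; apply: mem1].
- by split=> //; case: (key2 w' w a).
- by split.
Qed.

Lemma closeN_words u preds E y :
  reflect (exists w v, [/\ overm preds (size u) w, v \in E & y = wd w v]) (y \in closeN u (moves preds) E).
Proof.
elim/last_ind: u y => [|u t IH] y.
  apply: (iffP idP) => [h|[w [v [[_ hw] hv ->]]]]; first by exists [::], y; split=> //; split.
  by case: w hw.
rewrite /closeN foldl_rcons -/(closeN _ _ _) size_rcons /close mem_cat.
apply: (iffP orP) => [[/IH[w [v [h1 h2 h3]]]|/flattenP[s /mapP[m hm ->] /mapP[x /IH[w [v [h1 h2 ->]]] ->]]]|].
- by exists w, v; split=> //; apply: overm_le h1.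
- by exists (m :: w), v; split=> //; apply/overm_cons.
move=> [[|m w] [v [hw hv ->]]].
  by left; apply/IH; exists [::], v; split.
case/overm_cons: hw => hm hw; right; apply/flattenP.
exists [seq app m x | x <- closeN u (moves preds) E]; first by apply/mapP; exists m.
by apply: map_f; apply/IH; exists w, v.
Qed.

(** Let [f] be the last landmark not after [x]. If it is not [x] itself, then no landmark lies in
    [(f, x]], while the first point [z] after [f] in the refined class of [x] satisfies
    [f < z <= x]. So [x] and [z] agree on all landmarks, and [z] is one move away from [f]. *)
Lemma eqv_representative preds preds' r x E : goodp preds -> {subset preds <= preds'} ->
  (forall x, x \in pts -> exists Q, [/\ Q \in preds', x \in Q, {subset Q <= pts} &
     forall z, z \in Q -> Eqv preds r [:: (x, z)]]) ->
  {in E, forall v, valid v} -> 0 \in E -> x \in pts ->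
  exists w v, [/\ overm preds' (3 * r).+1 w, v \in E, wd w v \in pts &
    Eqv preds r ((x, wd w v) :: [seq (v, v) | v <- E])].
Proof.
move=> g sub hQ vE E0 hx.
have vx : valid x by rewrite /valid hx !orbT.
pose L := closeN (nseq (3 * r) 0) (moves preds) E.
have LP y : reflect (exists w v, [/\ overm preds (3 * r) w, v \in E & y = wd w v]) (y \in L).
  by have := closeN_words (nseq (3 * r) 0) preds E y; rewrite size_nseq.
(* The default [0] of [dn] is a landmark as well, because [0] is in [E]. *)
pose f := dn 1 L x.
have L0 : 0 \in L by apply/LP; exists [::], 0; split.
have fL : f \in L by rewrite /f; have /orP[/eqP->|] := dn_mem 1 L x.
have fx : f <= x.
  case: (posnP f) => [->//|f0]; have := dn_ge 1 L x f0; rewrite leqnn.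
  by move=> /esym/hasP[y _]; lia.
have fmax l : l \in L -> l <= x -> l <= f.
  case: (posnP l) => [->//|l0] hl hlx; rewrite dn_ge //; apply/hasP; exists l => //.
  by rewrite leqnn addn1 ltnS.
have [w [v [hw hv ef]]] := LP _ fL.
have [Q [q1 q2 q3 q4]] := hQ x hx.
have [efx|nfx] := eqVneq f x.
  exists w, v; rewrite -ef efx; split=> //.
    by apply: overm_sub sub _; apply: overm_le hw.
  apply: eqv_landmarks => //.
  exact: q4.
have {}fx : f < x by rewrite ltn_neqAle nfx.
have xt : x < top by have /andP[] := pts_bound hx.
pose z := up top 1 Q f.
have zx : z <= x.
  rewrite -ltnS up_lt //; apply/hasP; exists x => //; lia.
have fz : f < z.
  rewrite ltnNge; apply/negP => h.
  have := @up_lt top 1 Q f f.+1 (ltnW (leq_ltn_trans fx xt)).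
  by rewrite ltnS -/z h => /esym/hasP[y _]; lia.
have zQ : z \in Q by rewrite /z; have /orP[/eqP e|//] := up_mem top 1 Q f; move: zx; rewrite /z e leqNgt xt.
exists ((2, Q) :: w), v; split=> //.
- apply/overm_cons; split; last exact: overm_sub hw.
  by rewrite mem_moves q1.
- by rewrite wd_cons -ef; apply: q3.
rewrite wd_cons -ef -[app _ _]/z; apply: eqv_landmarks => //.
- by rewrite /valid q3 ?orbT.
- exact: q4.
move=> u v' e hu hv' he; have hl : wd u v' \in L by apply/LP; exists u, v'.
move: (fmax _ hl) fz zx he; move: (wd u v') => l; clear; lia.
Qed.

(** The representative of [x] is a word [w] applied to a point of the left side; the answer is the
    same [w] applied to the matching point on the right. A word of length [r] after [w] has total
    length at most [r + (3 * r).+1], whence the bound on [d]. *)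
Lemma eqv_extend preds preds' r d x zs : goodp preds -> {subset preds <= preds'} ->
  (forall x, x \in pts -> exists Q, [/\ Q \in preds', x \in Q, {subset Q <= pts} &
     forall z, z \in Q -> Eqv preds r [:: (x, z)]]) ->
  {in zs, forall z, valid z.1} -> (0, 0) \in zs -> x \in pts -> 4 * r + 1 <= d ->
  Eqv preds' d zs ->
  exists w v v', [/\ overm preds' (3 * r).+1 w, (v, v') \in zs, wd w v' \in pts &
    Eqv preds r ((x, wd w v') :: zs)].
Proof.
move=> g sub hQ vE E0 hx hd heq.
have [||w [v [hw hv hp hE]]] := @eqv_representative preds preds' r x [seq z.1 | z <- zs] g sub hQ _ _ hx.
- by move=> v /mapP[z /vE hz ->].
- by apply/mapP; exists (0, 0).
case/mapP: hv => -[v0 v'] hz /= ev; subst v0.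
exists w, v, v'; split=> //.
  have [Q [q1 q2 q3 q4]] := hQ _ hp; apply: q3.
  have ow : overm preds' d w by apply: overm_le hw; lia.
  by have [_ /(_ Q q1) /= <-] := heq w w _ _ ow ow hz hz.
have ext a : overm preds r a -> overm preds' d (a ++ w).
  by move=> /(overm_sub sub) ha; apply: overm_le (overm_cat ha hw); lia.
have ext0 a : overm preds r a -> overm preds' d a.
  by move=> /(overm_sub sub) ha; apply: overm_le ha; lia.
have wc a y : wd a (wd w y) = wd (a ++ w) y by rewrite /wd foldr_cat.
have dm y : y \in zs -> (y.1, y.1) \in [seq (v, v) | v <- [seq z.1 | z <- zs]].
  by move=> hy; apply/mapP; exists y.1 => //; apply: map_f.
move=> a a' b b' ha ha'; rewrite !inE => /orP[/eqP->|hb] /orP[/eqP->|hb'] /=.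
- have [e1 e2] := hE a a' _ _ ha ha' (mem_head _ _) (mem_head _ _).
  have [f1 f2] := heq _ _ _ _ (ext _ ha) (ext _ ha') hz hz.
  rewrite /= in e1 e2 f1 f2; rewrite e1 !wc f1; split=> // P hP.
  by rewrite e2 // wc f2 //; apply: sub.
- have [e1 e2] := hE a a' _ (b'.1, b'.1) ha ha' (mem_head _ _) (mem_behead (s := _ :: _) (dm _ hb')).
  have [f1 f2] := heq _ _ _ _ (ext _ ha) (ext0 _ ha') hz hb'.
  rewrite /= in e1 e2 f1 f2; rewrite e1 !wc f1; split=> // P hP.
  by rewrite e2 // wc f2 //; apply: sub.
- have [e1 e2] := hE a a' (b.1, b.1) _ ha ha' (mem_behead (s := _ :: _) (dm _ hb)) (mem_head _ _).
  have [f1 f2] := heq _ _ _ _ (ext0 _ ha) (ext _ ha') hb hz.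
  rewrite /= in e1 e2 f1 f2; rewrite e1 !wc f1; split=> // P hP.
  by rewrite f2 //; apply: sub.
- have [f1 f2] := heq _ _ _ _ (ext0 _ ha) (ext0 _ ha') hb hb'.
  by split=> // P hP; apply: f2; apply: sub.
Qed.
End Game.

(** * Types of points and first-order formulas *)

Definition undupl (l : seq (seq nat)) : seq (seq nat) :=
  foldl (fun s c => if meml c s then s else c :: s) [::] l.

Definition classes (kl : seq (nat * seq nat)) : seq (seq nat) :=
  [seq [seq p.1 | p <- kl & p.2 == c] | c <- undupl [seq p.2 | p <- kl]].

(** The old classes are kept, so that the moves of one level are also moves of the next. *)
Definition refine tab top u pts preds :=
  preds ++ classes [seq (x, key tab top u preds x) | x <- pts].

Lemma mem_undupl l c : (c \in undupl l) = (c \in l).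
Proof.
rewrite /undupl; have E s : (c \in foldl (fun s c => if meml c s then s else c :: s) s l) = (c \in s) || (c \in l).
  elim: l s => [|b l IH] s /=; first by rewrite orbF.
  rewrite IH memlE; case: ifP => h; rewrite !inE.
    by case: eqP => [->|]; rewrite ?h // ?orbT.
  by rewrite orbA [(c \in s) || _]orbC.
by rewrite E.
Qed.

Lemma mem_classes (f : nat -> seq nat) pts P :
  reflect (exists2 x, x \in pts & P = [seq y <- pts | f y == f x])
    (P \in classes [seq (x, f x) | x <- pts]).
Proof.
have E x : [seq p.1 | p <- [seq (y, f y) | y <- pts] & p.2 == f x] = [seq y <- pts | f y == f x].
  by rewrite filter_map -map_comp map_id_in.
apply: (iffP mapP) => [[c]|[x hx ->]].
- rewrite mem_undupl -map_comp => /mapP[x hx /= ->] ->; exists x => //; exact: E.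
- exists (f x); last by rewrite E.
  by rewrite mem_undupl -map_comp; apply/mapP; exists x.
Qed.

(** Rows of equal length are cut at the same places. This recovers the single bits from an equality
    of keys. *)
Lemma flatten_map_inj (A : eqType) (B : Type) (f g : A -> seq B) W :
  (forall w, size (f w) = size (g w)) -> flatten [seq f w | w <- W] = flatten [seq g w | w <- W] ->
  forall w, w \in W -> f w = g w.
Proof.
move=> hs; elim: W => [|v W IH] //= h w.
have := congr1 (take (size (f v))) h; rewrite take_size_cat // hs take_size_cat // => e1.
have := congr1 (drop (size (f v))) h; rewrite drop_size_cat // hs drop_size_cat // => e2.
by rewrite inE => /orP[/eqP->|] //; apply: IH.
Qed.

Section Keys.
Variables (tab : seq (nat * nat)) (top : nat).

Fixpoint words (d : nat) (ms : seq (nat * seq nat)) : seq (seq (nat * seq nat)) :=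
  if d is d'.+1 then let W := words d' ms in W ++ flatten [seq [seq m :: w | w <- W] | m <- ms]
  else [:: [::]].

(** Unlike [closeN_words], this fixes the order: the place in the list determines the word
    independently of [x], so the keys of two points can be compared entry by entry. *)
Lemma closeN_map u ms x : closeN tab top u ms [:: x] = [seq wd tab top w x | w <- words (size u) ms].
Proof.
elim/last_ind: u => [|u t IH] //; rewrite /closeN foldl_rcons -/(closeN _ _ _ _ _) IH size_rcons /=.
rewrite /close map_cat map_flatten -map_comp; congr (_ ++ flatten _).
by apply: eq_map => m /=; rewrite -!map_comp.
Qed.

Lemma overm_words preds d w : overm preds d w -> w \in words d (moves preds).
Proof.
elim: d w => [|d IH] w; first by case=> _; case: w.
rewrite -[words d.+1 _]/(words d _ ++ flatten [seq [seq m :: w | w <- words d (moves preds)] | m <- moves preds]).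
case: w => [|m w] h; rewrite mem_cat; first by rewrite IH //; split.
have [hm hw] := (overm_cons _ _ _ _).1 h.
by apply/orP; right; apply/flattenP; exists [seq m :: w | w <- words d (moves preds)];
  apply/mapP; [exists m|exists w => //; apply: IH].
Qed.

Lemma key_eqv preds u x z : key tab top u preds x = key tab top u preds z ->
  Eqv tab top preds (size u) [:: (x, z)].
Proof.
rewrite /key /pat !closeN_map; set W := words _ _.
pose row (y : nat) w := [seq nat_of_bool (wd tab top w y < wd tab top w' y) | w' <- W] ++
  [seq nat_of_bool (memn (wd tab top w y) P) | P <- preds].
have E y : flatten [seq [seq nat_of_bool (a < b) | b <- [seq wd tab top w y | w <- W]] ++
    [seq nat_of_bool (memn a P) | P <- preds] | a <- [seq wd tab top w y | w <- W]] =
    flatten [seq row y w | w <- W].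
  by rewrite -map_comp; congr flatten; apply: eq_map => w /=; rewrite /row -map_comp.
rewrite !E => /flatten_map_inj H.
move=> w w' a b hw hw'; rewrite !inE => /eqP-> /eqP-> /=.
have := H _ w (overm_words hw); rewrite /row => e.
have {}e : row x w = row z w by apply: e => v; rewrite !size_cat !size_map.
move/eqP: e; rewrite eqseq_cat ?size_map // => /andP[/eqP e1 /eqP e2].
have binj (b1 b2 : bool) : nat_of_bool b1 = b2 -> b1 = b2 by case: b1; case: b2.
split=> [|P hP]; first by apply: binj; exact: (eq_in_map _ _ _).2 e1 _ (overm_words hw').
by rewrite -!memnE; apply: binj; exact: (eq_in_map _ _ _).2 e2 _ hP.
Qed.
End Keys.

Record points (tab : seq (nat * nat)) (top : nat) (pts : seq nat) : Prop := Points {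
  pts_bound : forall x, x \in pts -> 0 < x < top;
  sg_pts : forall x, x \in pts -> partner tab x \in pts;
  sgK : forall x, x \in pts -> partner tab (partner tab x) = x;
  sg0 : partner tab 0 = 0;
  sgtop : partner tab top = top
}.

(** The radius needed with [i] rounds to go. The recursion is the one of [eqv_extend]; it starts at
    1 because adjacency of two left ends refers to their partners. *)
Fixpoint rad (i : nat) : nat := if i is i'.+1 then 4 * rad i' + 1 else 1.

Lemma rad_le i : rad i <= 5 ^ i.
Proof. by elim: i => //= i IH; rewrite expnS; move: (expn_gt0 5 i) IH; move: (5 ^ i) (rad i); lia. Qed.

Lemma rad_mono i j : i <= j -> rad i <= rad j.
Proof.
elim: j => [|j IH]; first by rewrite leqn0 => /eqP->.
by rewrite leq_eqVlt => /orP[/eqP->//|]; rewrite ltnS => /IH /=; lia.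
Qed.

Section FirstOrder.
Variables (tab : seq (nat * nat)) (top : nat) (pts : seq nat) (preds0 : seq (seq nat)).
Variable (u : seq nat).
Hypothesis pp : points tab top pts.
Hypothesis good0 : goodp tab top pts preds0.

Notation sg := (partner tab).

(** A play starts at a high level and descends by one with each quantifier. The same radius [size u]
    is used at all levels; it only has to dominate [rad i]. *)
Definition level (i : nat) := iter i (refine tab top u pts) preds0.

Lemma level_sub i j : i <= j -> {subset level i <= level j}.
Proof.
move=> /subnKC <-; elim: (j - i) => [|k IH] P hP; first by rewrite addn0.
by rewrite addnS /= mem_cat IH.
Qed.

Lemma level_good i : goodp tab top pts (level i).
Proof.
elim: i => [|i [g1 g2 g3 g4]] //=; split; rewrite ?mem_cat ?g1 ?g2 //.
- move=> P; rewrite mem_cat => /orP[/g3//|/mem_classes[x hx ->] y].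
  by rewrite mem_filter /valid => /andP[_ ->]; rewrite !orbT.
- by move=> x /g4[Q [q1 q2 q3 q4]]; exists Q; split=> //; rewrite mem_cat q1.
Qed.

Lemma level_class i r : r <= size u -> forall x, x \in pts -> exists Q,
  [/\ Q \in level i.+1, x \in Q, {subset Q <= pts} &
     forall z, z \in Q -> Eqv tab top (level i) r [:: (x, z)]].
Proof.
move=> hr x hx; exists [seq y <- pts | key tab top u (level i) y == key tab top u (level i) x].
split.
- by rewrite /= mem_cat; apply/orP; right; apply/mem_classes; exists x.
- by rewrite mem_filter eqxx.
- by move=> y; rewrite mem_filter => /andP[].
move=> z; rewrite mem_filter => /andP[/eqP/esym hk _].
by move=> w w' a b /(overm_le hr) hw /(overm_le hr) hw'; apply: key_eqv hk _ _ _ _ hw hw'.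
Qed.

Lemma Eqv_sub preds d zs zs' : {subset zs' <= zs} -> Eqv tab top preds d zs -> Eqv tab top preds d zs'.
Proof. by move=> h H w w' z z' hw hw' hz hz'; apply: H => //; apply: h. Qed.

Lemma Eqv_sym preds d zs : Eqv tab top preds d zs -> Eqv tab top preds d [seq (z.2, z.1) | z <- zs].
Proof.
move=> H w w' _ _ hw hw' /mapP[z hz ->] /mapP[z' hz' ->] /=.
by have [-> h] := H w w' z z' hw hw' hz hz'; split=> // P /h.
Qed.

Variables (L n : nat) (G : lgraph L n) (pt : 'I_n -> nat) (toks : seq nat).

(** Here [a] and [b] are left ends, and [sg a < a] says that the arc passes through 0. Two arcs
    through 0 always meet, an arc through 0 meets another one if one of the last two inequalities
    holds, and otherwise both are necessary; in each case this means two out of four. *)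
Definition meets (a b : nat) : bool := 2 <= (sg a < a) + (sg b < b) + (a <= sg b) + (b <= sg a).

Hypothesis pt_inj : injective pt.
Hypothesis pt_pts : forall i, pt i \in pts.
Hypothesis adjE : forall i j, adj G i j = (i != j) && meets (pt i) (pt j).
Hypothesis labE : forall i j (l : 'I_L), (forall P, P \in preds0 -> (pt i \in P) = (pt j \in P)) ->
  (l : nat) \in toks -> lab G l i = lab G l j.
Hypothesis leftE : forall i x, x \in pts -> (forall P, P \in preds0 -> (pt i \in P) = (x \in P)) ->
  exists j, x = pt j.

(** The pair [(0, 0)] provides the landmark from which the first point is reached. *)
Definition pairs m (e e' : 'I_m -> 'I_n) : seq (nat * nat) :=
  (0, 0) :: [seq (pt (e a), pt (e' a)) | a <- enum 'I_m].

Lemma pairs_mem m (e e' : 'I_m -> 'I_n) a : (pt (e a), pt (e' a)) \in pairs e e'.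
Proof. by rewrite inE; apply/orP; right; apply: (map_f (fun a => (pt (e a), pt (e' a)))); rewrite mem_enum. Qed.

Lemma pairs_sym m (e e' : 'I_m -> 'I_n) : [seq (z.2, z.1) | z <- pairs e e'] = pairs e' e.
Proof. by rewrite /pairs /= -map_comp. Qed.

Lemma pairs_scons m (e e' : 'I_m -> 'I_n) v v' :
  {subset pairs (scons v e) (scons v' e') <= (pt v, pt v') :: pairs e e'}.
Proof.
move=> z; rewrite inE => /orP[/eqP->|/mapP[a _ ->]]; first by rewrite !inE eqxx orbT.
rewrite /scons; case: (unlift ord0 a) => [b|]; last exact: mem_head.
by rewrite inE pairs_mem orbT.
Qed.

Lemma eqv_move i d m (e e' : 'I_m -> 'I_n) v : rad i <= size u -> rad i.+1 <= d ->
  Eqv tab top (level i.+1) d (pairs e e') ->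
  exists v' w y, [/\ overm (level i.+1) (3 * rad i).+1 w, y \in 0 :: [seq pt (e' a) | a <- enum 'I_m],
    pt v' = wd tab top w y & Eqv tab top (level i) (rad i) (pairs (scons v e) (scons v' e'))].
Proof.
case: pp => b1 b2 b3 b4 b5 hr hd H.
have hs : {subset level i <= level i.+1} by apply: level_sub.
have [|||w [a [a' [h1 h2 h3 h4]]]] := eqv_extend b1 b2 b3 b4 b5 (level_good i) hs
    (level_class i hr) _ _ (pt_pts v) _ H.
- move=> z; rewrite inE => /orP[/eqP->|/mapP[c _ ->]] /=; first by rewrite /valid eqxx.
  by rewrite /valid pt_pts !orbT.
- exact: mem_head.
- exact: hd.
have hw0 : overm (level i) (rad i) [::] by split.
have [_ hP] := h4 [::] [::] _ _ hw0 hw0 (mem_head _ _) (mem_head _ _).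
have [v' ev'] : exists v', wd tab top w a' = pt v'.
  by apply: (leftE (i := v)) => // P /(level_sub (leq0n i)) /hP.
exists v', w, a'; split=> //.
  move: h2; rewrite inE => /orP[/eqP[_ ->]|/mapP[c hc [_ ->]]]; first exact: mem_head.
  by rewrite inE; apply/orP; right; apply/mapP; exists c.
by apply: Eqv_sub h4; rewrite ev'; exact: pairs_scons.
Qed.

Lemma eqv_eq i d (a b a' b' : 'I_n) zs : Eqv tab top (level i) d zs ->
  (pt a, pt a') \in zs -> (pt b, pt b') \in zs -> (a == b) = (a' == b').
Proof.
move=> H h1 h2; have h0 : overm (level i) d [::] by split.
have [e1 _] := H [::] [::] _ _ h0 h0 h1 h2; have [e2 _] := H [::] [::] _ _ h0 h0 h2 h1.
by rewrite -!(inj_eq pt_inj) !eqn_leq !(leqNgt (pt _)) /= in e1 e2 *; rewrite e1 e2.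
Qed.

Lemma eqv_meets i d (a b a' b' : 'I_n) zs : 0 < d -> Eqv tab top (level i) d zs ->
  (pt a, pt a') \in zs -> (pt b, pt b') \in zs -> meets (pt a) (pt b) = meets (pt a') (pt b').
Proof.
move=> hd H h1 h2; have h0 : overm (level i) d [::] by split.
have hs : overm (level i) d [:: (0, [::])].
  by apply: (@overm_le _ 1) => //; apply/overm_cons; split=> //; rewrite inE eqxx.
have e w w' z z' (hw : overm (level i) d w) (hw' : overm (level i) d w') (hz : z \in zs) (hz' : z' \in zs) : (wd tab top w z.1 < wd tab top w' z'.1) = (wd tab top w z.2 < wd tab top w' z'.2).
  by case: (H w w' z z' hw hw' hz hz').
have := e _ _ _ _ hs h0 h1 h1; have := e _ _ _ _ hs h0 h2 h2.
have := e _ _ _ _ hs h0 h1 h2; have := e _ _ _ _ hs h0 h2 h1.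
rewrite /= /wd /= /app /=; rewrite /meets !(leqNgt (pt _)) => -> -> -> ->; by [].
Qed.

(** The length of the code serves as a bound on the quantifier rank. The level [i] is lowered only
    at quantifiers, where [eqv_move] is applied to the position and to its mirror image. *)
Lemma sat_eqv m (phi : fo L m) i (e e' : 'I_m -> 'I_n) : size (fo_code phi) <= i ->
  rad i <= size u -> {subset fo_code phi <= toks} ->
  Eqv tab top (level i) (rad i) (pairs e e') -> sat G phi e = sat G phi e'.
Proof.
elim: phi i e e' => {m} [m x y|m x y|m l x|m a IH|m a IHa b IHb|m a IHa b IHb|m a IH|m a IH] i e e' /= hi hu ht H.
- by apply: eqv_eq H _ _; apply: pairs_mem.
- rewrite !adjE (eqv_meets _ H (pairs_mem e e' x) (pairs_mem e e' y)); last by case: i {hi hu H} => //= i; lia.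
  by congr (~~ _ && _); apply: eqv_eq H _ _; apply: pairs_mem.
- apply: labE; last by apply: ht; rewrite !inE eqxx orbT.
  have h0 : overm (level i) (rad i) [::] by split.
  have [_ h] := H [::] [::] _ _ h0 h0 (pairs_mem e e' x) (pairs_mem e e' x).
  by move=> P /(level_sub (leq0n i))/h.
- congr (~~ _); apply: (IH i) => //; first exact: ltnW.
  by move=> z hz; apply: ht; rewrite inE hz orbT.
- congr (_ && _); [apply: (IHa i)|apply: (IHb i)] => //; rewrite ?size_cat in hi; try lia.
    by move=> z hz; apply: ht; rewrite inE mem_cat hz !orbT.
  by move=> z hz; apply: ht; rewrite inE mem_cat hz !orbT.
- congr (_ || _); [apply: (IHa i)|apply: (IHb i)] => //; rewrite ?size_cat in hi; try lia.
    by move=> z hz; apply: ht; rewrite inE mem_cat hz !orbT.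
  by move=> z hz; apply: ht; rewrite inE mem_cat hz !orbT.
- case: i hi hu H => // i hi hu H.
  have hu' : rad i <= size u by apply: leq_trans hu; apply: rad_mono.
  have ht' : {subset fo_code a <= toks} by move=> z hz; apply: ht; rewrite inE hz orbT.
  have H' := Eqv_sym H; rewrite pairs_sym in H'.
  apply/existsP/existsP => -[v hv].
  + have [v' [w [y [_ _ _ h]]]] := eqv_move v hu' (leqnn _) H.
    by exists v'; rewrite -(IH i _ _ _ _ ht' h).
  + have [v' [w [y [_ _ _ h]]]] := eqv_move v hu' (leqnn _) H'.
    by exists v'; rewrite -(IH i _ _ _ _ ht' h).
- case: i hi hu H => // i hi hu H.
  have hu' : rad i <= size u by apply: leq_trans hu; apply: rad_mono.
  have ht' : {subset fo_code a <= toks} by move=> z hz; apply: ht; rewrite inE hz orbT.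
  have H' := Eqv_sym H; rewrite pairs_sym in H'.
  apply/forallP/forallP => hv v.
  + have [v' [w [y [_ _ _ h]]]] := eqv_move v hu' (leqnn _) H'.
    by rewrite (IH i _ _ _ _ ht' h).
  + have [v' [w [y [_ _ _ h]]]] := eqv_move v hu' (leqnn _) H.
    by rewrite (IH i _ _ _ _ ht' h).
Qed.
End FirstOrder.

(** * Evaluation over bounded sets *)

(* The value at a code suffix [t :: s] whose suffixes have the values [ents]: the length of the
   formula that starts there and the assignments in [all] satisfying it.  It is meaningless if no
   formula starts there. *)
Definition entry (tab : seq (nat * nat)) (labtab all : seq (seq nat)) (t : nat) (s : seq nat)
    (ents : seq (nat * seq (seq nat))) : nat * seq (seq nat) :=
  let e1 := head (0, [::]) ents in let e2 := head (0, [::]) (drop e1.1 ents) in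
  let a := nth 0 s 0 in let b := nth 0 s 1 in
  if t == 0 then (3, [seq e <- all | nth 0 e a == nth 0 e b])
  else if t == 1 then
    (3, [seq e <- all | ~~ (nth 0 e a == nth 0 e b) && meets tab (nth 0 e a) (nth 0 e b)])
  else if t == 2 then (3, [seq e <- all | meml [:: a; nth 0 e b] labtab])
  else if t == 3 then (e1.1.+1, [seq e <- all | ~~ meml e e1.2])
  else if t == 4 then ((e1.1 + e2.1).+1, [seq e <- all | meml e e1.2 && meml e e2.2])
  else if t == 5 then ((e1.1 + e2.1).+1, [seq e <- all | meml e e1.2 || meml e e2.2])
  else if t == 6 then
    (e1.1.+1, [seq e <- all | has (fun p => (0 < size p) && (drop 1 p == e)) e1.2])
  else (e1.1.+1, [seq e <- all |
    ~~ has (fun p => [&& 0 < size p, drop 1 p == e & ~~ meml p e1.2]) all]).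

(** The code is in Polish notation. Read from the right, the operands of a connective are already
    evaluated: the first is the newest entry, the second lies beyond as many entries as the first
    operand has tokens. *)
Definition dp tab labtab all (code : seq nat) : seq (nat * seq (seq nat)) :=
  (foldl (fun st t => (t :: st.1, entry tab labtab all t st.1 st.2 :: st.2)) ([::], [::]) (rev code)).2.

Lemma dp_cons tab labtab all t s :
  dp tab labtab all (t :: s) = entry tab labtab all t s (dp tab labtab all s) :: dp tab labtab all s.
Proof.
rewrite /dp rev_cons foldl_rcons /=; congr (entry _ _ _ _ _ _ :: _).
by elim: s => //= y s IH; rewrite rev_cons foldl_rcons /= IH.
Qed.

Lemma drop_dp tab labtab all k s : drop k (dp tab labtab all s) = dp tab labtab all (drop k s).
Proof. by elim: s k => [|t s IH] [|k]; rewrite ?drop0 // dp_cons; exact: IH. Qed.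

(** The state consists of the points reached so far, the assignments of the current length, and
    those of all lengths up to it. Only left ends enter assignments, since they stand for the
    vertices. *)
Definition play_step tab top u ms lefts (st : seq nat * (seq (seq nat) * seq (seq nat))) :=
  let lay := closeN tab top u ms st.1 in
  let cur := flatten [seq [seq x :: e | e <- st.2.1] | x <- lay & memn x lefts] in
  (lay, (cur, cur ++ st.2.2)).

Definition plays tab top u ms lefts (v : seq nat) :=
  foldl (fun st _ => play_step tab top u ms lefts st) ([:: 0], ([:: [::]], [:: [::]])) v.

Record arc_model (tab : seq (nat * nat)) (pts : seq nat) (preds0 : seq (seq nat)) (L n : nat) (G : lgraph L n) (pt : 'I_n -> nat)
    (toks : seq nat) : Prop := ArcModel {
  pt_inj : injective pt;
  pt_pts : forall i, pt i \in pts;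
  adjE : forall i j, adj G i j = (i != j) && meets tab (pt i) (pt j);
  labE : forall i j (l : 'I_L), (forall P, P \in preds0 -> (pt i \in P) = (pt j \in P)) ->
    (l : nat) \in toks -> lab G l i = lab G l j;
  leftE : forall i x, x \in pts -> (forall P, P \in preds0 -> (pt i \in P) = (x \in P)) ->
    exists j, x = pt j
}.

Section Evaluation.
Variables (tab : seq (nat * nat)) (top : nat) (pts : seq nat) (preds0 : seq (seq nat)).
Variables (u code : seq nat) (L n : nat) (G : lgraph L n) (pt : 'I_n -> nat).
Variables (lefts : seq nat) (labtab : seq (seq nat)).
Hypothesis pp : points tab top pts.
Hypothesis good0 : goodp tab top pts preds0.
Hypothesis am : arc_model tab pts preds0 G pt code.
Hypothesis hu : rad (size code) <= size u.
Hypothesis leftsE : forall x, reflect (exists i, x = pt i) (x \in lefts).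
Hypothesis labtabE : forall (l : 'I_L) i, (l : nat) \in code ->
  ([:: (l : nat); pt i] \in labtab) = lab G l i.

Notation lev := (level tab top pts preds0 u).
Notation ms := (moves (lev (size code))).
Notation st m := (iter m (play_step tab top u ms lefts) ([:: 0], ([:: [::]], [:: [::]]))).
Notation lay m := (st m).1.
Notation cur m := (st m).2.1.
Notation all := (plays tab top u ms lefts code).2.2.

Definition ptl m (e : 'I_m -> 'I_n) : seq nat := [seq pt (e a) | a <- enum 'I_m].

Lemma ptl_scons m v (e : 'I_m -> 'I_n) : ptl (scons v e) = pt v :: ptl e.
Proof.
rewrite /ptl enum_ordSl /= -map_comp; congr (pt _ :: _); first by rewrite /scons unlift_none.
by apply: eq_map => a /=; rewrite /scons liftK.
Qed.

Lemma nth_ptl m (e : 'I_m -> 'I_n) (a : 'I_m) : nth 0 (ptl e) a = pt (e a).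
Proof. by rewrite (nth_map a) ?size_enum_ord // nth_ord_enum. Qed.

Lemma cur_cons m p : reflect (exists x e, [/\ p = x :: e, x \in lay m.+1, x \in lefts & e \in cur m])
  (p \in cur m.+1).
Proof.
rewrite [cur m.+1]/=; apply: (iffP flattenP) => [[s /mapP[x]]|[x [e [-> h1 h2 h3]]]].
  by rewrite mem_filter memnE => /andP[h1 h2] -> /mapP[e h3 ->]; exists x, e.
exists [seq x :: e | e <- cur m]; last by apply: map_f.
by apply/mapP; exists x => //; rewrite mem_filter memnE h2.
Qed.

Lemma cur_size m p : p \in cur m -> size p = m.
Proof.
elim: m p => [|m IH] p; first by rewrite inE => /eqP->.
by case/cur_cons => x [e [-> _ _ /IH/= ->]].
Qed.

Lemma all_cur p : (p \in all) = (size p <= size code) && (p \in cur (size p)).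
Proof.
have E (v : seq nat) s0 : foldl (fun s _ => play_step tab top u ms lefts s) s0 v =
    iter (size v) (play_step tab top u ms lefts) s0.
  by elim: v s0 => //= t v IH s0; rewrite IH -iterSr.
rewrite /plays E; have F k : (p \in (st k).2.2) = (size p <= k) && (p \in cur (size p)).
  elim: k => [|k IH]; first by rewrite leqn0; case: (p).
  rewrite [(st k.+1).2.2]/= mem_cat -[X in (p \in X) || _]/(cur k.+1) IH [size p <= k.+1]leq_eqVlt ltnS andb_orl.
  congr orb; have [->|ne] := eqVneq (size p) k.+1; first by [].
  by apply/negP => /cur_size/eqP; rewrite (negbTE ne).
exact: F.
Qed.

Lemma lay_le m y : y \in lay m -> y \in lay m.+1.
Proof.
move=> h; rewrite [lay m.+1]/=; apply/(closeN_words tab top u (lev (size code))).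
by exists [::], y; split=> //; apply: overm_nil.
Qed.

Lemma lay0 m : 0 \in lay m.
Proof. by elim: m => // m /lay_le. Qed.

Lemma cur_lay m p x : p \in cur m -> x \in p -> x \in lay m.
Proof.
elim: m p => [|m IH] p; first by rewrite inE => /eqP->.
case/cur_cons => y [e [-> h1 h2 h3]]; rewrite inE => /orP[/eqP->//|/(IH _ h3)]; exact: lay_le.
Qed.

(** The game is played between [e] and itself: the answer to [v] is then a vertex reached from [e]
    by [(3 * rad i).+1] moves, hence in the next layer, and it satisfies the same formula. *)
Lemma layer_witness m (a : fo L m.+1) (e : 'I_m -> 'I_n) v : {subset fo_code a <= code} ->
  size (fo_code a) < size code -> ptl e \in cur m ->
  exists2 v', ptl (scons v' e) \in cur m.+1 & sat G a (scons v e) = sat G a (scons v' e).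
Proof.
move=> ha hs he; pose i := size (fo_code a).
have hr : rad i <= size u by apply: leq_trans hu; apply: rad_mono; exact: ltnW.
have hr1 : rad i.+1 <= size u by apply: leq_trans hu; apply: rad_mono.
have refl : Eqv tab top (lev i.+1) (rad i.+1) (pairs pt e e).
  have E z : z \in pairs pt e e -> z.1 = z.2 by rewrite inE => /orP[/eqP->|/mapP[c _ ->]].
  by move=> w w' z z' _ _ /E-> /E->.
have [v' [w [y [h1 h2 h3 h4]]]] := eqv_move pp good0 (pt_pts am) (leftE am) v hr (leqnn _) refl.
exists v'; last first.
  by apply: (sat_eqv pp good0 (pt_inj am) (pt_pts am) (adjE am) (labE am) (leftE am)) h4.
rewrite ptl_scons; apply/cur_cons; exists (pt v'), (ptl e); split=> //; last by apply/leftsE; exists v'.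
rewrite [lay m.+1]/=; apply/(closeN_words tab top u (lev (size code))); exists w, y; split=> //.
  apply: overm_sub (overm_le _ h1); first by apply: level_sub.
  by apply: leq_trans hr1; rewrite /=; lia.
by move: h2; rewrite inE => /orP[/eqP->|/(cur_lay he)]; first exact: lay0.
Qed.

(** The table is claimed to be right only for assignments from the layers; quantifiers stay within
    them by [layer_witness]. The word [rest] makes the induction apply to an operand inside a longer
    code. *)
Lemma dp_sat m (phi : fo L m) rest : {subset fo_code phi <= code} ->
  m + size (fo_code phi) <= size code ->
  exists T, [/\ head (0, [::]) (dp tab labtab all (fo_code phi ++ rest)) = (size (fo_code phi), T),
    {subset T <= all} &
    forall e : 'I_m -> 'I_n, ptl e \in cur m -> (ptl e \in T) = sat G phi e].
Proof.
have fs (f : pred (seq nat)) : {subset [seq e <- all | f e] <= all}.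
  by move=> e; rewrite mem_filter => /andP[].
have ca k (e : 'I_k -> 'I_n) : k <= size code -> ptl e \in cur k -> ptl e \in all.
  by move=> hk he; rewrite all_cur (cur_size he) hk he.
elim: phi rest => {m} [m x y|m x y|m l x|m a IH|m a IHa b IHb|m a IHa b IHb|m a IH|m a IH] rest ht hs;
  rewrite /= in hs; rewrite [fo_code _]/= cat_cons dp_cons [head _ _]/= /entry /=.
- eexists; split=> // e he; rewrite mem_filter ca //; last by lia.
  by rewrite !nth_ptl (inj_eq (pt_inj am)) andbT.
- eexists; split=> // e he; rewrite mem_filter ca //; last by lia.
  by rewrite !nth_ptl (inj_eq (pt_inj am)) (adjE am) andbT.
- eexists; split=> // e he; rewrite mem_filter ca //; last by lia.
  by rewrite !nth_ptl memlE labtabE ?andbT //; apply: ht; rewrite !inE eqxx orbT.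
- have [||T [-> h1 h2]] := IH rest; [by move=> z hz; apply: ht; rewrite inE hz orbT | by lia |].
  eexists; split=> // e he; rewrite mem_filter ca //; last by lia.
  by rewrite memlE h2 // andbT.
- rewrite -catA; have [||T [E1 h1 h2]] := IHa (fo_code b ++ rest).
    + by move=> z hz; apply: ht; rewrite inE mem_cat hz !orbT.
    + by rewrite size_cat in hs; lia.
  rewrite E1 drop_dp drop_size_cat //.
  have [||T' [E2 h3 h4]] := IHb rest.
    + by move=> z hz; apply: ht; rewrite inE mem_cat hz !orbT.
    + by rewrite size_cat in hs; lia.
  rewrite E2 size_cat; eexists; split=> // e he; rewrite mem_filter ca //; last by lia.
  by rewrite !memlE h2 // h4 // andbT.
- rewrite -catA; have [||T [E1 h1 h2]] := IHa (fo_code b ++ rest).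
    + by move=> z hz; apply: ht; rewrite inE mem_cat hz !orbT.
    + by rewrite size_cat in hs; lia.
  rewrite E1 drop_dp drop_size_cat //.
  have [||T' [E2 h3 h4]] := IHb rest.
    + by move=> z hz; apply: ht; rewrite inE mem_cat hz !orbT.
    + by rewrite size_cat in hs; lia.
  rewrite E2 size_cat; eexists; split=> // e he; rewrite mem_filter ca //; last by lia.
  by rewrite !memlE h2 // h4 // andbT.
- have ht' : {subset fo_code a <= code} by move=> z hz; apply: ht; rewrite inE hz orbT.
  have [||T [-> h1 h2]] := IH rest; [by [] | by lia |].
  eexists; split=> // e he; rewrite mem_filter ca //; last by lia.
  rewrite andbT; apply/hasP/existsP => [[p hp /andP[p0 /eqP ep]]|[v hv]].
    (* Every listed assignment comes from the layers, so its first entry is the left end of some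
       arc, which gives the vertex. *)
    have := h1 _ hp; rewrite all_cur => /andP[q1 q2].
    case: p p0 ep q1 q2 hp => // x p _; rewrite /= drop0 => ep q1 q2 hp; subst p.
    have [y [e0 [[<- <-] _ /leftsE[v ev] _]]] := cur_cons _ _ q2.
    have hc : ptl (scons v e) \in cur m.+1.
      by move: q2; rewrite ptl_scons -ev (cur_size he).
    by exists v; rewrite -(h2 _ hc) ptl_scons -ev.
  have [|v' hc hv'] := layer_witness v ht' _ he; first by lia.
  exists (ptl (scons v' e)); first by rewrite h2 // -hv'.
  by rewrite ptl_scons /= drop0 eqxx.
- have ht' : {subset fo_code a <= code} by move=> z hz; apply: ht; rewrite inE hz orbT.
  have [||T [-> h1 h2]] := IH rest; [by [] | by lia |].
  eexists; split=> // e he; rewrite mem_filter ca //; last by lia.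
  rewrite andbT; apply/hasPn/forallP => [H v|H p hp].
    have [|v' hc ->] := layer_witness v ht' _ he; first by lia.
    have := H (ptl (scons v' e)); rewrite memlE h2 // ptl_scons /= drop0 eqxx /= negbK; apply.
    by rewrite -ptl_scons; apply: ca => //; lia.
  apply/negP => /and3P[p0 /eqP ep]; rewrite memlE => /negP; apply.
  have := hp; rewrite all_cur => /andP[q1 q2].
  case: p p0 ep q1 q2 hp => // x p _; rewrite /= drop0 => ep q1 q2 hp; subst p.
  have [y [e0 [[<- <-] _ /leftsE[v ev] _]]] := cur_cons _ _ q2.
  have hc : ptl (scons v e) \in cur m.+1.
    by move: q2; rewrite ptl_scons -ev (cur_size he).
  by rewrite ev -ptl_scons h2.
Qed.

Lemma dp_models (phi : fo L 0) : code = fo_code phi ->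
  meml [::] (head (0, [::]) (dp tab labtab all code)).2 = models G phi.
Proof.
move=> ec; have [||T [E _ h]] := @dp_sat 0 phi [::].
- by rewrite -ec.
- by rewrite -ec.
rewrite cats0 -ec in E; rewrite E memlE /models -h.
  by rewrite /ptl enum_ord0.
by rewrite /ptl enum_ord0 inE.
Qed.
End Evaluation.

(** * The algorithm *)

(* Multiplication is repeated addition, with the input word as a clock: [mulw w a b] is
   [a * b] as soon as [a <= size w]. *)
Definition mulw (w : seq nat) (a b : nat) : nat :=
  (foldl (fun s (_ : nat) => if s.1 < a then (s.1.+1, s.2 + b) else s) (0, 0) w).2.
Definition iotaw (w : seq nat) (n : nat) : seq nat :=
  rev (foldl (fun s (_ : nat) => if s.1 < n then (s.1.+1, s.1 :: s.2) else s) (0, [::]) w).2.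

Lemma mulwE w a b : a <= size w -> mulw w a b = a * b.
Proof.
move=> h; rewrite /mulw.
have E i s : foldl (fun s (_ : nat) => if s.1 < a then (s.1.+1, s.2 + b) else s) (i, i * b) s =
    (if i < a then minn (i + size s) a else i, (if i < a then minn (i + size s) a else i) * b).
  elim: s i => [|x s IH] i; first by rewrite addn0; case: ifP => // hi; rewrite (minn_idPl _) // ltnW.
  rewrite [foldl _ _ _]/=; case: ifP => hi; last by have := IH i; rewrite hi.
  rewrite -mulSnr IH [size _]/=; case: ifP => hi'; first by rewrite addSnnS.
  by have -> : minn (i + (size s).+1) a = i.+1 by lia.
have := E 0 w; rewrite mul0n => -> /=; case: ltnP => h0; last by have -> : a = 0 by lia.
by rewrite add0n (minn_idPr h).
Qed.

(** Covers the graph without vertices: there the number of labels is not bounded by the length of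
    the input, and the clock may stop too early. *)
Lemma mulw0 w a b : b = 0 -> mulw w a b = a * b.
Proof.
move=> ->; rewrite muln0 /mulw.
have E (v : seq nat) s : s.2 = 0 -> (foldl (fun s (_ : nat) => if s.1 < a then (s.1.+1, s.2 + 0) else s) s v).2 = 0.
  by elim: v s => //= x v IH s hs; apply: IH; case: ifP => // _; rewrite /= hs.
exact: E.
Qed.

Lemma iotawE w n : n <= size w -> iotaw w n = iota 0 n.
Proof.
move=> h; rewrite /iotaw.
have E i s : foldl (fun s (_ : nat) => if s.1 < n then (s.1.+1, s.1 :: s.2) else s) (i, rev (iota 0 i)) s =
    (if i < n then minn (i + size s) n else i, rev (iota 0 (if i < n then minn (i + size s) n else i))).
  elim: s i => [|x s IH] i; first by rewrite addn0; case: ifP => // hi; rewrite (minn_idPl _) // ltnW.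
  rewrite [foldl _ _ _]/=; case: ifP => hi; last by have := IH i; rewrite hi.
  have -> : i :: rev (iota 0 i) = rev (iota 0 i.+1) by rewrite -addn1 iotaD rev_cat.
  rewrite IH [size _]/=; case: ifP => hi'; first by rewrite addSnnS.
  by have -> : minn (i + (size s).+1) n = i.+1 by lia.
have := E 0 w; rewrite /= => -> /=; rewrite revK; case: ltnP => h0; last by have -> : n = 0 by lia.
by rewrite add0n (minn_idPr h).
Qed.

Definition offL w := 2 + mulw w (nth 0 w 0) (nth 0 w 0).
Definition offR w := offL w + mulw w (nth 0 w 1) (nth 0 w 0).
Definition codeof w := drop (offR w + nth 0 w 0 + nth 0 w 0) w.
(** Breaks ties between end points: [n] slots for each rank and each side, left ends before right
    ends, then by the index of the arc. The successor keeps [0] free for the sentinel. *)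
Definition posw w (i : nat) (b : nat) :=
  mulw w (nth 0 w (offR w + i + i + b) + nth 0 w (offR w + i + i + b) + b) (nth 0 w 0) + i.+1.
Definition labbit w (c i : nat) : bool := nth 0 w (offL w + mulw w c (nth 0 w 0) + i) == 1.
Definition arcsw w : seq (nat * (nat * nat)) :=
  [seq (i, (posw w i 0, posw w i 1)) | i <- iotaw w (nth 0 w 0)].

Definition wrap (p : nat * nat) : bool := p.2 < p.1.
Definition nest (p q : nat * nat) : bool :=
  [&& (wrap p && wrap q) || (~~ wrap p && ~~ wrap q), p.1 < q.1 & q.2 < p.2].
Definition nested (tab R : seq (nat * nat)) : seq (nat * nat) := [seq q <- tab | has (fun p => nest p q) R].
(* Contains the left end of an arc once for each [c] in [1 .. size tab] such that the arc ends a
   nested chain of [c + 1] arcs. *)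
Definition chains (tab : seq (nat * nat)) : seq nat :=
  (foldl (fun s (_ : nat * nat) => (nested tab s.1, [seq q.1 | q <- nested tab s.1] ++ s.2)) (tab, [::]) tab).2.
(** The number of arcs above [p] in a longest nested chain, read off as a multiplicity. *)
Definition height (hs : seq nat) (p : nat * nat) : nat := size [seq y <- hs | y == p.1].

(** Every token of the code is tried as a label, which avoids parsing; tokens that are no labels
    contribute arbitrary bits, and these only refine the classes. The number of bits is governed by
    the formula and not by [L]. *)
Definition colour w code (p : nat * (nat * nat)) : seq nat :=
  nat_of_bool (wrap p.2) :: [seq nat_of_bool (labbit w c p.1) | c <- code].
Definition colours w code (hs : seq nat) (arcs : seq (nat * (nat * nat))) : seq (nat * seq nat) :=
  flatten [seq [:: (p.2.1, height hs p.2 :: 0 :: colour w code p);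
                   (p.2.2, height hs p.2 :: 1 :: colour w code p)] | p <- arcs].

Definition labtabw w code (arcs : seq (nat * (nat * nat))) : seq (seq nat) :=
  flatten [seq [seq [:: c; p.2.1] | p <- arcs & labbit w c p.1] | c <- code].

Definition ptsof (tab : seq (nat * nat)) := flatten [seq [:: p.1; p.2] | p <- tab].
(** The right sentinel; any number above all points would do. *)
Definition topof (pts : seq nat) := foldl (fun s y => s + y) 1 pts.
(** A clock of length [5 ^ size code], which is at least [rad (size code)] by [rad_le]. *)
Definition unary (code : seq nat) : seq nat :=
  foldl (fun s (_ : nat) => s ++ (s ++ (s ++ (s ++ s)))) [:: 0] code.
Definition predsw top (cl : seq (nat * seq nat)) := [:: 0] :: [:: top] :: classes cl.

Lemma size_unary code : size (unary code) = 5 ^ size code.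
Proof.
rewrite /unary; have E s : size (foldl (fun s (_ : nat) => s ++ (s ++ (s ++ (s ++ s)))) s code) = 5 ^ size code * size s.
  elim: code s => [|c l IH] s; first by rewrite mul1n.
  by rewrite [foldl _ _ _]/= IH !size_cat [size (_ :: _)]/= expnS; move: (5 ^ _) (size s) => x y; lia.
by rewrite E muln1.
Qed.

(** * Decoding the input word *)

Lemma nth_pairs (A B : Type) (f : A -> B -> nat) s t i j x y : i < size s -> j < size t ->
  nth 0 [seq f a b | a <- s, b <- t] (i * size t + j) = f (nth x s i) (nth y t j).
Proof.
elim: s i => //= a s IH [|i] hi hj; rewrite nth_cat size_map.
  by rewrite hj (nth_map y).
by rewrite ltnNge mulSn -addnA leq_addr /= addKn IH.
Qed.

Section Encoding.
Variables (R : realType) (L n : nat) (G : lgraph L n) (A : 'I_n -> circ_arc R) (phi : fo L 0).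
Notation w := (encode G A phi).
Notation code := (fo_code phi).
Notation rk i b := (endpoint_rank A (i, b)).

Let adjs := [seq nat_of_bool (adj G i j) | i <- enum 'I_n, j <- enum 'I_n].
Let labs := [seq nat_of_bool (lab G l i) | l <- enum 'I_L, i <- enum 'I_n].
Let ranks := [seq endpoint_rank A (i, b) | i <- enum 'I_n, b <- [:: false; true]].

Lemma encE : w = [:: n; L] ++ adjs ++ labs ++ ranks ++ code. Proof. by []. Qed.

Lemma adjs_size : size adjs = n * n. Proof. by rewrite size_allpairs size_enum_ord. Qed.
Lemma labs_size : size labs = L * n. Proof. by rewrite size_allpairs !size_enum_ord. Qed.
Lemma ranks_size : size ranks = n * 2. Proof. by rewrite size_allpairs size_enum_ord. Qed.

Lemma enc_size : size w = 2 + n * n + L * n + n * 2 + size code.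
Proof. by rewrite encE !size_cat adjs_size labs_size ranks_size /=; lia. Qed.

Lemma enc_n : nth 0 w 0 = n. Proof. by []. Qed.
Lemma enc_L : nth 0 w 1 = L. Proof. by []. Qed.

Lemma n_le_w : n <= size w. Proof. by rewrite enc_size; nia. Qed.

Lemma offL_enc : offL w = 2 + n * n.
Proof. by rewrite /offL enc_n mulwE // n_le_w. Qed.

Lemma offR_enc : offR w = 2 + n * n + L * n.
Proof.
rewrite /offR offL_enc enc_n enc_L; congr (_ + _).
have [n0|n0] := posnP n; first exact: mulw0.
by rewrite mulwE // enc_size; nia.
Qed.

Lemma codeof_enc : codeof w = code.
Proof.
rewrite /codeof offR_enc enc_n encE !catA drop_size_cat //.
by rewrite !size_cat adjs_size labs_size ranks_size /=; lia.
Qed.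

Lemma rank_enc (i : 'I_n) (b : bool) : nth 0 w (offR w + i + i + b) = rk i b.
Proof.
rewrite offR_enc encE !catA.
have hi := ltn_ord i; have hb : (b : nat) <= 1 by case: b.
rewrite nth_cat !size_cat adjs_size labs_size ranks_size [size _]/=; case: ltnP => h; last by lia.
rewrite nth_cat !size_cat adjs_size labs_size [size _]/=; case: ltnP => h'; first by lia.
have -> : 2 + n * n + L * n + i + i + b - (2 + n * n + L * n) = i * size [:: false; true] + b.
  by rewrite /=; lia.
rewrite (nth_pairs _ i false) ?size_enum_ord //.
by rewrite nth_ord_enum; case: b {hb h h'}.
Qed.

Lemma labbit_enc (l : 'I_L) (i : 'I_n) : labbit w l i = lab G l i.
Proof.
have hi := ltn_ord i; have hl := ltn_ord l.
rewrite /labbit enc_n offL_enc mulwE; last by rewrite enc_size; nia.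
rewrite encE !catA nth_cat !size_cat adjs_size labs_size ranks_size [size _]/=; case: ltnP => h; last by nia.
rewrite nth_cat !size_cat adjs_size labs_size [size _]/=; case: ltnP => h'; last by nia.
rewrite nth_cat !size_cat adjs_size [size _]/=; case: ltnP => h''; first by nia.
have -> : 2 + n * n + l * n + i - (2 + n * n) = l * size (enum 'I_n) + i.
  by rewrite size_enum_ord; lia.
rewrite (nth_pairs _ l i) ?size_enum_ord // !nth_ord_enum.
by case: (lab G l i).
Qed.

Lemma rank_lt (i : 'I_n) b : rk i b < n * 2.
Proof.
have : #|[set q' : 'I_n * bool | (endpoint A q' < endpoint A (i, b))%R]| < #|[set: 'I_n * bool]|.
  apply: proper_card; rewrite properT; apply/eqP => /setP/(_ (i, b)).
  by rewrite !inE Order.POrderTheory.ltxx.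
by rewrite cardsT card_prod card_ord card_bool.
Qed.

Lemma pos_enc (i : 'I_n) (b : bool) : posw w i b = (rk i b * 2 + b) * n + i.+1.
Proof.
rewrite /posw rank_enc enc_n; have h := rank_lt i b; have hb : (b : nat) <= 1 by case: (b).
rewrite mulwE; first by lia.
by rewrite enc_size; nia.
Qed.

Lemma arcsw_enc : arcsw w = [seq (nat_of_ord i, (posw w i 0, posw w i 1)) | i <- enum 'I_n].
Proof.
rewrite /arcsw enc_n iotawE ?n_le_w // -val_enum_ord -map_comp.
by apply: eq_map => i.
Qed.
End Encoding.

(** * Circular arcs *)

Section Geometry.
Variables (R : realType) (n : nat) (A : 'I_n -> circ_arc R).
Import Order.TTheory GRing.Theory Num.Theory.
Local Open Scope ring_scope.

Lemma rank_le q q' : (endpoint_rank A q <= endpoint_rank A q')%N = (endpoint A q <= endpoint A q').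
Proof.
apply/idP/idP => [|h]; last first.
  by apply: subset_leq_card; apply/subsetP => z; rewrite !inE => /lt_le_trans; apply.
apply: contraTT; rewrite -ltNge -ltnNge => h; apply: proper_card; apply/properP; split.
  by apply/subsetP => z; rewrite !inE => /lt_trans; apply.
by exists q'; rewrite !inE ?ltxx.
Qed.

Definition crossing (a : circ_arc R) : bool := val a.2 < val a.1.

Lemma circle0_proof : (0 <= (0 : R) < 1). Proof. by rewrite lexx ltr01. Qed.
Definition circle0 : circle R := exist _ 0 circle0_proof.

(** Two arcs through the point 0 meet there; in the other cases an end of one of the arcs is a
    common point. *)
Lemma arc_meetsP (a b : circ_arc R) : reflect (arc_meets a b)
  (2 <= crossing a + crossing b + (val a.1 <= val b.2)%R + (val b.1 <= val a.2)%R)%N.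
Proof.
case: a b => [s t] [s' t']; rewrite /crossing /=.
have s0 (p : circle R) : 0 <= val p by case: p => p /= /andP[].
apply: (iffP idP) => [|[p []]]; rewrite /arc_meets /in_arc /=.
- case: (ltP (val t) (val s)) => h; case: (ltP (val t') (val s')) => h' /=.
  + by exists circle0; rewrite /= !s0 !orbT.
  + case: (leP (val s) (val t')) => h1; first by exists t'; rewrite h1 h' lexx.
    by case: (leP (val s') (val t)) => h2 //= _; exists s'; rewrite h2 orbT h' lexx.
  + case: (leP (val s') (val t)) => h1; first by exists t; rewrite h1 h lexx.
    by case: (leP (val s) (val t')) => h2 //= _; exists s; rewrite h2 orbT h lexx.
  + case: (leP (val s) (val t')) => h1; case: (leP (val s') (val t)) => h2 //= _.
    case: (leP (val s) (val s')) => h3; first by exists s'; rewrite h3 h2 lexx h'.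
    by exists s; rewrite lexx h (ltW h3) h1.
- case: (ltP (val t) (val s)) => h; case: (ltP (val t') (val s')) => h' //=.
  + case/orP => h1 /andP[h2 h3]; first by rewrite (le_trans h1 h3).
    by rewrite (le_trans h2 h1) addn1; case: (_ <= _).
  + move=> /andP[h2 h3] /orP[] h1; first by rewrite (le_trans h1 h3) addn1; case: (_ <= _).
    by rewrite (le_trans h2 h1).
  + by move=> /andP[h1 h2] /andP[h3 h4]; rewrite (le_trans h1 h4) (le_trans h3 h2).
Qed.

Lemma arc_sub_nested (a b : circ_arc R) : crossing a = crossing b ->
  val a.1 <= val b.1 -> val b.2 <= val a.2 -> arc_sub b a.
Proof.
case: a b => [s t] [s' t']; rewrite /crossing /arc_sub /in_arc /= => e h1 h2 p.
rewrite !leNgt -e; case: ifP => _.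
  by rewrite -!leNgt => /andP[h3 h4]; rewrite (le_trans h1 h3) (le_trans h4 h2).
by rewrite -!leNgt => /orP[h3|h3]; [rewrite (le_trans h1 h3) | rewrite (le_trans h3 h2) orbT].
Qed.

Local Close Scope ring_scope.
Local Open Scope nat_scope.

Definition point (i : 'I_n) (b : bool) : nat := (endpoint_rank A (i, b) * 2 + b) * n + i.+1.

Lemma point_inj i b j c : point i b = point j c -> i = j /\ b = c.
Proof.
rewrite /point => e; have hi := ltn_ord i; have hj := ltn_ord j.
have n0 : 0 < n by lia.
have e2 : endpoint_rank A (i, b) * 2 + b = endpoint_rank A (j, c) * 2 + c /\ (i : nat) = j.
  have := congr1 (edivn^~ n) (congr1 predn e); rewrite !addnS /= !edivn_eq // => -[-> ->]; by split.
case: e2 => e2 e3; split; first exact: val_inj.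
by have := congr1 odd e2; rewrite !oddD !oddM !andbF /= !oddb.
Qed.

Lemma point_gt0 i b : 0 < point i b. Proof. by rewrite /point addnS. Qed.

Lemma point_lt_rank i j b : point i b < point j b -> endpoint_rank A (i, b) <= endpoint_rank A (j, b).
Proof. by rewrite /point leqNgt => h; apply/negP => h'; have := ltn_ord j; have := ltn_ord i; nia. Qed.

(** This is the purpose of putting left ends first: when the two end points coincide, both sides
    hold whatever the indices are. *)
Lemma point_left_right i j : (point i false <= point j true) = (val (A i).1 <= val (A j).2)%R.
Proof.
rewrite -[RHS]/(endpoint A (i, false) <= endpoint A (j, true))%R -rank_le /point.
have := ltn_ord i; have := ltn_ord j; move: (endpoint_rank A (i, false)) (endpoint_rank A (j, true)) => x y h1 h2.
rewrite addn0 mulnDl mul1n; apply/idP/idP => [|h].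
  rewrite [x <= y]leqNgt; apply: contraTN => h; rewrite -ltnNge.
  have : (y * 2 + 2) * n <= x * 2 * n by rewrite leq_mul2r; apply/orP; right; clear - h; lia.
  by rewrite mulnDl; move: (y * 2 * n) (x * 2 * n); clear - h1 h2; lia.
have : x * 2 * n <= y * 2 * n by rewrite !leq_mul2r h !orbT.
by move: (y * 2 * n) (x * 2 * n); clear - h1 h2; lia.
Qed.

Definition arcpair (i : 'I_n) : nat * nat := (point i false, point i true).

Lemma wrap_crossing i : wrap (arcpair i) = crossing (A i).
Proof. by rewrite /wrap /crossing ltnNge point_left_right Order.TotalTheory.ltNge. Qed.

Lemma nest_sub i j : nest (arcpair i) (arcpair j) -> arc_sub (A j) (A i).
Proof.
rewrite /nest !wrap_crossing => /and3P[h1 h2 h3]; apply: arc_sub_nested.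
- by case: (crossing _) h1; case: (crossing _).
- by have := point_lt_rank h2; rewrite rank_le.
- by have := point_lt_rank h3; rewrite rank_le.
Qed.

Lemma nest_trans : transitive nest.
Proof.
move=> [a b] [c d] [e f]; rewrite /nest /wrap /=.
move=> /and3P[h1 h2 h3] /and3P[h4 h5 h6]; rewrite (ltn_trans h2 h5) (ltn_trans h6 h3) !andbT.
by move: h1 h4; case: (d < c) => /=; case: (b < a) => //=; case: (f < e).
Qed.

Lemma nest_irr p : nest p p = false.
Proof. by rewrite /nest ltnn andbF. Qed.

Notation tabA := [seq arcpair i | i <- enum 'I_n].

Lemma chain_exists c q : q \in iter c (nested tabA) tabA -> exists i s,
  [/\ q = arcpair i, size s = c & path (fun a b : 'I_n => nest (arcpair b) (arcpair a)) i s].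
Proof.
elim: c q => [|c IH] q; first by case/mapP => i _ ->; exists i, [::].
rewrite iterS mem_filter => /andP[/hasP[p hp hn] /mapP[i _ eq]].
have [j [s [ep hs hp']]] := IH _ hp; exists i, (j :: s); rewrite -eq /= hs hp' andbT; split=> //.
by rewrite -eq -ep.
Qed.

(** An arc that survives [c] rounds of [nested] is the innermost of a chain of [c + 1] arcs, on
    which [f] is injective. With the identity for [f] the chains are shorter than the number of
    rounds, with a colouring they have at most [k] members. *)
Lemma chain_size (T : eqType) (f : 'I_n -> T) (U : seq T) c q :
  (forall i j, nest (arcpair i) (arcpair j) -> f i != f j) -> (forall i, f i \in U) ->
  q \in iter c (nested tabA) tabA -> c < size U.
Proof.
move=> hf hU /chain_exists[i [s [_ <- hp]]].
have tr : transitive (fun a b : 'I_n => nest (arcpair b) (arcpair a)).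
  by move=> a b d h1 h2; apply: nest_trans h2 h1.
have : uniq [seq f j | j <- i :: s].
  have : sorted (fun a b : 'I_n => nest (arcpair b) (arcpair a)) (i :: s) by [].
  rewrite (sorted_pairwise tr) uniq_pairwise pairwise_map.
  by apply: sub_pairwise => a b /hf; rewrite eq_sym.
have hs : {subset [seq f j | j <- i :: s] <= U} by move=> z /mapP[j _ ->].
by move=> /uniq_leq_size/(_ hs); rewrite size_map.
Qed.

Lemma chains_count (p : nat * nat) : count_mem p.1 (chains tabA) =
  \sum_(c < n) count_mem p.1 [seq q.1 | q <- iter c.+1 (nested tabA) tabA].
Proof.
rewrite /chains; have E (v : seq (nat * nat)) : foldl (fun s (_ : nat * nat) =>
     (nested tabA s.1, [seq q.1 | q <- nested tabA s.1] ++ s.2)) (tabA, [::]) v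
   = iter (size v) (fun s => (nested tabA s.1, [seq q.1 | q <- nested tabA s.1] ++ s.2)) (tabA, [::]).
  by elim/last_ind: v => // v x IH; rewrite foldl_rcons size_rcons iterS IH.
rewrite E size_map size_enum_ord; set F := fun s => _; pose s0 := (tabA, [::] : seq nat).
have F1 m : (iter m F s0).1 = iter m (nested tabA) tabA by elim: m => //= m ->.
suff H m : count_mem p.1 (iter m F s0).2 =
    \sum_(c < m) count_mem p.1 [seq q.1 | q <- iter c.+1 (nested tabA) tabA] by apply: H.
elim: m => [|m IH]; first by rewrite big_ord0.
by rewrite big_ord_recr iterS [X in count_mem _ X]/= count_cat IH addnC F1.
Qed.

Lemma arc_count (i : 'I_n) (Q : seq (nat * nat)) : uniq Q -> {subset Q <= tabA} ->
  count_mem (point i false) [seq q.1 | q <- Q] = (arcpair i \in Q).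
Proof.
move=> uQ sQ; rewrite count_map -(count_uniq_mem _ uQ); apply: eq_in_count => q /sQ/mapP[j _ ->] /=.
apply/eqP/eqP => [/point_inj[-> _]//|[-> _]//].
Qed.

Lemma nested_iter c : uniq (iter c (nested tabA) tabA) /\ {subset iter c (nested tabA) tabA <= tabA}.
Proof.
have u0 : uniq tabA.
  by rewrite map_inj_uniq ?enum_uniq // => i j [/point_inj[]].
case: c => [|c]; first by split.
split; first by rewrite filter_uniq.
by move=> x; rewrite iterS mem_filter => /andP[].
Qed.

Lemma height_sum i : height (chains tabA) (arcpair i) = \sum_(c < n) (arcpair i \in iter c.+1 (nested tabA) tabA).
Proof.
rewrite /height size_filter -[count _ _]/(count_mem (arcpair i).1 _) chains_count.
by apply: eq_bigr => c _; have [u1 u2] := nested_iter c.+1; rewrite arc_count.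
Qed.

Lemma nest_step c i j : nest (arcpair i) (arcpair j) ->
  arcpair i \in iter c (nested tabA) tabA -> arcpair j \in iter c.+1 (nested tabA) tabA.
Proof.
move=> h hi; rewrite iterS mem_filter; apply/andP; split; first by apply/hasP; exists (arcpair i).
by rewrite map_f ?mem_enum.
Qed.

(** If the outer arc survives [c] rounds, the inner one survives [c + 1]. This shift gains the term
    of [c = 0], and nothing is lost at the other end because no arc survives [n] rounds. *)
Lemma height_nest i j : nest (arcpair i) (arcpair j) ->
  height (chains tabA) (arcpair i) < height (chains tabA) (arcpair j).
Proof.
move=> h; rewrite !height_sum.
pose a c : nat := arcpair i \in iter c (nested tabA) tabA.
pose b c : nat := arcpair j \in iter c (nested tabA) tabA.
have ab c : a c <= b c.+1.
  by rewrite /a /b; case E: (arcpair i \in _) => //; rewrite (nest_step h E).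
have a0 : a 0 = 1 by rewrite /a /= map_f ?mem_enum.
have an : a n = 0.
  rewrite /a; case E: (_ \in _) => //; exfalso.
  suff : n < size (enum 'I_n) by rewrite size_enum_ord ltnn.
  apply: (@chain_size _ id _ n (arcpair i)) => //.
    by move=> x y; apply: contraTneq => ->; rewrite nest_irr.
  by move=> x; rewrite mem_enum.
have : \sum_(c < n.+1) a c <= \sum_(c < n) b c.+1.
  by rewrite big_ord_recr /= an addn0; apply: leq_sum => c _.
by rewrite big_ord_recl a0 add1n.
Qed.

(** This is where properness enters: nested arcs are contained in one another and so have different
    colours, which limits the chains to [k] arcs. *)
Lemma height_lt k i : kfold_proper k A -> height (chains tabA) (arcpair i) < k.
Proof.
move=> [col hcol].
have bnd c q : q \in iter c (nested tabA) tabA -> c < k.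
  have := @chain_size _ col (enum 'I_k) c q; rewrite size_enum_ord; apply.
    move=> x y hn; apply/eqP => e; apply: (hcol (col x) y x); rewrite ?inE ?e ?eqxx //.
      by apply/eqP => exy; move: hn; rewrite exy nest_irr.
    exact: nest_sub.
  by move=> x; rewrite mem_enum.
have k0 : 0 < k by apply: (bnd 0 (arcpair i)); rewrite /= map_f ?mem_enum.
rewrite height_sum; apply: (@leq_ltn_trans (\sum_(c < n) (c.+1 < k))).
  by apply: leq_sum => c _; case E: (_ \in _) => //; rewrite (bnd _ _ E).
have : forall m, \sum_(c < m) (c.+1 < k) <= k.-1.
  move=> m; have [hm|hm] := leqP m k.-1.
    apply: leq_trans hm; rewrite -[X in _ <= X]card_ord -sum1_card; apply: leq_sum => c _.
    by case: (_ < _).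
  rewrite -(subnKC (ltnW hm)) big_split_ord /= [X in _ + X]big1 ?addn0; last first.
    by move=> c _; case: ltnP => //; lia.
  by rewrite -[X in _ <= X]card_ord -sum1_card; apply: leq_sum => c _; case: (_ < _).
by move=> /(_ n); lia.
Qed.
End Geometry.

(** * The complete algorithm and its correctness *)

Definition tabw w := [seq p.2 | p <- arcsw w].
Definition ptsw w := ptsof (tabw w).
Definition topw w := topof (ptsw w).
Definition leftsw w := [seq p.1 | p <- tabw w].
Definition coloursw w := colours w (codeof w) (chains (tabw w)) (arcsw w).
Definition preds0w w := predsw (topw w) (coloursw w).
Definition uw w := unary (codeof w).
Definition levelw w :=
  foldl (fun s (_ : nat) => refine (tabw w) (topw w) (uw w) (ptsw w) s) (preds0w w) (codeof w).
Definition playsw w :=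
  plays (tabw w) (topw w) (uw w) (moves (levelw w)) (leftsw w) (codeof w).
Definition dpw w :=
  dp (tabw w) (labtabw w (codeof w) (arcsw w)) (playsw w).2.2 (codeof w).
Definition alg w : bool := meml [::] (head (0, [::]) (dpw w)).2.

Lemma foldl_iter (S T : Type) (f : S -> S) (s : S) (l : seq T) :
  foldl (fun s _ => f s) s l = iter (size l) f s.
Proof. by elim: l s => //= x l IH s; rewrite IH -iterSr. Qed.

Lemma levelwE w : levelw w = level (tabw w) (topw w) (ptsw w) (preds0w w) (uw w) (size (codeof w)).
Proof. exact: foldl_iter. Qed.

Definition lookup (cl : seq (nat * seq nat)) (x : nat) : seq nat :=
  head [::] [seq c.2 | c <- cl & c.1 == x].

(** Presents the list of colours as the graph of a function, the form that [mem_classes] deals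
    with. *)
Lemma lookup_graph (cl : seq (nat * seq nat)) : uniq [seq c.1 | c <- cl] ->
  cl = [seq (x, lookup cl x) | x <- [seq c.1 | c <- cl]].
Proof.
move=> h; rewrite -map_comp; rewrite -[LHS]map_id; apply/eq_in_map => -[x c] hx /=.
congr pair; rewrite /lookup; elim: cl h hx => //= -[y d] cl IH /= /andP[h1 h2].
rewrite inE => /orP[/eqP[-> ->]|hx]; first by rewrite eqxx.
case: eqP => [e|_]; last exact: IH.
by move: h1; rewrite e (map_f (fun c : nat * seq nat => c.1) hx).
Qed.

Section Correctness.
Variables (R : realType) (L n : nat) (G : lgraph L n) (A : 'I_n -> circ_arc R) (phi : fo L 0).
Notation w := (encode G A phi).
Notation code := (fo_code phi).
Notation hs := (chains [seq arcpair A i | i <- enum 'I_n]).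

Lemma tabw_enc : tabw w = [seq arcpair A i | i <- enum 'I_n].
Proof.
rewrite /tabw arcsw_enc -map_comp; apply: eq_map => i /=.
by rewrite /arcpair /point -(pos_enc G A phi i false) -(pos_enc G A phi i true).
Qed.

Lemma arcsw_pairs : arcsw w = [seq (nat_of_ord i, arcpair A i) | i <- enum 'I_n].
Proof.
rewrite arcsw_enc; apply: eq_map => i.
by rewrite /arcpair /point -(pos_enc G A phi i false) -(pos_enc G A phi i true).
Qed.

Lemma mem_ptsw x : reflect (exists i b, x = point A i b) (x \in ptsw w).
Proof.
rewrite /ptsw /ptsof tabw_enc -map_comp; apply: (iffP flattenP) => [[s /mapP[i _ ->]]|[i [b ->]]].
  by rewrite !inE => /orP[]/eqP->; [exists i, false|exists i, true].
exists [:: point A i false; point A i true]; first by apply/mapP; exists i; rewrite ?mem_enum.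
by case: b; rewrite !inE eqxx ?orbT.
Qed.

Lemma uniq_ptsw : uniq (ptsw w).
Proof.
rewrite /ptsw /ptsof tabw_enc -map_comp; elim: (enum 'I_n) (enum_uniq 'I_n) => //= i s IH /andP[h1 h2].
have E b : point A i b \notin flatten [seq [:: (arcpair A i).1; (arcpair A i).2] | i <- s].
  apply/negP => /flattenP[t /mapP[j hj ->]].
  by rewrite !inE => /orP[]/eqP/point_inj[ij _]; move: h1; rewrite ij hj.
rewrite inE negb_or (E false) (E true) IH //.
by case: eqP => [/point_inj[]|].
Qed.

Lemma partner_tab (s : seq 'I_n) x : partner [seq arcpair A i | i <- s] x =
  if [pick ib : 'I_n * bool | (ib.1 \in s) && (x == point A ib.1 ib.2)] is Some ib
  then point A ib.1 (~~ ib.2) else x.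
Proof.
elim/last_ind: s => [|s i IH]; first by case: pickP => // -[j b]; rewrite in_nil.
rewrite /partner map_rcons foldl_rcons -/(partner _ _) IH /=.
case: (pickP (fun ib : 'I_n * bool => (ib.1 \in rcons s i) && (x == point A ib.1 ib.2))).
- move=> [j b] /= /andP[]; rewrite mem_rcons inE => /orP[/eqP->|hj] /eqP->.
    by case: b; [case: eqP => [/point_inj[_]//|_] | ]; rewrite eqxx.
  have [->|nij] := eqVneq i j.
    by case: b; [case: eqP => [/point_inj[_]//|_] | ]; rewrite eqxx.
  do 2 (case: eqP => [/point_inj[e _]|_]; first by rewrite e eqxx in nij).
  case: pickP => [[j' b'] /= /andP[_ /eqP/point_inj[-> ->]]//|/(_ (j, b))].
  by rewrite /= hj eqxx.
- move=> h; have hi := h (i, false); have hi' := h (i, true).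
  rewrite /= mem_rcons mem_head /= in hi hi'; rewrite eq_sym hi eq_sym hi'.
  case: pickP => // -[j b] /= /andP[hj hx]; have := h (j, b).
  by rewrite /= mem_rcons inE hj hx orbT.
Qed.

Lemma partner_point i b : partner (tabw w) (point A i b) = point A i (~~ b).
Proof.
rewrite tabw_enc partner_tab; case: pickP => [[j c] /= /andP[_ /eqP/point_inj[-> ->]]//|/(_ (i, b))].
by rewrite /= mem_enum eqxx.
Qed.

Lemma partner_out x : x \notin ptsw w -> partner (tabw w) x = x.
Proof.
move=> hx; rewrite tabw_enc partner_tab; case: pickP => // -[i b] /= /andP[_ /eqP e].
by case/negP: hx; apply/mem_ptsw; exists i, b.
Qed.

Lemma top_gt x l : x \in l -> x < topof l.
Proof.
rewrite /topof; have mono s r : s <= foldl (fun s y => s + y) s r.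
  by elim: r s => //= y r IH s; apply: leq_trans (IH _); apply: leq_addr.
suff H s : 0 < s -> x \in l -> x < foldl (fun s y => s + y) s l by apply: H.
elim: l s => //= y l IH s hs; rewrite inE => /orP[/eqP->|hx]; last first.
  by apply: IH => //; rewrite addn_gt0 hs.
by apply: leq_trans (mono _ _); lia.
Qed.

Lemma points_enc : points (tabw w) (topw w) (ptsw w).
Proof.
split.
- move=> x hx; rewrite (top_gt hx) andbT.
  by move/mem_ptsw: hx => [i [b ->]]; apply: point_gt0.
- by move=> x /mem_ptsw[i [b ->]]; rewrite partner_point; apply/mem_ptsw; exists i, (~~ b).
- by move=> x /mem_ptsw[i [b ->]]; rewrite !partner_point negbK.
- by apply: partner_out; apply/negP => /mem_ptsw[i [b e]]; have := point_gt0 A i b; rewrite -e.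
- by apply: partner_out; apply/negP => /top_gt; rewrite ltnn.
Qed.

Definition pcolour (i : 'I_n) (b : bool) : seq nat :=
  height hs (arcpair A i) :: nat_of_bool b :: nat_of_bool (wrap (arcpair A i)) ::
  [seq nat_of_bool (labbit w c i) | c <- code].

Lemma coloursw_enc : coloursw w =
  flatten [seq [:: (point A i false, pcolour i false); (point A i true, pcolour i true)] | i <- enum 'I_n].
Proof. by rewrite /coloursw /colours tabw_enc arcsw_pairs codeof_enc -map_comp. Qed.

Lemma coloursw_pts : [seq c.1 | c <- coloursw w] = ptsw w.
Proof.
rewrite coloursw_enc /ptsw /ptsof tabw_enc map_flatten -!map_comp.
by congr flatten; apply: eq_map => i.
Qed.

Notation col := (lookup (coloursw w)).

Lemma coloursw_graph : coloursw w = [seq (x, col x) | x <- ptsw w].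
Proof. by rewrite -coloursw_pts; apply: lookup_graph; rewrite coloursw_pts uniq_ptsw. Qed.

Lemma col_point i b : col (point A i b) = pcolour i b.
Proof.
have : (point A i b, pcolour i b) \in coloursw w.
  rewrite coloursw_enc; apply/flattenP.
  exists [:: (point A i false, pcolour i false); (point A i true, pcolour i true)].
    by apply/mapP; exists i; rewrite ?mem_enum.
  by case: b; rewrite !inE eqxx ?orbT.
by rewrite {1}coloursw_graph => /mapP[x _ [-> ->]].
Qed.

Lemma mem_preds0 P : P \in preds0w w -> [\/ P = [:: 0], P = [:: topw w] |
  exists2 x, x \in ptsw w & P = [seq y <- ptsw w | col y == col x]].
Proof.
rewrite /preds0w /predsw !inE {1}coloursw_graph => /or3P[/eqP->|/eqP->|/mem_classes[x hx ->]].
- by constructor 1.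
- by constructor 2.
- by constructor 3; exists x.
Qed.

Lemma preds0_class x : x \in ptsw w -> [seq y <- ptsw w | col y == col x] \in preds0w w.
Proof.
move=> hx; have h := mem_classes col (ptsw w) [seq y <- ptsw w | col y == col x].
rewrite -coloursw_graph in h; rewrite !inE; apply/orP; right; apply/orP; right.
by apply/h; exists x.
Qed.

Lemma same_class x y : x \in ptsw w -> y \in ptsw w ->
  (forall P, P \in preds0w w -> (x \in P) = (y \in P)) -> col x = col y.
Proof.
move=> hx hy h; have := h _ (preds0_class hx).
by rewrite !mem_filter eqxx hx hy !andbT => /esym/eqP->.
Qed.

(** Points of one colour are ends on the same side, of arcs with the same height and the same
    position relative to 0. If the partner map reversed two of them, one arc would be nested in the
    other, against [height_nest]. *)
Lemma goodp_enc : goodp (tabw w) (topw w) (ptsw w) (preds0w w).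
Proof.
split.
- by rewrite inE eqxx.
- by rewrite !inE eqxx orbT.
- move=> P /mem_preds0[->|->|[x _ ->]] y; rewrite ?inE /valid.
  + by move=> ->.
  + by move=> ->; rewrite orbT.
  + by rewrite mem_filter => /andP[_ ->]; rewrite !orbT.
move=> x hx; exists [seq y <- ptsw w | col y == col x]; split; first exact: preds0_class.
- by rewrite mem_filter eqxx.
- by move=> y; rewrite mem_filter => /andP[].
move=> a b; rewrite !mem_filter => /andP[/eqP ea /mem_ptsw[i [c ha]]] /andP[/eqP eb /mem_ptsw[j [d hb]]].
move: ea; rewrite -eb ha hb !col_point => -[eh ecd ew _].
have {}ecd : c = d by case: c d ecd {ha hb} => [] [].
have {}ew : (wrap (arcpair A i) && wrap (arcpair A j)) || (~~ wrap (arcpair A i) && ~~ wrap (arcpair A j)).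
  by case: (wrap (arcpair A i)) ew; case: (wrap (arcpair A j)).
have {}ew' : (wrap (arcpair A j) && wrap (arcpair A i)) || (~~ wrap (arcpair A j) && ~~ wrap (arcpair A i)).
  by rewrite andbC [X in _ || X]andbC.
subst d; rewrite !partner_point => hlt.
have ij e : point A i e <> point A j e by move=> /point_inj[e' _]; move: hlt; rewrite e' ltnn.
rewrite ltnNge leq_eqVlt; apply/negP => /orP[/eqP/esym/ij//|hlt'].
case: c hlt hlt' {ha hb} => /= hlt hlt'.
- by have := @height_nest _ _ A j i; rewrite /nest ew' hlt' hlt eh ltnn => /(_ isT).
- by have := @height_nest _ _ A i j; rewrite /nest ew hlt' hlt eh ltnn => /(_ isT).
Qed.

Hypothesis rep : represents A G.

(** A vertex is represented by its left end. The side bit of the colours makes every point in the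
    class of a left end a left end. *)
Lemma arc_model_enc : arc_model (tabw w) (ptsw w) (preds0w w) G (fun i => point A i false) code.
Proof.
have hp i : point A i false \in ptsw w by apply/mem_ptsw; exists i, false.
split=> //.
- by move=> i j /point_inj[].
- move=> i j; have [->|nij] := eqVneq i j; first exact: adj_irr.
  have wc a : (point A a true < point A a false) = crossing (A a) := wrap_crossing A a.
  rewrite /= /meets !partner_point /= !wc !point_left_right.
  by apply/idP/idP => [/(rep nij)/arc_meetsP|/arc_meetsP/(rep nij)].
- move=> i j l h hl; have := same_class (hp i) (hp j) h.
  rewrite !col_point => -[_ _ e]; rewrite -(labbit_enc G A phi) -(labbit_enc G A phi l j).
  have := (eq_in_map _ _ _).2 e _ hl.
  by case: labbit; case: labbit.
- move=> i x hx h; have := same_class (hp i) hx h.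
  move/mem_ptsw: hx => [j [b ->]]; rewrite !col_point => -[_ e _].
  by exists j; case: b e.
Qed.

Lemma alg_models : alg w = models G phi.
Proof.
have cE := codeof_enc G A phi.
rewrite /alg /dpw /playsw levelwE cE.
apply: (@dp_models (tabw w) (topw w) (ptsw w) (preds0w w) (uw w) code L n G (fun i => point A i false)
  (leftsw w) _ points_enc goodp_enc arc_model_enc) => //.
- by rewrite /uw cE size_unary rad_le.
- move=> x; rewrite /leftsw tabw_enc -map_comp; apply: (iffP mapP) => [[i _ ->]|[i ->]]; exists i => //.
  by rewrite mem_enum.
- move=> l i hl; rewrite /labtabw arcsw_pairs; apply/flattenP/idP => [[s /mapP[c hc ->]]|hli].
    case/mapP => p; rewrite mem_filter => /andP[h /mapP[j _ ep]] [ec]; subst c p.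
    by move=> /point_inj[-> _]; rewrite -(labbit_enc G A phi).
  exists [seq [:: nat_of_ord l; p.2.1] | p <- [seq (nat_of_ord i, arcpair A i) | i <- enum 'I_n] & labbit w l p.1].
    by apply/mapP; exists (l : nat).
  apply/mapP; exists (nat_of_ord i, arcpair A i) => //.
  by rewrite mem_filter /= labbit_enc hli map_f ?mem_enum.
Qed.
End Correctness.

(** * Polynomial time under side conditions *)

Lemma cpoly_weak (A B : dtype) (p p' : A -> nat -> Prop) (f : A -> B) :
  (forall x K, p x K -> p' x K) -> cpoly p' f -> cpoly p f.
Proof. by move=> h [T [e [h1 h2]]]; exists T, e; split=> // x K hK /h; apply: h2. Qed.

Lemma cpoly_map_gen (A B C : dtype) p q (F : A -> B -> C) (l : A -> seq B) :
  (forall z K K', K <= K' -> q z K -> q z K') ->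
  cpoly q (fun z : A * B => F z.1 z.2) -> cpoly p (fun x => x) -> cpoly p l ->
  (exists c, forall x K, 1 < K -> p x K -> forall u y v, l x = u ++ y :: v -> q (x, y) (K ^ c.+1)) ->
  cpoly p (fun x => [seq F x y | y <- l x]).
Proof.
move=> qle hF hx hl [c hc].
have E s x r : foldl (fun s y => F x y :: s) s r = rev [seq F x y | y <- r] ++ s.
  by elim: r s => //= y r IH s; rewrite IH rev_cons -cats1 -catA.
apply: (@eq_cpoly _ _ _ (fun x => rev (foldl (fun s y => F x y :: s) [::] (l x)))).
  by move=> x; rewrite E cats0 revK.
apply: cpoly_rev.
pose pb (z : A * (seq C * B)) K := dfits K z /\ q (z.1, z.2.2) K.
apply: (@cpoly_foldl_gen A (seq_dt C) B p pb (fun x s y => F x y :: s) (fun=> [::]) l) => //.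
- have h0 : cpoly pb (fun z : A * (seq C * B) => z) by apply: cpoly_weak (@ptime_id _) => z K [].
  apply: cpoly_cons; last by pauto.
  apply: (@cpoly_comp _ _ _ pb q (fun z : A * (seq C * B) => (z.1, z.2.2)) (fun z : A * B => F z.1 z.2)).
  + by pauto.
  + exact: hF.
  + by exists 0 => z K hK [_]; rewrite expn1.
- exact: cpoly_nil.
have [TF [eF [_ fF]]] := hF; have [Tx [ex [_ fx]]] := hx; have [Tl [el [_ fl]]] := hl.
exists (c + c.+1 * eF + ex + el) => x K hK hp.
have [_ hx'] := fx x K hK hp; have [_ hl'] := fl x K hK hp.
have fit1 u y v : l x = u ++ y :: v -> dfits (K ^ (c.+1 * eF)) (F x y).
  by move=> e; have [_] := fF (x, y) _ (@exp_gt1 K c.+1 hK isT) (hc x K hK hp _ _ _ e); rewrite expnM.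
have fit2 u v : l x = u ++ v -> dfits (K ^ (c + c.+1 * eF + ex + el).+1) ([seq F x y | y <- u] : seq_dt C).
  move=> e; apply: dfits_all => [|u' y v' e'].
    rewrite size_map; apply: (@leq_trans (size (l x))); first by rewrite e size_cat leq_addr.
    by case: hl' => h _; apply: leq_trans h _; apply: exp_le => //; lia.
  have [t [ht ey]] : exists t, y = F x t /\ exists u2 v2, u = u2 ++ t :: v2.
    elim: u u' e' {e} => [|a u IH] [|a' u'] //= [ea eu].
      by exists a; split=> //; exists [::], u.
    have [t [ht [u2 [v2 e2]]]] := IH _ eu; exists t; split=> //; exists (a :: u2), v2.
    by rewrite e2.
  case: ey => u2 [v2 e2]; rewrite ht; apply: dfits_le (fit1 u2 t (v2 ++ v) _).
    by apply: exp_le => //; lia.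
  by rewrite e e2 -catA.
split; last first.
  by rewrite E cats0; apply: dfits_rev; apply: (fit2 _ [::]); rewrite cats0.
move=> u y v e; split.
  split; first by apply: dfits_le hx'; apply: exp_le => //; lia.
  split; first by rewrite E cats0; apply: dfits_rev; apply: fit2 e.
  by rewrite e in hl'; apply: dfits_le (dfits_mid hl'); apply: exp_le => //; lia.
by apply: qle (hc x K hK hp _ _ _ e); apply: exp_le => //; lia.
Qed.

Lemma cpoly_headd (A T : dtype) p (d : T) (f : A -> seq T) :
  ptime (fun _ : seq T => d) -> cpoly p f -> cpoly p (fun x => head d (f x)).
Proof.
move=> hd; apply: (@cpoly_app A (seq_dt T) T p f (head d)).
pose b (s : bool * T) y := if s.1 then s else (true, y).
have E q : foldl b (true, q.1) q.2 = (true, q.1) by case: q => a; elim.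
apply: (@eq_cpoly (seq_dt T) T _ (fun x => (foldl b (false, d) x).2)).
  by case=> //= y x; rewrite {2}/b /= (E (y, x)).
apply: cpoly_snd; apply: (@ptime_foldl _ (prod_dt bool_dt T) T (fun _ s y => b s y) (fun=> (false, d)) (fun x => x)).
- by rewrite /b; pauto.
- by pauto; apply: cpoly_bool.
- by pauto.
have [c hc] := ptime_bound hd; exists c.+1 => x K i hK hx.
case Ei : (take i x) => [|y r]; first by split=> //; apply: (hc x).
rewrite /= {2}/b (E (y, r)); split=> //=.
have : dfits K (take i x : seq_dt T) by apply: dfits_take.
by rewrite Ei => -[_ [h _]]; apply: dfits_le h; apply: (@exp_le K 1 c.+1).
Qed.

Ltac peta := lazymatch goal with
  | |- cpoly ?p (map ?f) => change (cpoly p (fun x => map f x))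
  | |- cpoly ?p (filter ?f) => change (cpoly p (fun x => filter f x))
  | |- cpoly ?p (has ?f) => change (cpoly p (fun x => has f x))
  | |- cpoly ?p flatten => change (cpoly p (fun x => flatten x))
  | |- cpoly ?p size => change (cpoly p (fun x => size x))
  end.
Ltac puser ::= first [plist | peta].

(** * Running time *)

Lemma ptime_up : ptime (fun z : nat * (nat * (seq nat * nat)) => up z.1 z.2.1 z.2.2.1 z.2.2.2).
Proof. by rewrite /up; pauto. Qed.
Lemma ptime_dn : ptime (fun z : nat * (seq nat * nat) => dn z.1 z.2.1 z.2.2).
Proof. by rewrite /dn; pauto. Qed.
Lemma ptime_partner : ptime (fun z : seq (nat * nat) * nat => partner z.1 z.2).
Proof. by rewrite /partner; pauto. Qed.

Definition cpoly_up (A : dtype) p (a b : A -> nat) (c : A -> seq nat) (d : A -> nat) :=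
  @cpoly_app4 A nat_dt nat_dt (seq_dt nat_dt) nat_dt nat_dt p up a b c d ptime_up.
Definition cpoly_dn (A : dtype) p (a : A -> nat) (b : A -> seq nat) (c : A -> nat) :=
  @cpoly_app3 A nat_dt (seq_dt nat_dt) nat_dt nat_dt p dn a b c ptime_dn.
Definition cpoly_partner (A : dtype) p (a : A -> seq (nat * nat)) (b : A -> nat) :=
  @cpoly_app2 A (seq_dt (prod_dt nat_dt nat_dt)) nat_dt nat_dt p partner a b ptime_partner.

Lemma ptime_app : ptime (fun z : seq (nat * nat) * (nat * ((nat * seq nat) * nat)) =>
  app z.1 z.2.1 z.2.2.1 z.2.2.2).
Proof.
rewrite /app; apply: cpoly_if; first by pauto.
  by apply: cpoly_partner; pauto.
by apply: cpoly_if; [pauto | apply: cpoly_up; pauto | apply: cpoly_dn; pauto].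
Qed.

Lemma ptime_moves : ptime moves.
Proof. by rewrite /moves; pauto. Qed.

Lemma ptime_close : ptime (fun z : seq (nat * nat) * (nat * (seq (nat * seq nat) * seq nat)) =>
  close z.1 z.2.1 z.2.2.1 z.2.2.2).
Proof.
rewrite /close; pauto.
by apply: (@cpoly_app4 _ (seq_dt (prod_dt nat_dt nat_dt)) nat_dt (prod_dt nat_dt (seq_dt nat_dt)) nat_dt
  nat_dt _ app _ _ _ _ ptime_app); pauto.
Qed.

Lemma ptime_pat : ptime (fun z : seq (seq nat) * seq nat => pat z.1 z.2).
Proof. by rewrite /pat; pauto; apply: cpoly_memn; pauto. Qed.

Lemma ptime_undupl : ptime undupl.
Proof.
rewrite /undupl; apply: (@ptime_foldl (seq_dt (seq_dt nat_dt)) (seq_dt (seq_dt nat_dt)) (seq_dt nat_dt)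
  (fun _ s c => if meml c s then s else c :: s) (fun=> [::]) (fun x => x)).
- by apply: cpoly_if; [apply: cpoly_meml; pauto | pauto | pauto].
- by pauto.
- by pauto.
exists 1 => x K i hK hx; rewrite expn1.
have : dfits K (take i x : seq_dt (seq_dt nat_dt)) by apply: dfits_take.
move: (take i x) => {hx}x [h1 h2]; split.
  apply: leq_trans h1; elim/last_ind: x {h2} => // x c IH.
  by rewrite foldl_rcons size_rcons; case: ifP => _ /=; rewrite ?ltnS // ltnW.
elim/last_ind: x {h1} h2 => // x c IH; rewrite foldl_rcons -cats1 foldr_cat => h2.
have [h3 h4] : foldr (fun (y : seq_dt nat_dt) q => dfits K y /\ q) True x /\ dfits K (c : seq_dt nat_dt).
  by elim: x {IH} h2 => [|y x IH] /= [h5 h6]; [split|have [? ?] := IH h6; split].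
by case: ifP => _; [exact: IH | split=> //; exact: IH].
Qed.

Lemma ptime_classes : ptime classes.
Proof.
rewrite /classes; pauto.
by apply: (@cpoly_app _ _ _ _ _ _ ptime_undupl); pauto.
Qed.

Lemma ptime_meets : ptime (fun z : seq (nat * nat) * (nat * nat) => meets z.1 z.2.1 z.2.2).
Proof. by rewrite /meets; repeat first [progress pauto | apply: cpoly_partner]. Qed.


Definition cpoly_meets (A : dtype) p (a : A -> seq (nat * nat)) (b c : A -> nat) :=
  @cpoly_app3 A (seq_dt (prod_dt nat_dt nat_dt)) nat_dt nat_dt bool_dt p meets a b c ptime_meets.

Ltac pmore := lazymatch goal with
  | |- cpoly _ (fun x => head (0, [::]) _) => apply: cpoly_headd; first by pauto
  | |- cpoly _ (fun x => memn _ _) => apply: cpoly_memn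
  | |- cpoly _ (fun x => meml _ _) => apply: cpoly_meml
  | |- cpoly _ (fun x => meets _ _ _) => apply: cpoly_meets
  | |- cpoly _ (fun x => partner _ _) => apply: cpoly_partner
  end.
Ltac puser ::= first [pmore | plist | peta].

Lemma ptime_entry : ptime (fun z : seq (nat * nat) * (seq (seq nat) * (seq (seq nat) *
    (nat * (seq nat * seq (nat * seq (seq nat)))))) =>
  entry z.1 z.2.1 z.2.2.1 z.2.2.2.1 z.2.2.2.2.1 z.2.2.2.2.2).
Proof. by rewrite /entry; cbv zeta; pauto. Qed.

Lemma entry_fits K tab labtab all t s ents : dfits K (all : seq_dt (seq_dt nat_dt)) ->
  dfits K (entry tab labtab all t s ents : prod_dt nat_dt (seq_dt (seq_dt nat_dt))).
Proof.
move=> h; rewrite /entry; do 7 (case: (t == _); first by split=> //; apply: dfits_filter).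
by split=> //; apply: dfits_filter.
Qed.

Lemma cpoly_entry (A : dtype) p (a : A -> seq (nat * nat)) (b c : A -> seq (seq nat)) (d : A -> nat)
    (e : A -> seq nat) (f : A -> seq (nat * seq (seq nat))) :
  cpoly p a -> cpoly p b -> cpoly p c -> cpoly p d -> cpoly p e -> cpoly p f ->
  cpoly p (fun x => entry (a x) (b x) (c x) (d x) (e x) (f x)).
Proof.
move=> ha hb hc hd he hf.
by apply: (cpoly_app ptime_entry (f := fun x => (a x, (b x, (c x, (d x, (e x, f x))))))); pauto.
Qed.

Lemma ptime_dp : ptime (fun z : seq (nat * nat) * (seq (seq nat) * (seq (seq nat) * seq nat)) =>
  dp z.1 z.2.1 z.2.2.1 z.2.2.2).
Proof.
rewrite /dp; apply: cpoly_snd.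
pose E := prod_dt (seq_dt (prod_dt nat_dt nat_dt)) (prod_dt (seq_dt (seq_dt nat_dt))
  (prod_dt (seq_dt (seq_dt nat_dt)) (seq_dt nat_dt))).
pose S := prod_dt (seq_dt nat_dt) (seq_dt (prod_dt nat_dt (seq_dt (seq_dt nat_dt)))).
apply: (@ptime_foldl E S nat_dt
  (fun z st t => (t :: st.1, entry z.1 z.2.1 z.2.2.1 t st.1 st.2 :: st.2))
  (fun=> ([::], [::])) (fun z => rev z.2.2.2)).
- apply: cpoly_pair; first by pauto.
  apply: cpoly_cons; last by pauto.
  by apply: cpoly_entry; pauto.
- by pauto.
- by pauto.
exists 1 => z K i hK hz; rewrite expn1.
have : dfits K (take i (rev z.2.2.2) : seq_dt nat_dt).
  by apply: dfits_take; apply: dfits_rev; case: hz => _ [_ []].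
case: hz => _ [_ [ha _]]; move: (take i _) => r [hr _].
suff : let st := foldl (fun (st : S) (t : nat) => (t :: st.1, entry z.1 z.2.1 z.2.2.1 t st.1 st.2 :: st.2)) ([::], [::]) r in
    [/\ size st.1 = size r, size st.2 = size r &
      foldr (fun (y : prod_dt nat_dt (seq_dt (seq_dt nat_dt))) q => dfits K y /\ q) True st.2].
  move=> [h1 h2 h3]; split; split; rewrite ?h1 ?h2 //.
  by move: (X in foldr _ _ X); elim.
elim/last_ind: r {hr} => // r t IH; rewrite foldl_rcons size_rcons /=.
by case: IH => -> -> h; split=> //; split=> //; apply: entry_fits.
Qed.

Lemma ptime_mulw : ptime (fun z : seq nat * (nat * nat) => mulw z.1 z.2.1 z.2.2).
Proof. by rewrite /mulw; pauto. Qed.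
Definition cpoly_mulw (A : dtype) p (a : A -> seq nat) (b c : A -> nat) :=
  @cpoly_app3 A (seq_dt nat_dt) nat_dt nat_dt nat_dt p mulw a b c ptime_mulw.

Lemma ptime_iotaw : ptime (fun z : seq nat * nat => iotaw z.1 z.2).
Proof.
rewrite /iotaw; apply: cpoly_rev; apply: cpoly_snd.
apply: (@ptime_foldl (prod_dt (seq_dt nat_dt) nat_dt) (prod_dt nat_dt (seq_dt nat_dt)) nat_dt
  (fun z s _ => if s.1 < z.2 then (s.1.+1, s.1 :: s.2) else s) (fun=> (0, [::])) (fun z => z.1)).
- by pauto.
- by pauto.
- by pauto.
exists 1 => -[w n] K i hK [hw _]; rewrite expn1 /=; split=> //; split; last by elim: (_.2).
have : dfits K (take i w : seq_dt nat_dt) by apply: dfits_take.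
move: (take i w) => v [hv _]; apply: leq_trans hv.
elim/last_ind: v => // v x IH; rewrite foldl_rcons size_rcons; case: ifP => _ //=.
exact: leqW.
Qed.
Definition cpoly_iotaw (A : dtype) p (a : A -> seq nat) (b : A -> nat) :=
  @cpoly_app2 A (seq_dt nat_dt) nat_dt (seq_dt nat_dt) p iotaw a b ptime_iotaw.

Lemma ptime_offL : ptime offL.
Proof. by rewrite /offL; pauto; apply: cpoly_mulw; pauto. Qed.
Definition cpoly_offL (A : dtype) p (a : A -> seq nat) := @cpoly_app A (seq_dt nat_dt) nat_dt p a offL ptime_offL.
Lemma ptime_offR : ptime offR.
Proof. by rewrite /offR; pauto; [apply: cpoly_offL | apply: cpoly_mulw]; pauto. Qed.
Definition cpoly_offR (A : dtype) p (a : A -> seq nat) := @cpoly_app A (seq_dt nat_dt) nat_dt p a offR ptime_offR.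
Lemma ptime_codeof : ptime codeof.
Proof. by rewrite /codeof; pauto; apply: cpoly_offR; pauto. Qed.

Lemma ptime_posw : ptime (fun z : seq nat * (nat * nat) => posw z.1 z.2.1 z.2.2).
Proof.
rewrite /posw; repeat first [progress pauto | apply: cpoly_mulw | apply: cpoly_offR].
Qed.
Definition cpoly_posw (A : dtype) p (a : A -> seq nat) (b c : A -> nat) :=
  @cpoly_app3 A (seq_dt nat_dt) nat_dt nat_dt nat_dt p posw a b c ptime_posw.

Lemma ptime_labbit : ptime (fun z : seq nat * (nat * nat) => labbit z.1 z.2.1 z.2.2).
Proof.
rewrite /labbit; repeat first [progress pauto | apply: cpoly_mulw | apply: cpoly_offL].
Qed.
Definition cpoly_labbit (A : dtype) p (a : A -> seq nat) (b c : A -> nat) :=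
  @cpoly_app3 A (seq_dt nat_dt) nat_dt nat_dt bool_dt p labbit a b c ptime_labbit.

Lemma ptime_arcsw : ptime arcsw.
Proof.
rewrite /arcsw; apply: ptime_map; last by apply: cpoly_iotaw; pauto.
by repeat first [progress pauto | apply: cpoly_posw].
Qed.

Lemma ptime_nested : ptime (fun z : seq (nat * nat) * seq (nat * nat) => nested z.1 z.2).
Proof. by rewrite /nested /nest /wrap; pauto. Qed.

Lemma ptime_chains : ptime chains.
Proof.
rewrite /chains; apply: cpoly_snd.
pose T := seq_dt (prod_dt nat_dt nat_dt).
have hn (A : dtype) (p : A -> nat -> Prop) (f g : A -> T) : cpoly p f -> cpoly p g -> cpoly p (fun x => nested (f x) (g x) : T).
  exact: (@cpoly_app2 A T T T p nested f g ptime_nested).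
apply: (@ptime_foldl T (prod_dt T (seq_dt nat_dt)) (prod_dt nat_dt nat_dt)
  (fun tab s _ => (nested tab s.1, [seq q.1 | q <- nested tab s.1] ++ s.2)) (fun tab => (tab, [::])) (fun tab => tab)).
- by repeat first [progress pauto | apply: hn].
- by pauto.
- by pauto.
exists 2 => tab K i hK hx.
have h1 : dfits K (take i tab : T) by apply: dfits_take.
have nfit R : dfits K (nested tab R : T) by apply: dfits_filter.
have hK2 : K <= K ^ 2 by apply: (@exp_le K 1 2).
suff : let st := foldl (fun (s : prod_dt T (seq_dt nat_dt)) (_ : nat * nat) =>
     (nested tab s.1, [seq q.1 | q <- nested tab s.1] ++ s.2)) (tab, [::]) (take i tab) in
    dfits K st.1 /\ size st.2 <= size (take i tab) * K.
  case=> h2 h3; split; first exact: dfits_le hK2 h2.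
  split; last by elim: (_.2).
  by apply: leq_trans h3 _; rewrite expnS expn1 leq_mul2r; case: h1 => ->; rewrite orbT.
elim/last_ind: (take i tab) {h1} => [|r q IH]; first by split.
rewrite foldl_rcons size_rcons; case: IH => h2 h3; split=> /=; first exact: nfit.
rewrite size_cat size_map mulSn; apply: leq_add => //.
by case: (nfit (foldl (fun (s : prod_dt T (seq_dt nat_dt)) (_ : nat * nat) =>
     (nested tab s.1, [seq q.1 | q <- nested tab s.1] ++ s.2)) (tab, [::]) r).1).
Qed.

Lemma ptime_height : ptime (fun z : seq nat * (nat * nat) => height z.1 z.2).
Proof. by rewrite /height; pauto. Qed.

Lemma ptime_colours : ptime (fun z : seq nat * (seq nat * (seq nat * seq (nat * (nat * nat)))) =>
  colours z.1 z.2.1 z.2.2.1 z.2.2.2).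
Proof.
have hh (A : dtype) (p : A -> nat -> Prop) (f : A -> seq nat) (g : A -> nat * nat) :
   cpoly p f -> cpoly p g -> cpoly p (fun x => height (f x) (g x)).
  exact: (@cpoly_app2 A (seq_dt nat_dt) (prod_dt nat_dt nat_dt) nat_dt p height f g ptime_height).
by rewrite /colours /colour /wrap; repeat first [progress pauto | apply: hh | apply: cpoly_labbit].
Qed.

Lemma ptime_labtabw : ptime (fun z : seq nat * (seq nat * seq (nat * (nat * nat))) =>
  labtabw z.1 z.2.1 z.2.2).
Proof. by rewrite /labtabw; repeat first [progress pauto | apply: cpoly_labbit]. Qed.

Lemma ptime_ptsof : ptime ptsof.
Proof. by rewrite /ptsof; pauto. Qed.
Lemma ptime_topof : ptime topof.
Proof. by rewrite /topof; pauto. Qed.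
Lemma ptime_predsw : ptime (fun z : nat * seq (nat * seq nat) => predsw z.1 z.2).
Proof. by rewrite /predsw; pauto; apply: (cpoly_app ptime_classes); pauto. Qed.

Lemma ptime_tabw : ptime tabw.
Proof. by rewrite /tabw; pauto; apply: (cpoly_app ptime_arcsw); pauto. Qed.
Lemma ptime_ptsw : ptime ptsw.
Proof. exact: cpoly_app ptime_ptsof ptime_tabw. Qed.
Lemma ptime_topw : ptime topw.
Proof. exact: cpoly_app ptime_topof ptime_ptsw. Qed.
Lemma ptime_leftsw : ptime leftsw.
Proof. by rewrite /leftsw; pauto; apply: ptime_tabw. Qed.
Lemma ptime_coloursw : ptime coloursw.
Proof.
apply: (cpoly_app ptime_colours (f := fun w => (w, (codeof w, (chains (tabw w), arcsw w))))).
apply: cpoly_pair; first by pauto.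
apply: cpoly_pair; first exact: ptime_codeof.
apply: cpoly_pair; last exact: ptime_arcsw.
exact: cpoly_app ptime_chains ptime_tabw.
Qed.
Lemma ptime_preds0w : ptime preds0w.
Proof. exact: (cpoly_app ptime_predsw (cpoly_pair ptime_topw ptime_coloursw)). Qed.

Lemma cpoly_compr (A B C : dtype) p (r : B -> nat -> Prop) (f : A -> B) (g : B -> C) :
  cpoly p f -> cpoly (fun z K => dfits K z /\ r z K) g ->
  (forall z K K', K <= K' -> r z K -> r z K') -> (forall x K, p x K -> r (f x) K) ->
  cpoly p (fun x => g (f x)).
Proof.
move=> hf hg rle hr; apply: (cpoly_comp hf hg); case: hf => T [e [_ h]].
exists e => x K hK hp; have [_ hx] := h x K hK hp; split.
  by apply: dfits_le hx; apply: exp_le.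
by apply: rle (hr _ _ hp); rewrite -{1}[K]expn1; apply: exp_le.
Qed.

Notation Tab := (seq (nat * nat)).
Notation Move := (nat * seq nat)%type.

Lemma cpoly_close (A : dtype) p (a : A -> Tab) (b : A -> nat) (c : A -> seq Move) (d : A -> seq nat) :
  cpoly p a -> cpoly p b -> cpoly p c -> cpoly p d -> cpoly p (fun x => close (a x) (b x) (c x) (d x)).
Proof.
exact: (@cpoly_app4 A (seq_dt (prod_dt nat_dt nat_dt)) nat_dt (seq_dt (prod_dt nat_dt (seq_dt nat_dt)))
  (seq_dt nat_dt) (seq_dt nat_dt) p close a b c d ptime_close).
Qed.

(** The closures are exponentially long in [size u], so they cannot be bounded from their arguments.
    Instead all stages of the loop are required to fit into [K], and this is verified later with a
    [K] that depends on the parameters. *)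
Definition closes K tab top (u : seq nat) ms l : Prop :=
  forall q r, u = q ++ r -> dfits K (closeN tab top q ms l : seq_dt nat_dt).

Lemma closes_le K K' tab top u ms l : K <= K' -> closes K tab top u ms l -> closes K' tab top u ms l.
Proof. by move=> h H q r /H; apply: dfits_le. Qed.

Lemma cpoly_closeN : cpoly (fun (z : Tab * (nat * (seq nat * (seq Move * seq nat)))) K =>
    dfits K z /\ closes K z.1 z.2.1 z.2.2.1 z.2.2.2.1 z.2.2.2.2)
  (fun z => closeN z.1 z.2.1 z.2.2.1 z.2.2.2.1 z.2.2.2.2).
Proof.
set p := (X in cpoly X _).
have hid : cpoly p (fun z => z) by apply: cpoly_weak (@ptime_id _) => z K [].
rewrite /closeN; apply: (@cpoly_foldl _ (seq_dt nat_dt) nat_dt p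
  (fun z s _ => close z.1 z.2.1 z.2.2.2.1 s) (fun z => z.2.2.2.2) (fun z => z.2.2.1)).
- by apply: cpoly_close; pauto.
- by [].
- by pauto.
- by pauto.
exists 1 => z K i hK [_ h]; rewrite expn1; apply: (h _ (drop i z.2.2.1)).
by rewrite cat_take_drop.
Qed.

Lemma cpoly_key : cpoly (fun (z : Tab * (nat * (seq nat * (seq (seq nat) * nat)))) K =>
    dfits K z /\ closes K z.1 z.2.1 z.2.2.1 (moves z.2.2.2.1) [:: z.2.2.2.2])
  (fun z => key z.1 z.2.1 z.2.2.1 z.2.2.2.1 z.2.2.2.2).
Proof.
set p := (X in cpoly X _).
have hid : cpoly p (fun z => z) by apply: cpoly_weak (@ptime_id _) => z K [].
rewrite /key; apply: (@cpoly_app2 _ (seq_dt (seq_dt nat_dt)) (seq_dt nat_dt) (seq_dt nat_dt) p pat _ _ ptime_pat).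
  by pauto.
apply: (cpoly_compr (f := fun z : Tab * (nat * (seq nat * (seq (seq nat) * nat))) =>
  (z.1, (z.2.1, (z.2.2.1, (moves z.2.2.2.1, [:: z.2.2.2.2]))))) _ cpoly_closeN).
- by pauto; apply: (cpoly_app ptime_moves); pauto.
- by move=> z K K'; apply: closes_le.
- by move=> z K [].
Qed.

Lemma cpoly_refine : cpoly (fun (z : Tab * (nat * (seq nat * (seq nat * seq (seq nat))))) K =>
    dfits K z /\ forall x, x \in z.2.2.2.1 -> closes K z.1 z.2.1 z.2.2.1 (moves z.2.2.2.2) [:: x])
  (fun z => refine z.1 z.2.1 z.2.2.1 z.2.2.2.1 z.2.2.2.2).
Proof.
set p := (X in cpoly X _).
have hid : cpoly p (fun z => z) by apply: cpoly_weak (@ptime_id _) => z K [].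
rewrite /refine; apply: cpoly_cat; first by pauto.
apply: (cpoly_app ptime_classes).
pose A : dtype := prod_dt (seq_dt (prod_dt nat_dt nat_dt)) (prod_dt nat_dt (prod_dt (seq_dt nat_dt)
  (prod_dt (seq_dt nat_dt) (seq_dt (seq_dt nat_dt))))).
pose q (z : A * nat) K := dfits K z /\ closes K z.1.1 z.1.2.1 z.1.2.2.1 (moves z.1.2.2.2.2) [:: z.2].
apply: (@cpoly_map_gen A nat_dt (prod_dt nat_dt (seq_dt nat_dt)) p q
  (fun z x => (x, key z.1 z.2.1 z.2.2.1 z.2.2.2.2 x)) (fun z => z.2.2.2.1)) => //.
- by move=> z K K' h [h1 h2]; split; [apply: dfits_le h1 | apply: closes_le h2].
- have hid' : cpoly q (fun z => z) by apply: cpoly_weak (@ptime_id _) => z K [].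
  apply: cpoly_pair; first by pauto.
  apply: (cpoly_compr (f := fun z : A * nat => (z.1.1, (z.1.2.1, (z.1.2.2.1, (z.1.2.2.2.2, z.2))))) _ cpoly_key).
  + by pauto.
  + by move=> z K K'; apply: closes_le.
  + by move=> z K [].
- by pauto.
exists 0 => z K hK [h1 h2] u y v e; rewrite expn1; split; last by apply: h2; rewrite e mem_cat mem_head orbT.
split=> //.
Qed.

Definition levels_fit K tab top (u pts : seq nat) preds0 (v : seq nat) : Prop :=
  forall q r, v = q ++ r ->
  let P := foldl (fun s (_ : nat) => refine tab top u pts s) preds0 q in
  dfits K (P : seq_dt (seq_dt nat_dt)) /\ forall x, x \in pts -> closes K tab top u (moves P) [:: x].

Lemma levels_fit_le K K' tab top u pts preds0 v : K <= K' ->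
  levels_fit K tab top u pts preds0 v -> levels_fit K' tab top u pts preds0 v.
Proof.
move=> h H q r /H [h1 h2]; split; first by apply: dfits_le h1.
by move=> x /h2; apply: closes_le.
Qed.

Lemma cpoly_levels : cpoly
  (fun (z : Tab * (nat * (seq nat * (seq nat * (seq (seq nat) * seq nat))))) K =>
    dfits K z /\ levels_fit K z.1 z.2.1 z.2.2.1 z.2.2.2.1 z.2.2.2.2.1 z.2.2.2.2.2)
  (fun z => foldl (fun s (_ : nat) => refine z.1 z.2.1 z.2.2.1 z.2.2.2.1 s) z.2.2.2.2.1 z.2.2.2.2.2).
Proof.
set p := (X in cpoly X _).
have hid : cpoly p (fun z => z) by apply: cpoly_weak (@ptime_id _) => z K [].
pose A : dtype := prod_dt (seq_dt (prod_dt nat_dt nat_dt)) (prod_dt nat_dt (prod_dt (seq_dt nat_dt)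
  (prod_dt (seq_dt nat_dt) (prod_dt (seq_dt (seq_dt nat_dt)) (seq_dt nat_dt))))).
pose pb (z : A * (seq (seq nat) * nat)) K := dfits K z /\ forall x, x \in z.1.2.2.2.1 ->
  closes K z.1.1 z.1.2.1 z.1.2.2.1 (moves z.2.1) [:: x].
apply: (@cpoly_foldl_gen A (seq_dt (seq_dt nat_dt)) nat_dt p pb
  (fun z s _ => refine z.1 z.2.1 z.2.2.1 z.2.2.2.1 s) (fun z => z.2.2.2.2.1) (fun z => z.2.2.2.2.2)).
- have hid' : cpoly pb (fun z => z) by apply: cpoly_weak (@ptime_id _) => z K [].
  apply: (cpoly_compr (f := fun z : A * (seq (seq nat) * nat) =>
     (z.1.1, (z.1.2.1, (z.1.2.2.1, (z.1.2.2.2.1, z.2.1))))) _ cpoly_refine).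
  + by pauto.
  + by move=> z K K' h H x /H; apply: closes_le.
  + by move=> z K [].
- by [].
- by pauto.
- by pauto.
exists 0 => z K hK [h1 h2]; rewrite expn1; split; last first.
  by have [] := h2 z.2.2.2.2.2 [::] (esym (cats0 _)).
by move=> q y r e; have [h3 h4] := h2 _ _ e; split; [split|].
Qed.

Notation Plays := (seq nat * (seq (seq nat) * seq (seq nat)))%type.

Lemma cpoly_play_step : cpoly
  (fun (z : Tab * (nat * (seq nat * (seq Move * (seq nat * Plays))))) K =>
    dfits K z /\ closes K z.1 z.2.1 z.2.2.1 z.2.2.2.1 z.2.2.2.2.2.1)
  (fun z => play_step z.1 z.2.1 z.2.2.1 z.2.2.2.1 z.2.2.2.2.1 z.2.2.2.2.2).
Proof.
set p := (X in cpoly X _).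
have hid : cpoly p (fun z => z) by apply: cpoly_weak (@ptime_id _) => z K [].
have hl : cpoly p (fun z => closeN z.1 z.2.1 z.2.2.1 z.2.2.2.1 z.2.2.2.2.2.1).
  apply: (cpoly_compr (f := fun z : Tab * (nat * (seq nat * (seq Move * (seq nat * Plays)))) =>
    (z.1, (z.2.1, (z.2.2.1, (z.2.2.2.1, z.2.2.2.2.2.1))))) _ cpoly_closeN).
  + by pauto.
  + by move=> z K K'; apply: closes_le.
  + by move=> z K [].
have hc : cpoly p (fun z => flatten [seq [seq x :: e | e <- z.2.2.2.2.2.2.1] |
    x <- closeN z.1 z.2.1 z.2.2.1 z.2.2.2.1 z.2.2.2.2.2.1 & memn x z.2.2.2.2.1]).
  have h : ptime (fun y : seq nat * (seq nat * seq (seq nat)) =>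
     flatten [seq [seq x :: e | e <- y.2.2] | x <- y.1 & memn x y.2.1]) by pauto.
  by apply: (cpoly_app h (cpoly_pair hl (cpoly_pair _ _))); pauto.
by rewrite /play_step; cbv zeta; pauto.
Qed.

Definition plays_fit K tab top (u : seq nat) ms lefts (v : seq nat) : Prop :=
  forall q r, v = q ++ r ->
  let st := plays tab top u ms lefts q in
  dfits K (st : prod_dt (seq_dt nat_dt) (prod_dt (seq_dt (seq_dt nat_dt)) (seq_dt (seq_dt nat_dt)))) /\
  closes K tab top u ms st.1.

Lemma plays_fit_le K K' tab top u ms lefts v : K <= K' ->
  plays_fit K tab top u ms lefts v -> plays_fit K' tab top u ms lefts v.
Proof.
by move=> h H q r /H [h1 h2]; split; [apply: dfits_le h1 | apply: closes_le h2].
Qed.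

Lemma cpoly_plays : cpoly (fun (z : Tab * (nat * (seq nat * (seq Move * (seq nat * seq nat))))) K =>
    dfits K z /\ plays_fit K z.1 z.2.1 z.2.2.1 z.2.2.2.1 z.2.2.2.2.1 z.2.2.2.2.2)
  (fun z => plays z.1 z.2.1 z.2.2.1 z.2.2.2.1 z.2.2.2.2.1 z.2.2.2.2.2).
Proof.
set p := (X in cpoly X _).
have hid : cpoly p (fun z => z) by apply: cpoly_weak (@ptime_id _) => z K [].
pose A : dtype := prod_dt (seq_dt (prod_dt nat_dt nat_dt)) (prod_dt nat_dt (prod_dt (seq_dt nat_dt)
  (prod_dt (seq_dt (prod_dt nat_dt (seq_dt nat_dt))) (prod_dt (seq_dt nat_dt) (seq_dt nat_dt))))).
pose S : dtype := prod_dt (seq_dt nat_dt) (prod_dt (seq_dt (seq_dt nat_dt)) (seq_dt (seq_dt nat_dt))).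
pose pb (z : A * (S * nat)) K := dfits K z /\ closes K z.1.1 z.1.2.1 z.1.2.2.1 z.1.2.2.2.1 z.2.1.1.
rewrite /plays; apply: (@cpoly_foldl_gen A S nat_dt p pb
  (fun z s _ => play_step z.1 z.2.1 z.2.2.1 z.2.2.2.1 z.2.2.2.2.1 s)
  (fun z => ([:: 0], ([:: [::]], [:: [::]]))) (fun z => z.2.2.2.2.2)).
- have hid' : cpoly pb (fun z => z) by apply: cpoly_weak (@ptime_id _) => z K [].
  apply: (cpoly_compr (f := fun z : A * (S * nat) =>
     (z.1.1, (z.1.2.1, (z.1.2.2.1, (z.1.2.2.2.1, (z.1.2.2.2.2.1, z.2.1)))))) _ cpoly_play_step).
  + by pauto.
  + by move=> z K K'; apply: closes_le.
  + by move=> z K [].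
- by [].
- by pauto.
- by pauto.
exists 0 => z K hK [h1 h2]; rewrite expn1; split; last first.
  by have [] := h2 z.2.2.2.2.2 [::] (esym (cats0 _)).
by move=> q y r e; have [h3 h4] := h2 _ _ e; split; [split|].
Qed.

(** Collects the values that may exceed every polynomial in the input: the clock, the classes of all
    levels, and the layers with their assignments. *)
Definition run_fits (w : seq nat) (K : nat) : Prop :=
  [/\ dfits K w, size (uw w) <= K,
    levels_fit K (tabw w) (topw w) (uw w) (ptsw w) (preds0w w) (codeof w) &
    plays_fit K (tabw w) (topw w) (uw w) (moves (levelw w)) (leftsw w) (codeof w)].

Lemma cpoly_alg : cpoly run_fits alg.
Proof.
have of_p (B : dtype) (f : seq nat -> B) : ptime f -> cpoly run_fits f.
  by apply: cpoly_weak => w K [].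
have hu : cpoly run_fits uw.
  rewrite /uw /unary; apply: (@cpoly_foldl (seq_dt nat_dt) (seq_dt nat_dt) nat_dt run_fits
    (fun _ s _ => s ++ (s ++ (s ++ (s ++ s)))) (fun=> [:: 0]) codeof).
  - by pauto.
  - exact: of_p (ptime_id _).
  - by pauto.
  - exact: of_p ptime_codeof.
  exists 1 => w K i hK [_ h _ _]; rewrite expn1; split; last by elim: (foldl _ _ _).
  apply: leq_trans h; rewrite /uw !size_unary leq_exp2l //.
  by rewrite size_take_min geq_minr.
have hlev : cpoly run_fits levelw.
  apply: (cpoly_compr (f := fun w => (tabw w, (topw w, (uw w, (ptsw w, (preds0w w, codeof w)))))) _ cpoly_levels).
  - do ?apply: cpoly_pair => //; apply: of_p.
    + exact: ptime_tabw.
    + exact: ptime_topw.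
    + exact: ptime_ptsw.
    + exact: ptime_preds0w.
    + exact: ptime_codeof.
  - by move=> z K K'; apply: levels_fit_le.
  - by move=> w K [].
have hpl : cpoly run_fits playsw.
  apply: (cpoly_compr (f := fun w => (tabw w, (topw w, (uw w, (moves (levelw w), (leftsw w, codeof w)))))) _ cpoly_plays).
  - do ?apply: cpoly_pair => //.
    + exact: of_p ptime_tabw.
    + exact: of_p ptime_topw.
    + exact: cpoly_app ptime_moves hlev.
    + exact: of_p ptime_leftsw.
    + exact: of_p ptime_codeof.
  - by move=> z K K'; apply: plays_fit_le.
  - by move=> w K [].
have hdp : cpoly run_fits dpw.
  apply: (cpoly_app ptime_dp (f := fun w => (tabw w, (labtabw w (codeof w) (arcsw w), ((playsw w).2.2, codeof w))))).
  do ?apply: cpoly_pair.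
  - exact: of_p ptime_tabw.
  - apply: of_p; apply: (cpoly_app ptime_labtabw (f := fun w => (w, (codeof w, arcsw w)))).
    by do ?apply: cpoly_pair; [exact: ptime_id | exact: ptime_codeof | exact: ptime_arcsw].
  - by apply: cpoly_snd; apply: cpoly_snd.
  - exact: of_p ptime_codeof.
rewrite /alg; apply: cpoly_meml; first by pauto.
by apply: cpoly_snd; apply: cpoly_headd => //; pauto.
Qed.

(** * Bounds on the number of types and candidates *)

Fixpoint bitlists (m : nat) : seq (seq nat) :=
  if m is m'.+1 then [seq 0 :: b | b <- bitlists m'] ++ [seq 1 :: b | b <- bitlists m'] else [:: [::]].

Lemma size_bitlists m : size (bitlists m) = 2 ^ m.
Proof. by elim: m => //= m IH; rewrite size_cat !size_map IH expnS mul2n addnn. Qed.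

Lemma mem_bitlists b : all (fun x => x < 2) b -> b \in bitlists (size b).
Proof.
elim: b => //= x b IH /andP[hx /IH hb]; rewrite mem_cat; apply/orP.
by case: x hx => [|[|//]] _; [left|right]; apply: map_f.
Qed.

Lemma size_classes (kl : seq (nat * seq nat)) (U : seq (seq nat)) :
  (forall c, c \in [seq p.2 | p <- kl] -> c \in U) -> size (classes kl) <= size U.
Proof.
move=> h; rewrite /classes size_map; apply: uniq_leq_size; last first.
  by move=> c; rewrite mem_undupl => /h.
rewrite /undupl; have E l s : uniq s -> uniq (foldl (fun s c => if meml c s then s else c :: s) s l).
  elim: l s => //= c l IH s hs; apply: IH; rewrite memlE; case: ifP => //= ->; exact: hs.
exact: E.
Qed.

Lemma classes_size kl P : P \in classes kl -> size P <= size kl.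
Proof. by case/mapP => c _ ->; rewrite size_map size_filter count_size. Qed.

Lemma size_moves preds : size (moves preds) = (4 * size preds).+1.
Proof.
rewrite /moves /= size_flatten /shape -map_comp; congr _.+1.
by elim: preds => //= P l ->; rewrite mulnS.
Qed.

(** A round keeps the list and adds its image under each of the [1 + 4 * size preds] moves. *)
Lemma size_closeN tab top u preds l :
  size (closeN tab top u (moves preds) l) = size l * (2 + 4 * size preds) ^ size u.
Proof.
elim/last_ind: u => [|u t IH]; first by rewrite muln1.
rewrite /closeN foldl_rcons -/(closeN _ _ _ _ _) size_rcons /close size_cat size_flatten /shape -map_comp.
rewrite (@eq_map _ _ _ (fun=> size (closeN tab top u (moves preds) l))); last by move=> m; rewrite /= size_map.
have -> : forall (A : Type) (s : seq A) c, sumn [seq c | _ <- s] = size s * c.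
  by move=> A s c; elim: s => //= a s ->.
by rewrite size_moves IH expnS [in RHS]mulnCA -mulSn.
Qed.

(** A key has one row for each of the [m] words, with [m] comparisons and one membership bit per
    class. *)
Lemma key_bits tab top u preds x : let m := (2 + 4 * size preds) ^ size u in
  key tab top u preds x \in bitlists (m * (m + size preds)).
Proof.
rewrite /= /key; set l := closeN _ _ _ _ _.
have sl : size l = (2 + 4 * size preds) ^ size u by rewrite size_closeN mul1n.
rewrite -sl.
have E r : size (flatten [seq [seq nat_of_bool (a < y) | y <- l] ++ [seq nat_of_bool (memn a P) | P <- preds] | a <- r])
    = size r * (size l + size preds).
  by elim: r => //= a r IH; rewrite size_cat IH size_cat !size_map.
rewrite -(E l); apply: mem_bitlists; apply/allP => b /flattenP[s /mapP[a _ ->]].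
by rewrite mem_cat => /orP[] /mapP[? _ ->]; rewrite ltnS leq_b1.
Qed.

(** The [a] old classes and at most one new class for each list of bits that can be a key of radius
    [D]. *)
Definition next_size (D a : nat) : nat :=
  a + 2 ^ ((2 + 4 * a) ^ D * ((2 + 4 * a) ^ D + a)).

Lemma size_refine tab top u pts preds :
  size (refine tab top u pts preds) <= next_size (size u) (size preds).
Proof.
rewrite /refine size_cat leq_add2l -size_bitlists; apply: size_classes => c.
by rewrite -map_comp => /mapP[x _ ->]; apply: key_bits.
Qed.

Lemma next_size_le D a b : a <= b -> next_size D a <= next_size D b.
Proof.
move=> h; have hD : (2 + 4 * a) ^ D <= (2 + 4 * b) ^ D.
  by case: D => // D; rewrite leq_exp2r // leq_add2l leq_mul2l.
rewrite /next_size; apply: leq_add => //; apply: leq_pexp2l => //.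
by apply: leq_mul => //; apply: leq_add.
Qed.

Lemma next_size_ge D i a : a <= iter i (next_size D) a.
Proof. by elim: i => //= i IH; apply: leq_trans IH (leq_addr _ _). Qed.

(** Initially there are the two classes of the sentinels, and colours made of one of [k] heights and
    [l + 2] bits: the side, the passage through 0, and one bit for each token of the code. *)
Definition level_size (k l i : nat) : nat := iter i (next_size (5 ^ l)) (2 + k * 2 ^ (l + 2)).

Lemma level_size_mono k l i j : i <= j -> level_size k l i <= level_size k l j.
Proof. by move=> /subnK <-; rewrite /level_size iterD; apply: next_size_ge. Qed.

(** There are [l] rounds of [5 ^ l] moves; the additional round is due to [plays_fit], which also
    bounds the closure of the last layer. *)
Definition layer_size (k l : nat) : nat := (2 + 4 * level_size k l l) ^ (5 ^ l * l.+1).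

(** The term [l.+1 * layer_size k l ^ l] bounds the assignments of all lengths from 0 to [l]; the
    final [2] keeps the bound above 1. *)
Definition total_size (k l : nat) : nat :=
  5 ^ l + level_size k l l + layer_size k l + l.+1 * layer_size k l ^ l + 2.

Lemma dfits_lists K (l : seq (seq nat)) : size l <= K -> (forall P, P \in l -> size P <= K) ->
  dfits K (l : seq_dt (seq_dt nat_dt)).
Proof.
move=> h1 h2; split=> //; elim: l {h1} h2 => //= P l IH h2; split.
  by split; [apply: h2; rewrite mem_head | elim: (P)].
by apply: IH => Q hQ; apply: h2; rewrite inE hQ orbT.
Qed.

Lemma dfits_nats K (l : seq nat) : size l <= K -> dfits K (l : seq_dt nat_dt).
Proof. by move=> h; split=> //; elim: l {h}. Qed.

Lemma exp_base_le a b d : a <= b -> a ^ d <= b ^ d.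
Proof. by case: d => // d h; rewrite leq_exp2r. Qed.

Section Bounds.
Variables (R : realType) (k L n : nat) (G : lgraph L n) (A : 'I_n -> circ_arc R) (phi : fo L 0).
Notation w := (encode G A phi).
Notation code := (fo_code phi).
Notation l := (size code).
Hypothesis kp : kfold_proper k A.
Variable K : nat.
Hypothesis hK : total_size k l + size w <= K.

Lemma size_uw : size (uw w) = 5 ^ l.
Proof. by rewrite /uw codeof_enc size_unary. Qed.

Lemma size_ptsw : size (ptsw w) = n * 2.
Proof.
rewrite /ptsw /ptsof tabw_enc -map_comp size_flatten /shape -map_comp.
rewrite -[in RHS](size_enum_ord n).
by elim: (enum 'I_n) => //= i s ->.
Qed.

Lemma size_preds0w : size (preds0w w) <= 2 + k * 2 ^ (l + 2).
Proof.
rewrite /preds0w /predsw /= -[_.+2]/(2 + _) leq_add2l.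
have -> : k * 2 ^ (l + 2) = size [seq h :: b | h <- iota 0 k, b <- bitlists (l + 2)].
  by rewrite size_allpairs size_iota size_bitlists.
apply: size_classes => c; rewrite coloursw_enc => /mapP[p /flattenP[s /mapP[i _ ->]] hp ->].
have H b : pcolour G A phi i b \in [seq h :: b | h <- iota 0 k, b <- bitlists (l + 2)].
  apply: allpairs_f; first by rewrite mem_iota add0n; apply: height_lt.
  set bb := (X in X \in _); have -> : l + 2 = size bb by rewrite /= size_map addn2.
  apply: mem_bitlists; apply/allP => x; rewrite !inE => /or3P[/eqP->|/eqP->|/mapP[y _ ->]].
  - by rewrite ltnS leq_b1.
  - by rewrite ltnS leq_b1.
  - by rewrite ltnS leq_b1.
by move: hp; rewrite !inE => /orP[] /eqP->; apply: H.
Qed.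

Lemma K_parts : [/\ 5 ^ l <= K, level_size k l l <= K, layer_size k l <= K,
  l.+1 * layer_size k l ^ l <= K & size w <= K].
Proof. by move: hK; rewrite /total_size; split; lia. Qed.

Lemma pts_le : n * 2 <= K.
Proof. by have [_ _ _ _] := K_parts; rewrite enc_size; lia. Qed.

Lemma levels_size q r : code = q ++ r ->
  let P := foldl (fun s (_ : nat) => refine (tabw w) (topw w) (uw w) (ptsw w) s) (preds0w w) q in
  size P <= level_size k l (size q) /\ forall Q, Q \in P -> size Q <= K.
Proof.
move=> _; elim/last_ind: q => [|q t IH] /=.
  split; first exact: size_preds0w.
  have hp := pts_le; have [hK1 _ _ _ _] := K_parts.
  have hK0 : 0 < K by apply: leq_trans hK1; rewrite expn_gt0.
  move=> Q; rewrite !inE => /or3P[/eqP->|/eqP->|/classes_size h] //.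
  apply: leq_trans h _; rewrite -(size_map (fun c : nat * seq nat => c.1)) coloursw_pts size_ptsw.
  exact: pts_le.
rewrite foldl_rcons size_rcons; case: IH => h1 h2; split.
  apply: leq_trans (size_refine _ _ _ _ _) _; rewrite size_uw /level_size iterS.
  exact: next_size_le.
move=> Q; rewrite mem_cat => /orP[/h2//|/classes_size h].
by apply: leq_trans h _; rewrite size_map size_ptsw; apply: pts_le.
Qed.

Lemma closes_size p c preds lst : size preds <= level_size k l l -> size lst <= c ->
  c * (2 + 4 * level_size k l l) ^ (5 ^ l) <= p -> closes p (tabw w) (topw w) (uw w) (moves preds) lst.
Proof.
move=> h1 h2 h3 q r e; apply: dfits_nats; rewrite size_closeN; apply: leq_trans h3.
apply: leq_mul => //; apply: (@leq_trans ((2 + 4 * level_size k l l) ^ size q)).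
  by apply: exp_base_le; rewrite leq_add2l leq_mul2l.
by apply: leq_pexp2l => //; rewrite -size_uw e size_cat leq_addr.
Qed.

Lemma levels_fit_enc : levels_fit K (tabw w) (topw w) (uw w) (ptsw w) (preds0w w) (codeof w).
Proof.
rewrite codeof_enc => q r e; have [h1 h2] := levels_size e.
have [_ k2 k3 _ _] := K_parts.
have hq : level_size k l (size q) <= level_size k l l.
  by apply: level_size_mono; rewrite e size_cat leq_addr.
split; first by apply: dfits_lists => //; apply: leq_trans h1 (leq_trans hq k2).
move=> x _; apply: (@closes_size _ 1) => //; first exact: leq_trans h1 hq.
rewrite mul1n; apply: leq_trans k3; apply: leq_pexp2l => //.
by rewrite mulnS leq_addr.
Qed.

Lemma layer_gt0 : 0 < layer_size k l. Proof. by rewrite expn_gt0. Qed.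

Lemma plays_size q r : code = q ++ r ->
  let st := plays (tabw w) (topw w) (uw w) (moves (levelw w)) (leftsw w) q in
  [/\ size st.1 <= (2 + 4 * level_size k l l) ^ (5 ^ l * size q),
      size st.2.1 <= layer_size k l ^ size q,
      size st.2.2 <= (size q).+1 * layer_size k l ^ size q &
      forall p, p \in st.2.1 ++ st.2.2 -> size p <= size q].
Proof.
have hlev : size (levelw w) <= level_size k l l.
  by rewrite /levelw codeof_enc; have [] := levels_size (esym (cats0 code)).
elim/last_ind: q r => [|q t IH] r e /=.
  rewrite muln0; split=> // p; rewrite !inE => /orP[] /eqP-> //.
rewrite cat_rcons in e; have [h1 h2 h3 h4] := IH _ e.
rewrite /plays foldl_rcons -/(plays _ _ _ _ _ _) size_rcons.
move: (plays _ _ _ _ _ _) h1 h2 h3 h4 => [lay [cur alls]] /= h1 h2 h3 h4.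
have h5 : size (closeN (tabw w) (topw w) (uw w) (moves (levelw w)) lay) <=
    (2 + 4 * level_size k l l) ^ (5 ^ l * (size q).+1).
  rewrite size_closeN size_uw mulnS [5 ^ l + _]addnC expnD; apply: leq_mul => //.
  by apply: exp_base_le; rewrite leq_add2l leq_mul2l.
have hq : (size q).+1 <= l.+1 by rewrite e size_cat ltnS leq_addr.
have h6 : size (closeN (tabw w) (topw w) (uw w) (moves (levelw w)) lay) <= layer_size k l.
  by apply: leq_trans h5 _; apply: leq_pexp2l => //; rewrite leq_mul2l hq orbT.
move: (closeN _ _ _ _ _) h5 h6 => lay' h5 h6.
have h7 : size (flatten [seq [seq x :: e0 | e0 <- cur] | x <- lay' & memn x (leftsw w)]) <=
    layer_size k l ^ (size q).+1.
  rewrite size_flatten /shape -map_comp (@eq_map _ _ _ (fun=> size cur)); last by move=> x; rewrite /= size_map.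
  have -> : forall s : seq nat, sumn [seq size cur | _ <- s] = size s * size cur.
    by elim=> //= x s ->.
  rewrite expnS; apply: leq_mul => //; apply: leq_trans h6.
  by rewrite size_filter count_size.
split=> //.
  rewrite size_cat mulSn; apply: leq_add => //.
  apply: leq_trans h3 _; rewrite leq_mul2l; apply/orP; right.
  by apply: leq_pexp2l; rewrite ?layer_gt0.
have h8 p : p \in flatten [seq [seq x :: e0 | e0 <- cur] | x <- lay' & memn x (leftsw w)] ->
    size p <= (size q).+1.
  case/flattenP => s /mapP[x _ ->] /mapP[e0 he0 ->] /=; rewrite ltnS; apply: h4.
  by rewrite mem_cat he0.
move=> p; rewrite !mem_cat => /or3P[/h8//|/h8//|hp]; apply: leqW; apply: h4.
by rewrite mem_cat hp orbT.
Qed.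

Lemma plays_fit_enc :
  plays_fit K (tabw w) (topw w) (uw w) (moves (levelw w)) (leftsw w) (codeof w).
Proof.
rewrite codeof_enc => q r e; have [h1 h2 h3 h4] := plays_size e.
have [k1 k2 k3 k4 _] := K_parts.
have hq : size q <= l by rewrite e size_cat leq_addr.
have hlK : l <= K by apply: leq_trans k1; apply: ltnW; apply: ltn_expl.
have hlev : size (levelw w) <= level_size k l l.
  by rewrite /levelw codeof_enc; have [] := levels_size (esym (cats0 code)).
have hpow : layer_size k l ^ size q <= layer_size k l ^ l by apply: leq_pexp2l; rewrite ?layer_gt0.
have hsz p : p \in (plays (tabw w) (topw w) (uw w) (moves (levelw w)) (leftsw w) q).2.1 ++
    (plays (tabw w) (topw w) (uw w) (moves (levelw w)) (leftsw w) q).2.2 -> size p <= K.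
  by move=> /h4 h; apply: leq_trans h (leq_trans hq hlK).
split; last first.
  apply: closes_size hlev h1 _; apply: leq_trans k3; rewrite -expnD; apply: leq_pexp2l => //.
  by rewrite addnC -mulnS leq_mul2l ltnS hq orbT.
split; last split.
- apply: dfits_nats; apply: leq_trans h1 (leq_trans _ k3); apply: leq_pexp2l => //.
  by rewrite leq_mul2l (leqW hq) orbT.
- apply: dfits_lists => [|p hp]; last by apply: hsz; rewrite mem_cat hp.
  apply: leq_trans h2 (leq_trans hpow (leq_trans _ k4)); exact: leq_pmull.
- apply: dfits_lists => [|p hp]; last by apply: hsz; rewrite mem_cat hp orbT.
  by apply: leq_trans h3 (leq_trans _ k4); apply: leq_mul.
Qed.

Lemma run_fits_enc : run_fits w K.
Proof.
have [k1 _ _ _ k5] := K_parts; split.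
- exact: dfits_nats.
- by rewrite size_uw.
- exact: levels_fit_enc.
- exact: plays_fit_enc.
Qed.
End Bounds.

(** * Computability of the bound *)

(** The running time is unrestricted here, so a number may be iterated over by way of [spec_nseq];
    multiplication and powers are obtained in this manner. *)
Definition computes (A B : dtype) (f : A -> B) : Prop := exists T, spec f T.

Lemma computes_comp (A B C : dtype) (f : A -> B) (g : B -> C) :
  computes f -> computes g -> computes (fun x => g (f x)).
Proof. by move=> [T h] [T' h']; eexists; apply: spec_comp h h'. Qed.

Lemma computes_pair (A B C : dtype) (f : A -> B) (g : A -> C) :
  computes f -> computes g -> computes (fun x => (f x, g x)).
Proof. by move=> [T h] [T' h']; eexists; apply: spec_pair h h'. Qed.

Lemma computes_id (A : dtype) : computes (fun x : A => x).
Proof. by eexists; apply: spec_id. Qed.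

Lemma computes_fst (A B C : dtype) (f : A -> B * C) : computes f -> computes (fun x => (f x).1).
Proof. by move=> h; apply: (computes_comp h); eexists; apply: spec_fst. Qed.

Lemma computes_snd (A B C : dtype) (f : A -> B * C) : computes f -> computes (fun x => (f x).2).
Proof. by move=> h; apply: (computes_comp h); eexists; apply: spec_snd. Qed.

Lemma computes_nat (A : dtype) (c : nat) : computes (fun _ : A => c).
Proof. by eexists; apply: spec_nat. Qed.

Lemma computes_add (A : dtype) (f g : A -> nat) :
  computes f -> computes g -> computes (fun x => f x + g x).
Proof.
move=> h h'; apply: (computes_comp (computes_pair h h') (g := fun z : nat * nat => z.1 + z.2)).
by eexists; apply: spec_add.
Qed.

Lemma eq_computes (A B : dtype) (f g : A -> B) : f =1 g -> computes f -> computes g.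
Proof. by move=> e [T h]; exists T; apply: eq_spec h. Qed.

Lemma computes_iter (A S : dtype) (g : A -> S -> S) (m : A -> nat) (s0 : A -> S) :
  computes (fun z : A * S => g z.1 z.2) -> computes m -> computes s0 ->
  computes (fun x => iter (m x) (g x) (s0 x)).
Proof.
move=> hg hm hs.
have [T h] : computes (fun z : (A * S) * nat => (z.1.1, g z.1.1 z.1.2)).
  have h1 : computes (fun z : (A * S) * nat => z.1) by apply: computes_fst; apply: computes_id.
  by apply: computes_pair; [exact: computes_fst | exact: (computes_comp h1 hg)].
have hl : computes (fun x => ((x, s0 x), nseq (m x) 0)).
  apply: computes_pair; first by apply: computes_pair => //; apply: computes_id.
  by apply: (computes_comp hm); eexists; apply: spec_nseq.
have h2 := computes_snd (computes_comp hl (ex_intro _ _ (spec_foldl h))).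
apply: eq_computes h2 => x /=.
by elim: (m x) (s0 x) => //= j IH s; rewrite IH -iterSr.
Qed.

Lemma computes_mul (A : dtype) (f g : A -> nat) :
  computes f -> computes g -> computes (fun x => f x * g x).
Proof.
move=> h h'; apply: (@eq_computes A nat_dt (fun x => iter (f x) (fun s => s + g x) 0)).
  by move=> x; elim: (f x) => //= j ->; rewrite mulSn addnC.
apply: (@computes_iter A nat_dt (fun x s => s + g x)) => //; last exact: computes_nat.
apply: computes_add; first by apply: computes_snd; apply: computes_id.
by apply: (computes_comp _ h'); apply: computes_fst; apply: computes_id.
Qed.

Lemma computes_exp (A : dtype) (f g : A -> nat) :
  computes f -> computes g -> computes (fun x => f x ^ g x).
Proof.
move=> h h'; apply: (@eq_computes A nat_dt (fun x => iter (g x) (fun s => f x * s) 1)).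
  by move=> x; elim: (g x) => //= j ->; rewrite expnS.
apply: (@computes_iter A nat_dt (fun x s => f x * s)) => //; last exact: computes_nat.
apply: computes_mul; last by apply: computes_snd; apply: computes_id.
by apply: (computes_comp _ h); apply: computes_fst; apply: computes_id.
Qed.

Lemma computes_succ (A : dtype) (f : A -> nat) : computes f -> computes (fun x => (f x).+1).
Proof.
move=> h; apply: (@eq_computes A nat_dt (fun x => f x + 1)) => [x|]; first by rewrite addn1.
by apply: computes_add h (computes_nat _ _).
Qed.

Ltac computes_tac := repeat lazymatch goal with
  | |- computes (fun x => x) => exact: computes_id
  | |- computes (fun x => _.1) => apply: computes_fst
  | |- computes (fun x => _.2) => apply: computes_snd
  | |- computes fst => exact: (computes_fst (computes_id _))
  | |- computes snd => exact: (computes_snd (computes_id _))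
  | |- computes (fun x => 0) => exact: computes_nat
  | |- computes (fun x => _ + _) => apply: computes_add
  | |- computes (fun x => _ * _) => apply: computes_mul
  | |- computes (fun x => _ ^ _) => apply: computes_exp
  | |- computes (fun x => _.+1) => apply: computes_succ
  end.

Lemma computes_level_size : computes (fun z : nat * nat => level_size z.1 z.2 z.2).
Proof.
rewrite /level_size; apply: (@computes_iter (prod_dt nat_dt nat_dt) nat_dt
  (fun z s => next_size (5 ^ z.2) s) snd (fun z => 2 + z.1 * 2 ^ (z.2 + 2))).
- by rewrite /next_size; computes_tac.
- by computes_tac.
- by computes_tac.
Qed.

Lemma computes_total_size : computes (fun z : nat * nat => total_size z.1 z.2).
Proof.
have h := computes_level_size; rewrite /total_size /layer_size.
by repeat first [exact: h | progress computes_tac].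
Qed.

Lemma bitsize_ge (s : seq nat) : size s <= bitsize s.
Proof. by rewrite /bitsize; elim: s => [|x s IH]; rewrite ?big_nil // big_cons addSn ltnS (leq_trans IH) // leq_addl. Qed.

Theorem theorem5 (R : realType) :
  exists (P : program) (f : nat -> nat -> nat) (d : nat),
    computable2 f /\
    forall (k L n : nat) (G : lgraph L n) (A : 'I_n -> circ_arc R) (phi : fo L 0),
      represents A G -> kfold_proper k A ->
      run P (f k (fo_size phi) * bitsize (encode G A phi) ^ d)
            (init (encode G A phi))
        = Some (nat_of_bool (models G phi)).
Proof.
have [T [e [hT hb]]] := cpoly_alg.
have [P hP] := spec_run (out := nat_of_bool) (fun m h w x (E : w = nat_of_bool x) => E) hT.
(* Loading the input takes time at most [K ^ 5] and the algorithm [K ^ e]; [exp_sum] adds the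
   two. *)
pose E := 5 + e + 6.
exists P, (fun k l => (total_size k l * 2) ^ E), E; split.
  have [T' h] : computes (fun z : nat * nat => (total_size z.1 z.2 * 2) ^ E).
    by apply: computes_exp; [apply: computes_mul; [exact: computes_total_size | exact: computes_nat] |
      exact: computes_nat].
  exact: spec_computable2 h.
move=> k L n G A phi rep kp; set w := encode G A phi.
rewrite -(alg_models phi rep) -/w; apply: hP.
pose F := total_size k (size (fo_code phi)); pose B := bitsize w.
have hF : 1 < F by rewrite /F /total_size; lia.
have hB : size w <= B by apply: bitsize_ge.
have hw : 1 < size w by rewrite /w enc_size; lia.
(* Replacing the sum by a product separates the parameters from the input: as [B + 1 <= 2 * B], the
   power splits into [(F * 2) ^ E] and [B ^ E]. *)
have hK : F + size w <= F * (B + 1) by rewrite mulnDr muln1 addnC leq_add2r (leq_trans hB) // leq_pmull // ltnW.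
have K1 : 1 < F * (B + 1) by apply: leq_trans hK; lia.
have [h1 _] := hb w _ K1 (run_fits_enc kp hK).
have h2 : 11 * size w + 5 <= (F * (B + 1)) ^ 5.
  apply: (@leq_trans (F * (B + 1) * 16)); first by move: hK hF hw; move: (F * _) (size w); lia.
  rewrite expnS; apply: leq_mul => //; rewrite -[16]/(2 ^ 4); exact: exp_base_le.
have h3 := exp_sum (c := 0) 5 e K1 isT.
apply: leq_trans (leq_add h2 h1) _; apply: (leq_trans (leq_trans (leq_addr 0 _) h3)).
rewrite -/E -/B /fo_size -/F -expnMn; apply: exp_base_le; rewrite -mulnA leq_mul2l.
by apply/orP; right; move: hB hw; move: (size w); lia.
Qed.
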